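(* Let $x:[0,T]\to\mathbb{R}^m$ be Hölder continuous of order $\beta>1/2$, let $\widetilde\Gamma$ be a finite subset of $\Gamma$, $N=\max\{|\alpha|:\alpha\in\widetilde\Gamma\}$, and let $V=(V^i_j)_{1\le i\le d,1\le j\le m}\in C^{N+1}(\mathbb{R}^d;\mathbb{R}^{d\times m})$. Let $y$ be the solution of $dy_t=V(y_t)\,dx_t$ on $[0,T]$ with $y_0\in\mathbb{R}^d$, and let $y^n$ be given by $y^n_0=y_0$ and $$y^n_t=y^n_{t_k}+\widetilde{\mathcal E}^{(N)}_{t_k,t}(y^n_{t_k}),\quad t\in[t_k,t_{k+1}],\ k=0,\dots,n-1,\ t_k=\tfrac{kT}{n}.$$ Let $R^e_{s,t}(y)$, $e=1,2,3,4$, be the remainder functions defined in the context, and let $\Phi,\Psi:[0,T]\to\mathbb{R}^{d\times d}$ be the solutions of $$\Phi_t=I+\sum_{j=1}^m\int_0^t\dot V_j(y_s,y^n_s)\Phi_s\,dx^j_s,\qquad \Psi_t=I-\sum_{j=1}^m\int_0^t\Psi_s\dot V_j(y_s,y^n_s)\,dx^j_s,$$ where here $I$ is the $d\times d$ identity matrix and $\dot V_j(\xi,\xi')=\int_0^1\partial V_j(\lambda\xi+(1-\lambda)\xi')\,d\lambda$. Then for every $t\in[0,T]$ $$y_t-y^n_t=\sum_{e=1}^4\Phi_t\sum_{k=0}^{\lfloor nt/T\rfloor}\int_{t_k}^{t_{k+1}\wedge t}\Psi_s\,dR^e_{t_k,s}(y^n_{t_k})=\sum_{e=1}^4\Phi_t\int_0^t\Psi_s\,dR^e_{\eta(s),s}(y^n_{\eta(s)}),$$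 where $\eta(s)=t_k$ for $s\in[t_k,t_{k+1})$.
   Context: All integrals are (iterated) Riemann–Stieltjes/Young integrals. $\Gamma_r$ is the set of multi-indices of length $r$ with entries in $\{1,\dots,m\}$, $\Gamma=\bigcup_{r\ge1}\Gamma_r$; $\Upsilon_p$ is the set of multi-indices of length $p$ with entries in $\{1,\dots,d\}$, $\Upsilon=\bigcup_{p\ge1}\Upsilon_p$; $|\cdot|$ is length. $\partial_\zeta=\partial_{\zeta_1}\cdots\partial_{\zeta_p}$ for $\zeta\in\Upsilon_p$; $\partial V_j$ is the Jacobian matrix of $V_j=(V_j^1,\dots,V_j^d)$. $\mathcal V_jf=\sum_iV^i_j\partial_if$, $\mathcal V_\gamma=\mathcal V_{\gamma_1}\cdots\mathcal V_{\gamma_r}$; $I(y)=y$, $I_i(y)=y^i$. $x^\gamma_{s,t}=\int_s^t\int_s^{u_r}\cdots\int_s^{u_2}dx^{\gamma_1}_{u_1}\cdots dx^{\gamma_r}_{u_r}$. Taylor expansions: $\mathcal E^{(N)}_{s,t}(y)=\sum_{\gamma\in\Gamma,|\gamma|\le N}\mathcal V_\gamma I(y)x^\gamma_{s,t}$ with components $\mathcal E^i_{s,t}(y)=\sum_{|\gamma|\le N}\mathcal V_\gamma I_i(y)x^\gamma_{s,t}$; $\widetilde{\mathcal E}^{(N)}_{s,t}(y)=\sum_{\gamma\in\widetilde\Gamma}\mathcal V_\gamma I(y)x^\gamma_{s,t}$ with components $\widetilde{\mathcal E}^i_{s,t}(y)$. For $\zeta\in\Upsilon_p$ and a function $f$ of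 time, $\mathcal E^\zeta_{s,t}(f)=\int_s^t\int_s^{u_p}\cdots\int_s^{u_2}f_{u_1}\,d\mathcal E^{\zeta_1}_{s,u_1}\cdots d\mathcal E^{\zeta_p}_{s,u_p}$ (all evaluated at the point $y$), and $\mathcal E^\zeta_{s,t}(y)$ is the case $f\equiv1$; $\widetilde{\mathcal E}^\zeta_{s,t}$ is defined likewise from $\widetilde{\mathcal E}^i$. For $\vec\tau=(\tau_1,\dots,\tau_p)$ with $1\le\tau_1<\dots<\tau_p=r$, $\tau_0=0$: $\Xi_r(\vec\tau)$ is the set of permutations $\rho$ of $\{1,\dots,r\}$ with $\rho(\tau_i)<\rho(\tau_j)$ for $i<j$ and $\rho$ increasing on each block $\{\tau_{i-1}+1,\dots,\tau_i\}$. For $\alpha\in\Gamma_r$, $\zeta\in\Upsilon_p$: $H(\alpha,\zeta,\vec\tau)(y)=\prod_{i=1}^p\mathcal V_{\alpha_{\tau_{i-1}+1}}\cdots\mathcal V_{\alpha_{\tau_i-1}}V^{\zeta_i}_{\alpha_{\tau_i}}(y)$. For an integer $M\ge1$ and $\zeta\in\Upsilon_p$, $$Q(M,p,\zeta)_{s,t}(y)=\sum_{\substack{\gamma^1,\dots,\gamma^p\in\Gamma:\ |\gamma^1|+\cdots+|\gamma^p|>M\\ |\gamma^1|,\dots,|\gamma^p|\le M}}\ \sum_{\rho\in\Xi_{|\gamma|}(\vec\tau(\gamma))}H(\gamma,\zeta,\vec\tau(\gamma))(y)\,x^{\gamma\circ\rho^{-1}}_{s,t},$$ with $\gamma=(\gamma^1,\dots,\gamma^p)$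 the concatenation, $\vec\tau(\gamma)=(\tau_1(\gamma),\dots,\tau_p(\gamma))$, $\tau_i(\gamma)=|\gamma^1|+\cdots+|\gamma^i|$, and $(\gamma\circ\rho^{-1})_i=\gamma_{\rho^{-1}(i)}$ (an empty sum is $0$). Remainders: $R^1_{s,t}(y)=\sum_{\zeta\in\Upsilon_N}\int_s^t\mathcal E^\zeta_{s,u}(y)\partial_\zeta V(y)dx_u+\sum_{\zeta\in\Upsilon:1\le|\zeta|\le N-1}\int_s^tQ(N-1,|\zeta|,\zeta)_{s,u}(y)\partial_\zeta V(y)dx_u$; $R^2_{s,t}(y)=\sum_{\zeta\in\Upsilon_{N+1}}\int_s^t\widetilde{\mathcal E}^\zeta_{s,u}\big(\partial_\zeta V(y+\widetilde{\mathcal E}^{(N)}_{s,\cdot}(y))\big)(y)\,dx_u$; $R^3_{s,t}(y)=\sum_{\zeta\in\Upsilon:1\le|\zeta|\le N}\int_s^t\big(\widetilde{\mathcal E}^\zeta_{s,u}(y)-\mathcal E^\zeta_{s,u}(y)\big)\partial_\zeta V(y)\,dx_u$; $R^4_{s,t}(y)=\mathcal E^{(N)}_{s,t}(y)-\widetilde{\mathcal E}^{(N)}_{s,t}(y)$.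
   Formalization: In R^1 the words in Q have length at most N (not N-1), total length still > N-1, since the printed formula fails for V(y)=y, N=2; and if β<1, the order-(N+1) derivatives of V are assumed locally γ-Hölder for some γ with β(1+γ)>1, as R^2 may be undefined or the formula false for V only C^{N+1}. *)

(* Defs.v *)
From HB Require Import structures.
From mathcomp Require Import all_boot all_order all_algebra all_fingroup finmap.
From mathcomp Require Import all_classical all_reals all_analysis.
Import Order.TTheory GRing.Theory Num.Theory.
Import numFieldNormedType.Exports.

Set Implicit Arguments.
Unset Strict Implicit.
Unset Printing Implicit Defensive.

Local Open Scope classical_set_scope.
Local Open Scope ring_scope.

Section RiemannStieltjes.
Context {R : realType}.
Implicit Types (f g : R -> R) (a b s t v : R).

(* A partition of [a, b] is given, as in [itv_partition], by the points that
   follow a; xi k is the tag in the k-th cell. *)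
Definition rs_sum f g a b (p : seq R) (xi : nat -> R) : R :=
  \sum_(0 <= k < size p)
    f (xi k) * (g (nth b (a :: p) k.+1) - g (nth b (a :: p) k)).

(* Convergence, as the mesh tends to 0, for arbitrary tags.  Only meaningful
   for a <= b. *)
Definition is_RSint f g a b v : Prop :=
  forall e, 0 < e -> exists2 delta, 0 < delta &
    forall (p : seq R) (xi : nat -> R), itv_partition a b p ->
      (forall k, (k < size p)%N ->
        nth b (a :: p) k.+1 - nth b (a :: p) k < delta /\
        nth b (a :: p) k <= xi k <= nth b (a :: p) k.+1) ->
      `|rs_sum f g a b p xi - v| < e.

Definition RSint f g a b : R := xget 0 [set v | is_RSint f g a b v].

Definition RSint_mx p q (F : R -> 'M[R]_(p, q)) g a b : 'M[R]_(p, q) :=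
  \matrix_(i, j) RSint (fun u => F u i j) g a b.

Definition RSint_mulmx p q r (F : R -> 'M[R]_(p, q)) (G : R -> 'M[R]_(q, r)) a b
    : 'M[R]_(p, r) :=
  \matrix_(i, k) \sum_j RSint (fun u => F u i j) (fun u => G u j k) a b.

(* The first path of gs is the innermost integrator. *)
Definition iterated_int f (gs : seq (R -> R)) s : R -> R :=
  foldl (fun F g t => RSint F g s t) f gs.

Definition hoelder_on p q a b (alpha : R) (f : R -> 'M[R]_(p, q)) : Prop :=
  exists C : R, forall s t, a <= s <= b -> a <= t <= b ->
    `|f t - f s| <= C * `|t - s| `^ alpha.

(* Regularity under which Young integrals of f, and of locally Lipschitz
   functions of f, against a beta-Hoelder path exist. *)
Definition young_path p q (T beta : R) (f : R -> 'M[R]_(p, q)) : Prop :=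
  exists alpha : R, [/\ 0 < alpha, 1 < alpha + beta & hoelder_on 0 T alpha f].

End RiemannStieltjes.

Section Derivatives.
Context {R : realType} {d : nat}.
Implicit Types (f : 'cV[R]_d -> R) (zeta : seq 'I_d).

Definition partial (i : 'I_d) f : 'cV[R]_d -> R :=
  fun y => 'D_(delta_mx i 0) f y.

Definition partials zeta f : 'cV[R]_d -> R := foldr partial f zeta.

Definition is_Ck (k : nat) f : Prop :=
  forall zeta, (size zeta <= k)%N ->
    continuous (partials zeta f) /\
    ((size zeta < k)%N ->
      forall i y, derivable (partials zeta f) y (delta_mx i 0)).

(* Used for the derivatives of order N + 1 of V, with beta * (1 + gam) > 1: the
   remainder R2 integrates them along beta-Hoelder paths.  If they are merely
   continuous and beta < 1, the integrals need not exist, and even where they do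
   the chain rule behind R2 can fail (Whitney: a C^1 function that is critical
   but not constant along a snowflake arc). *)
Definition loc_hoelder (gam : R) f : Prop :=
  forall r : R, exists C : R, forall y z : 'cV[R]_d, `|y| <= r -> `|z| <= r ->
    `|f y - f z| <= C * `|y - z| `^ gam.

End Derivatives.

Section TaylorExpansions.
Context {R : realType} {d m : nat}.
Variable (x : R -> 'cV[R]_m) (V : 'cV[R]_d -> 'M[R]_(d, m)).
Implicit Types (s t u : R) (y : 'cV[R]_d) (g : seq 'I_m).

Definition partials_mx (zeta : seq 'I_d) y : 'M[R]_(d, m) :=
  \matrix_(i, j) partials zeta (fun z => V z i j) y.

Definition Jacobian (j : 'I_m) y : 'M[R]_d :=
  \matrix_(i, l) partial l (fun z => V z i j) y.

Definition Vdot (j : 'I_m) (xi xi' : 'cV[R]_d) : 'M[R]_d :=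
  \matrix_(i, l) \int[lebesgue_measure]_(lam in `[0%R, 1%R])
     (Jacobian j (lam *: xi + (1 - lam) *: xi') i l).

Definition vfield (j : 'I_m) (f : 'cV[R]_d -> R) : 'cV[R]_d -> R :=
  fun y => \sum_i V y i j * partial i f y.

Definition vfields g (f : 'cV[R]_d -> R) : 'cV[R]_d -> R := foldr vfield f g.

Definition vfieldsI g y : 'cV[R]_d := \col_i vfields g (fun z => z i 0) y.

Definition xint g s t : R :=
  iterated_int (fun=> 1) [seq (fun u => x u j 0) | j <- g] s t.

Definition Taylor (N : nat) s t y : 'cV[R]_d :=
  \sum_(1 <= r < N.+1) \sum_(g : r.-tuple 'I_m) xint g s t *: vfieldsI g y.

Definition TaylorOn (Gt : {fset seq 'I_m}) s t y : 'cV[R]_d :=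
  \sum_(g <- Gt) xint g s t *: vfieldsI g y.

(* Iterated integral of f along the components of an expansion E, all of them
   started at time s and evaluated at y. *)
Definition Eint (E : R -> R -> 'cV[R]_d -> 'cV[R]_d) (zeta : seq 'I_d)
    (f : R -> R) s t y : R :=
  iterated_int f [seq (fun u => E s u y i 0) | i <- zeta] s t.

Definition Eint1 E (zeta : seq 'I_d) s t y : R := Eint E zeta (fun=> 1) s t y.

(* Positions 1, ..., r of the mathematical text are the ordinals 0, ..., r-1,
   whereas the entries of tau = (tau_1, ..., tau_p) are kept as they are: the
   ordinal of the position tau_i is tau_i - 1, and the i-th block consists of the
   ordinals a with tau_(i-1) <= a < tau_i. *)
Definition Xi (r : nat) (tau : seq nat) : {set 'S_r} :=
  [set rho : 'S_r |
    [forall i : 'I_(size tau), forall j : 'I_(size tau),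
       forall a : 'I_r, forall b : 'I_r,
       [&& (i < j)%N, a.+1 == nth 0%N tau i & b.+1 == nth 0%N tau j]
         ==> (rho a < rho b)%N] &&
    [forall i : 'I_(size tau), forall a : 'I_r, forall b : 'I_r,
       [&& (nth 0 (0 :: tau) i <= a)%N, (a < b)%N & (b < nth 0 tau i)%N]
         ==> (rho a < rho b)%N]].

Definition Hblock (b : seq 'I_m) (i : 'I_d) : 'cV[R]_d -> R :=
  if b is j :: b' then vfields (belast j b') (fun z => V z i (last j b'))
  else fun=> 1.

Definition H (al : seq 'I_m) p (zeta : p.-tuple 'I_d) (tau : seq nat) y : R :=
  \prod_(i < p)
    Hblock (drop (nth 0 (0 :: tau) i)%N (take (nth 0 tau i)%N al))
           (tnth zeta i) y.

(* gam o rho^-1 *)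
Definition act_word (gam : seq 'I_m) (rho : 'S_(size gam)) : seq 'I_m :=
  [seq tnth (in_tuple gam) ((rho^-1)%g i) | i <- enum 'I_(size gam)].

(* The words gamma^1, ..., gamma^p have length between 1 and L and total length
   greater than M.  Q is the part of order > M of the expansion of
   Eint1 (Taylor L) zeta, which contains all words of length at most L.  In R1
   this is used with L = N and M = N - 1.  With L = M the terms in which some
   word has length N would be lost: then the error formula fails for V(y) = y in
   dimension one and N = 2, where the remainders would all vanish. *)
Definition Q (L M p : nat) (zeta : p.-tuple 'I_d) s t y : R :=
  \sum_(g : p.-tuple (L.-bseq 'I_m) |
         all (fun w : L.-bseq 'I_m => 0 < size w)%N g &&
         (M < \sum_(w <- g) size w)%N)
    let gam := flatten [seq bseqval w | w <- g] in
    let tau := scanl addn 0%N [seq size (bseqval w) | w <- g] in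
    \sum_(rho in Xi (size gam) tau)
      H gam zeta tau y * xint (act_word rho) s t.

Variables (N : nat) (Gt : {fset seq 'I_m}).

Definition R1 s t y : 'cV[R]_d :=
  \sum_(zeta : N.-tuple 'I_d)
    RSint_mulmx (fun u => Eint1 (Taylor N) zeta s u y *: partials_mx zeta y) x s t
  + \sum_(1 <= p < N) \sum_(zeta : p.-tuple 'I_d)
    RSint_mulmx (fun u => Q N N.-1 zeta s u y *: partials_mx zeta y) x s t.

Definition R2 s t y : 'cV[R]_d :=
  \sum_(zeta : N.+1.-tuple 'I_d)
    RSint_mulmx
      (fun u => \matrix_(i, j)
         Eint (TaylorOn Gt) zeta
           (fun v => partials_mx zeta (y + TaylorOn Gt s v y) i j) s u y)
      x s t.

Definition R3 s t y : 'cV[R]_d :=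
  \sum_(1 <= p < N.+1) \sum_(zeta : p.-tuple 'I_d)
    RSint_mulmx
      (fun u => (Eint1 (TaylorOn Gt) zeta s u y - Eint1 (Taylor N) zeta s u y)
                  *: partials_mx zeta y)
      x s t.

Definition R4 s t y : 'cV[R]_d := Taylor N s t y - TaylorOn Gt s t y.

End TaylorExpansions.

Section Grid.
Context {R : realType} {d : nat}.
Variables (T : R) (n : nat).

Definition grid (k : nat) : R := k%:R * T / n%:R.

Definition grid_index (t : R) : nat := Num.truncn (n%:R * t / T).

Definition eta (t : R) : R := grid (grid_index t).

(* The continuous path whose differential is d_s Re_{eta(s),s}(yn_{eta(s)}): the
   differential is in the variable s with eta(s) frozen, so the jumps of
   s |-> Re_{eta(s),s}(yn_{eta(s)}) at the grid points do not count. *)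
Definition glue_grid (Re : R -> R -> 'cV[R]_d -> 'cV[R]_d) (yn : R -> 'cV[R]_d)
    (t : R) : 'cV[R]_d :=
  \sum_(0 <= k < grid_index t) Re (grid k) (grid k.+1) (yn (grid k))
  + Re (eta t) t (yn (eta t)).

End Grid.

(* Main.v *)
Require Import Defs.
From HB Require Import structures.
From mathcomp Require Import all_boot all_order all_algebra all_fingroup finmap.
From mathcomp Require Import all_classical all_reals all_analysis.
From mathcomp Require Import ring lra zify.
Import Order.TTheory GRing.Theory Num.Theory.
Import numFieldNormedType.Exports.

Set Implicit Arguments.
Unset Strict Implicit.
Unset Printing Implicit Defensive.

Local Open Scope classical_set_scope.
Local Open Scope ring_scope.

(** * Uniform little-o calculus on an interval *)

Section LittleO.
Context {R : realType}.
Implicit Types (a b s t u v e : R) (D : R -> R -> R -> R) (f g h k : R -> R).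

(** The uniform relation D(s, u, t) = o(t - s) for s <= u <= t. The middle time
    carries the tag of a Riemann sum. *)
Definition small a b D : Prop := forall e, 0 < e -> exists2 delta, 0 < delta &
  forall s u t, a <= s -> s <= u -> u <= t -> t <= b -> t - s < delta ->
    `|D s u t| <= e * (t - s).

(** h is an indefinite integral of f dg. Tagged Riemann sums converge because the
    estimate holds for every tag u of [s, t]. *)
Definition prim a b f g h : Prop :=
  small a b (fun s u t => h t - h s - f u * (g t - g s)).

(** The differential relation dh = f dg. With left tags only, the estimate is stable
    under products, composition and change of integrator. *)
Definition germ a b f g h : Prop :=
  small a b (fun s _ t => h t - h s - f s * (g t - g s)).

Definition yint a b f g : Prop := exists h, prim a b f g h.

Definition bdd a b f : Prop := exists2 C, 0 <= C &
  forall t, a <= t -> t <= b -> `|f t| <= C.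

Lemma small_ext a b D D' :
  (forall s u t, a <= s -> s <= u -> u <= t -> t <= b -> D s u t = D' s u t) ->
  small a b D -> small a b D'.
Proof.
move=> E sD e e0; have [d d0 H] := sD e e0; exists d => // s u t as_ su ut tb ts.
by rewrite -E//; exact: H.
Qed.

Lemma small_sub a b a' b' D : a <= a' -> b' <= b -> small a b D -> small a' b' D.
Proof.
move=> aa bb sD e e0; have [d d0 H] := sD e e0; exists d => // s u t *.
by apply: H => //; lra.
Qed.

Lemma small_tagl a b D : small a b D -> small a b (fun s _ t => D s s t).
Proof.
move=> sD e e0; have [d d0 H] := sD e e0; exists d => // s u t *.
by apply: H => //; lra.
Qed.

Lemma smallD a b D D' : small a b D -> small a b D' ->
  small a b (fun s u t => D s u t + D' s u t).
Proof.
move=> sD sD' e e0; have e2 : 0 < e / 2 by lra.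
have [d d0 H] := sD _ e2; have [d' d0' H'] := sD' _ e2.
exists (Num.min d d'); first by rewrite lt_min d0.
move=> s u t as_ su ut tb; rewrite lt_min => /andP[h1 h2].
have := H s u t as_ su ut tb h1; have := H' s u t as_ su ut tb h2.
have := ler_normD (D s u t) (D' s u t); lra.
Qed.

Lemma small0 a b : small a b (fun _ _ _ => 0).
Proof.
move=> e e0; exists 1 => // s u t *; rewrite normr0 mulr_ge0//; lra.
Qed.

Lemma smallMl a b C (c D : R -> R -> R -> R) :
  (forall s u t, a <= s -> s <= u -> u <= t -> t <= b -> `|c s u t| <= C) ->
  small a b D -> small a b (fun s u t => c s u t * D s u t).
Proof.
move=> cC sD e e0.
pose C' := Num.max C 1; have C1 : 1 <= C' by rewrite le_max lexx orbT.
have eC : 0 < e / C' by rewrite divr_gt0//; lra.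
have [d d0 H] := sD _ eC; exists d => // s u t as_ su ut tb ts.
have h := H _ _ _ as_ su ut tb ts; rewrite normrM.
apply: (@le_trans _ _ (C' * (e / C' * (t - s)))).
  by apply: ler_pM => //; rewrite (le_trans (cC _ _ _ as_ su ut tb))// le_max lexx.
by rewrite mulrA mulrCA divff ?mulr1//; lra.
Qed.

Lemma smallZ a b c D : small a b D -> small a b (fun s u t => c * D s u t).
Proof. by move=> sD; apply: (@smallMl _ _ `|c|). Qed.

Lemma small_sum a b (I : Type) (r : seq I) (P : pred I) (D : I -> R -> R -> R -> R) :
  (forall i, P i -> small a b (D i)) ->
  small a b (fun s u t => \sum_(i <- r | P i) D i s u t).
Proof.
move=> H; elim: r => [|i r IH].
  by apply: small_ext (small0 a b) => *; rewrite big_nil.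
case: (boolP (P i)) => Pi.
  apply: small_ext (smallD (H i Pi) IH) => *; by rewrite big_cons Pi.
by apply: small_ext IH => *; rewrite big_cons (negbTE Pi).
Qed.

(** Cutting [s, t] into n equal pieces turns a bound at small scale into one at
    every scale, and the additive errors pile up n times. *)
Lemma chop h e eta delta n s t : 0 <= e ->
  (forall u v, s <= u -> u <= v -> v <= t -> v - u < delta ->
     `|h v - h u| <= e * (v - u) + eta) ->
  s <= t -> t - s < n%:R * delta ->
  `|h t - h s| <= e * (t - s) + n%:R * eta.
Proof.
move=> e0; elim: n s => [|n IH] s H st; first by rewrite mul0r; lra.
rewrite -natr1 => lt_ts.
have n0 : 0 < n%:R + 1 :> R by rewrite ltr_wpDl.
pose q := (t - s) / (n%:R + 1).
have qE : (n%:R + 1) * q = t - s by rewrite /q mulrC divfK// gt_eqF.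
have q0 : 0 <= q by rewrite divr_ge0 ?subr_ge0// ltW.
have nq0 : 0 <= n%:R * q by rewrite mulr_ge0.
have qd : q < delta by rewrite /q ltr_pdivrMr// mulrC.
have ntE : t - (s + q) = n%:R * q by lra.
have su : s <= s + q by lra.
have ut : s + q <= t by lra.
have h1 : `|h (s + q) - h s| <= e * q + eta.
  by have := H s (s + q) (lexx _) su ut; rewrite (addrC s) addrK; apply.
case: n => [|n] in IH lt_ts n0 q qE q0 nq0 qd ntE su ut h1 *.
  have -> : t = s + q by lra.
  have -> : s + q - s = q by lra.
  lra.
have h2 : `|h t - h (s + q)| <= e * (t - (s + q)) + n.+1%:R * eta.
  apply: IH => //.
  - by move=> u v *; apply: H => //; lra.
  - by rewrite ntE ltr_pM2l.
have -> : h t - h s = (h t - h (s + q)) + (h (s + q) - h s) by ring.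
have := ler_normD (h t - h (s + q)) (h (s + q) - h s).
lra.
Qed.

Lemma natr_gtP (r : R) : exists n : nat, r < n%:R.
Proof.
by exists (Num.truncn r).+1; exact: truncnS_gt.
Qed.

(** By [chop] without additive error, e (t - s) bounds the increment for every e. *)
Lemma small_const a b h : small a b (fun s _ t => h t - h s) ->
  forall s t, a <= s -> s <= t -> t <= b -> h t = h s.
Proof.
move=> sh s t as_ st tb; apply/eqP; rewrite -subr_eq0 -normr_le0.
have le_e e : 0 < e -> `|h t - h s| <= e * (t - s).
  move=> e0; have [d d0 H] := sh e e0.
  have [n n_gt] := natr_gtP ((t - s) / d).
  rewrite -[leRHS]addr0 -(mulr0 n%:R); apply: (@chop h e 0 d) => //; [exact: ltW| |]; last first.
    by rewrite -ltr_pdivrMr.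
  by move=> u v su uv vt uvd; rewrite addr0; apply: (H _ u) => //; lra.
case: (eqVneq s t) => [->|nst]; first by rewrite subrr normr0.
have ts : 0 < t - s by rewrite subr_gt0 lt_neqAle nst.
apply/ler_addgt0Pr => e e0; rewrite add0r.
apply: le_trans (le_e (e / (t - s)) _) _; first by rewrite divr_gt0.
by rewrite divfK ?gt_eqF.
Qed.

Lemma small_eq a b h k : small a b (fun s _ t => (h t - h s) - (k t - k s)) ->
  h a = k a -> forall t, a <= t -> t <= b -> h t = k t.
Proof.
move=> shk E t at_ tb; apply/eqP; rewrite -subr_eq0; apply/eqP.
have <- : h a - k a = 0 by rewrite E subrr.
apply: (@small_const a b (fun t => h t - k t)) => //.
apply: small_ext shk => *; ring.
Qed.

(** The excess th - 1 of the exponent is what is left to beat any e. *)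
Lemma small_pow a b C th D : 1 < th ->
  (forall s u t, a <= s -> s <= u -> u <= t -> t <= b ->
     `|D s u t| <= C * (t - s) `^ th) ->
  small a b D.
Proof.
move=> th1 H e e0.
pose C' := Num.max C 1; have C1 : 1 <= C' by rewrite le_max lexx orbT.
have C0 : 0 < C' by lra.
exists ((e / C') `^ (th - 1)^-1); first exact/powR_gt0/divr_gt0.
move=> s u t as_ su ut tb ts; apply: (le_trans (H _ _ _ as_ su ut tb)).
have [->|nst] := eqVneq s t; first by rewrite subrr powR0 ?mulr0//; lra.
have ts0 : 0 < t - s by rewrite subr_gt0 lt_neqAle nst; lra.
have -> : th = 1 + (th - 1) by ring.
rewrite powRD; last by rewrite (gt_eqF ts0) implybT.
rewrite powRr1 ?(ltW ts0)// mulrA mulrAC ler_pM2r//.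
apply: (@le_trans _ _ (C' * (t - s) `^ (th - 1))).
  by rewrite ler_wpM2r ?powR_ge0// le_max lexx.
rewrite mulrC -ler_pdivlMr//.
have th0 : 0 < th - 1 by lra.
have := @ge0_ler_powR _ (th - 1) (ltW th0) (t - s) ((e / C') `^ (th - 1)^-1).
rewrite -powRrM mulVf ?gt_eqF// powRr1 ?divr_ge0 ?(ltW e0) ?(ltW C0)//.
by apply; rewrite ?nnegrE ?powR_ge0//; lra.
Qed.

End LittleO.

(** * Primitives and Riemann-Stieltjes integrals *)

Section Primitive.
Context {R : realType}.
Implicit Types (a b s t u v e : R) (f g h : R -> R).

Lemma prim_germ a b f g h : prim a b f g h -> germ a b f g h.
Proof. exact: small_tagl. Qed.

Lemma prim_sub a b a' b' f g h : a <= a' -> b' <= b -> prim a b f g h ->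
  prim a' b' f g h.
Proof. exact: small_sub. Qed.

Lemma yint_sub a b a' b' f g : a <= a' -> b' <= b -> yint a b f g ->
  yint a' b' f g.
Proof. by move=> aa bb [h ?]; exists h; apply: prim_sub aa bb _. Qed.

(** Steps slightly shorter than delta, chosen so that the rest of the interval has
    room for the steps that remain. *)
Lemma fine_partition a b (delta : R) : a <= b -> 0 < delta ->
  exists2 p : seq R, itv_partition a b p &
  forall k : nat, (k < size p)%N -> nth b (a :: p) k.+1 - nth b (a :: p) k < delta /\
     nth b (a :: p) k <= nth b (a :: p) k.+1.
Proof.
move=> ab d0; have [n] := natr_gtP ((b - a) / delta).
rewrite ltr_pdivrMr//; elim: n a ab => [|n IH] a ab; first by rewrite mul0r; lra.
have [->|nab] := eqVneq a b.
  by exists [::] => //; split => //=.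
have {nab}ab' : a < b by rewrite lt_neqAle nab.
rewrite -natr1 mulrDl mul1r => H.
have [ltd|ged] := ltP (b - a) delta.
  exists [:: b] => [|[|//] _]; first exact: itv_partition1.
  by rewrite /= ltd ltW.
have n1 : 0 < n%:R + 1 :> R by rewrite ltr_wpDl.
have e0 : 0 < n%:R * delta + delta - (b - a) by lra.
pose q := (n%:R * delta + delta - (b - a)) / (n%:R + 1).
have qE : (n%:R + 1) * q = n%:R * delta + delta - (b - a).
  by rewrite /q mulrC divfK// gt_eqF.
have q0 : 0 < q by rewrite divr_gt0.
have qd : q < delta by rewrite ltr_pdivrMr// mulrC; lra.
have n0 : 0 < n%:R :> R.
  rewrite ltr0n lt0n; apply/eqP => n0; move: H; rewrite n0 mul0r; lra.
have nq : 0 < n%:R * q by rewrite mulr_gt0.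
have [||p [p1 p2] p3] := IH (a + (delta - q)).
- by move: q0 qd ged; clear; lra.
- by move: qE; rewrite mulrDl mul1r; lra.
exists (a + (delta - q) :: p).
  by split => //=; rewrite p1 andbT; lra.
by case=> [|k] /=; [move=> _; split; lra|exact: p3].
Qed.

Lemma rs_sum_cons f g a b c (p : seq R) (xi : nat -> R) :
  rs_sum f g a b (c :: p) xi =
  f (xi 0%N) * (g c - g a) + rs_sum f g c b p (fun k => xi k.+1).
Proof. by rewrite /rs_sum /= big_nat_recl. Qed.

(** The errors of the cells of a partition add up. *)
Lemma rs_sum_error a b c f g h e d (p : seq R) (xi : nat -> R) :
  (forall s u t, a <= s -> s <= u -> u <= t -> t <= b -> t - s < d ->
     `|h t - h s - f u * (g t - g s)| <= e * (t - s)) ->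
  a <= c -> itv_partition c b p ->
  (forall k : nat, (k < size p)%N -> nth b (c :: p) k.+1 - nth b (c :: p) k < d /\
        nth b (c :: p) k <= xi k <= nth b (c :: p) k.+1) ->
  `|rs_sum f g c b p xi - (h b - h c)| <= e * (b - c).
Proof.
move=> H; elim: p xi c => [|c' p IH] xi c ac pp pxi.
  rewrite (itv_partition_nil pp) /rs_sum big_nil.
  by rewrite !subrr normr0 mulr0.
rewrite rs_sum_cons.
have cc' : c < c' by case: pp => /= /andP[].
have pp' := itv_partition_cons pp.
have c'b := itv_partition_le pp'.
have ac' : a <= c' by lra.
have {IH} := IH (fun k => xi k.+1) c' ac' pp' (fun k kp => pxi k.+1 kp).
have [/= d1 /andP[d2 d3]] := pxi 0%N isT.
have := H c (xi 0%N) c' ac d2 d3 c'b d1.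
set A := f _ * _; set B := rs_sum _ _ _ _ _ _ => h1 h2.
have -> : A + B - (h b - h c) =
   - (h c' - h c - A) + (B - (h b - h c')) by ring.
have := ler_normD (- (h c' - h c - A)) (B - (h b - h c')).
rewrite normrN; lra.
Qed.

Lemma prim_is_RSint a b f g h : prim a b f g h -> is_RSint f g a b (h b - h a).
Proof.
move=> ph e e0.
pose e' := e / (2 * (`|b - a| + 1)).
have ba : 0 <= `|b - a| by [].
have e'0 : 0 < e' by rewrite divr_gt0//; lra.
have [d d0 H] := ph _ e'0; exists d => // p xi pp pxi.
have ab := itv_partition_le pp.
apply: (le_lt_trans (rs_sum_error H (lexx a) pp pxi)).
rewrite /e' mulrAC ltr_pdivrMr; last lra.
rewrite ltr_pM2l// ger0_norm; lra.
Qed.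

Lemma is_RSint_uniq a b f g u v : a <= b ->
  is_RSint f g a b u -> is_RSint f g a b v -> u = v.
Proof.
move=> ab Hu Hv; apply/eqP; rewrite -subr_eq0 -normr_le0.
apply/ler_addgt0Pr => e e0; rewrite add0r.
have e2 : 0 < e / 2 by lra.
have [d d0 {}Hu] := Hu _ e2; have [d' d'0 {}Hv] := Hv _ e2.
have [|p pp p1] := @fine_partition a b (Num.min d d') ab; first by rewrite lt_min d0.
have := Hu p (nth b (a :: p)) pp.
have := Hv p (nth b (a :: p)) pp.
set s := rs_sum _ _ _ _ _ _ => h1 h2.
have {}h1 : `|s - v| < e / 2.
  by apply: h1 => k /p1[]; rewrite lt_min => /andP[_ ->] ->; rewrite lexx.
have {}h2 : `|s - u| < e / 2.
  by apply: h2 => k /p1[]; rewrite lt_min => /andP[-> _] ->; rewrite lexx.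
have -> : u - v = (s - v) - (s - u) by ring.
have := ler_normB (s - v) (s - u); lra.
Qed.

Lemma RSint_prim a b f g h s t : prim a b f g h -> a <= s -> s <= t -> t <= b ->
  RSint f g s t = h t - h s.
Proof.
move=> ph as_ st tb.
have H : is_RSint f g s t (h t - h s) by apply: prim_is_RSint; apply: prim_sub ph.
apply: (is_RSint_uniq st _ H).
by rewrite /RSint; case: xgetP => [x _ //|/(_ _ H)].
Qed.

Lemma RSintxx f g a : RSint f g a a = 0.
Proof.
suff H : is_RSint f g a a 0.
  apply: (is_RSint_uniq (lexx a) _ H).
  by rewrite /RSint; case: xgetP => [x _ //|/(_ _ H)].
move=> e e0; exists 1 => // p xi /itv_partitionxx -> _.
by rewrite /rs_sum big_nil subrr normr0.
Qed.

Lemma prim_RSint a b f g : a <= b -> yint a b f g ->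
  prim a b f g (fun t => RSint f g a t).
Proof.
move=> ab [h ph]; apply: small_ext (ph) => s u t as_ su ut tb.
by rewrite !(RSint_prim ph)//; lra.
Qed.

(** Two paths with the germ f dg differ by a constant, so one that satisfies the
    germ estimate at left tags only gives the integral once that exists. *)
Lemma RSint_germ a b f g h s t : yint a b f g -> germ a b f g h ->
  a <= s -> s <= t -> t <= b -> RSint f g s t = h t - h s.
Proof.
move=> [k pk] gh as_ st tb; rewrite (RSint_prim pk)//.
have E : small a b (fun s _ t => (k t - k s) - (h t - h s)).
  apply: small_ext (smallD (prim_germ pk) (smallZ (-1) gh)) => *; ring.
have := @small_const _ a b (fun t => k t - h t).
move=> /(_ _ s t as_ st tb) H.
suff : k t - h t = k s - h s by lra.
by apply: H; apply: small_ext E => *; ring.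
Qed.

Lemma RSintD a b f g s u t : yint a b f g -> a <= s -> s <= u -> u <= t -> t <= b ->
  RSint f g s t = RSint f g s u + RSint f g u t.
Proof.
move=> [h ph] as_ su ut tb; rewrite !(RSint_prim ph)//; try lra.
Qed.

Lemma prim_ext a b f g h f' g' h' :
  (forall t, a <= t -> t <= b -> f t = f' t) ->
  (forall t, a <= t -> t <= b -> g t = g' t) ->
  (forall t, a <= t -> t <= b -> h t = h' t) ->
  prim a b f g h -> prim a b f' g' h'.
Proof.
move=> Ef Eg Eh; apply: small_ext => s u t as_ su ut tb.
by rewrite ?Ef ?Eg ?Eh//; lra.
Qed.

Lemma yint_ext a b f g f' g' :
  (forall t, a <= t -> t <= b -> f t = f' t) ->
  (forall t, a <= t -> t <= b -> g t = g' t) ->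
  yint a b f g -> yint a b f' g'.
Proof. by move=> Ef Eg [h ph]; exists h; apply: prim_ext ph. Qed.

(** Riemann sums see the integrator through its increments only, hence the free
    constant c. *)
Lemma RSint_ext a b c f g f' g' s t : 
  (forall t, a <= t -> t <= b -> f t = f' t) ->
  (forall t, a <= t -> t <= b -> g t = c + g' t) ->
  yint a b f' g' -> a <= s -> s <= t -> t <= b ->
  RSint f g s t = RSint f' g' s t.
Proof.
move=> Ef Eg [h ph] as_ st tb; rewrite (RSint_prim ph)//.
apply: (@RSint_prim a b) => //; apply: small_ext ph => *.
rewrite Ef ?Eg//; try lra.
Qed.

Lemma prim_sumf a b (I : Type) (r : seq I) (P : pred I) (c : I -> R) (f : I -> R -> R) g
    (h : I -> R -> R) : (forall i, P i -> prim a b (f i) g (h i)) ->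
  prim a b (fun u => \sum_(i <- r | P i) c i * f i u) g
           (fun u => \sum_(i <- r | P i) c i * h i u).
Proof.
move=> H.
apply: small_ext (small_sum r (fun i Pi => smallZ (c i) (H i Pi))) => s u t *.
rewrite mulr_suml -!sumrB; apply: eq_bigr => i _; ring.
Qed.

Lemma prim_sumg a b (I : Type) (r : seq I) (P : pred I) (c : I -> R) f (g : I -> R -> R)
    (h : I -> R -> R) : (forall i, P i -> prim a b f (g i) (h i)) ->
  prim a b f (fun u => \sum_(i <- r | P i) c i * g i u)
           (fun u => \sum_(i <- r | P i) c i * h i u).
Proof.
move=> H.
apply: small_ext (small_sum r (fun i Pi => smallZ (c i) (H i Pi))) => s u t *.
rewrite -!sumrB mulr_sumr -sumrB; apply: eq_bigr => i _; ring.
Qed.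

Lemma yint_sumf a b (I : Type) (r : seq I) (P : pred I) (c : I -> R) (f : I -> R -> R) g :
  a <= b -> (forall i, P i -> yint a b (f i) g) ->
  yint a b (fun u => \sum_(i <- r | P i) c i * f i u) g.
Proof.
move=> ab H; exists (fun u => \sum_(i <- r | P i) c i * RSint (f i) g a u).
by apply: prim_sumf => i Pi; apply/prim_RSint/H.
Qed.

Lemma RSint_sumf a b (I : Type) (r : seq I) (P : pred I) (c : I -> R) (f : I -> R -> R)
    g t :
  (forall i, P i -> yint a b (f i) g) -> a <= t -> t <= b ->
  RSint (fun u => \sum_(i <- r | P i) c i * f i u) g a t
  = \sum_(i <- r | P i) c i * RSint (f i) g a t.
Proof.
move=> H at_ tb; have ab : a <= b by lra.
rewrite (RSint_prim (prim_sumf r c (fun i Pi => prim_RSint ab (H i Pi))))//.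
by rewrite -sumrB; apply: eq_bigr => i _; rewrite RSintxx mulr0 subr0.
Qed.

Lemma RSint_sumg a b (I : Type) (r : seq I) (P : pred I) (c : I -> R) f
    (g : I -> R -> R) t :
  (forall i, P i -> yint a b f (g i)) -> a <= t -> t <= b ->
  RSint f (fun u => \sum_(i <- r | P i) c i * g i u) a t
  = \sum_(i <- r | P i) c i * RSint f (g i) a t.
Proof.
move=> H at_ tb; have ab : a <= b by lra.
rewrite (RSint_prim (prim_sumg r c (fun i Pi => prim_RSint ab (H i Pi))))//.
by rewrite -sumrB; apply: eq_bigr => i _; rewrite RSintxx mulr0 subr0.
Qed.

End Primitive.

(** * Existence of Young integrals *)

Section Sewing.
Context {R : realType}.
Implicit Types (a b s t u v e : R) (f g h : R -> R).

(** Approximate primitives that satisfy the germ estimate up to an additive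
    error tending to 0 converge: by [chop] they form a Cauchy sequence. *)
Lemma sewing a b f g (H : nat -> R -> R) : a <= b -> (forall n, H n a = 0) ->
  (forall e, 0 < e -> exists2 delta, 0 < delta & forall eta, 0 < eta ->
     exists n0, forall n s t, (n0 <= n)%N -> a <= s -> s <= t -> t <= b ->
       t - s < delta ->
       `|H n t - H n s - f s * (g t - g s)| <= e * (t - s) + eta) ->
  exists h, germ a b f g h.
Proof.
move=> ab Ha HH.
have cau t : a <= t -> t <= b -> exists l : R, (fun n => H n t) @ \oo --> l.
  move=> at_ tb; suff : cvgn (fun n => H n t) by move=> c; exists (limn (fun n => H n t)); exact: c.
  apply/cauchy_cvgP/cauchy_ballP => e e0.
  pose e1 := e / (4 * (t - a + 1)).
  have e10 : 0 < e1 by rewrite divr_gt0//; lra.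
  have e1E : e1 * (t - a) <= e / 4.
    rewrite /e1 mulrAC ler_pdivrMr; last lra.
    have ea : 0 <= e * (t - a) by rewrite mulr_ge0; lra.
    lra.
  have [d d0 {}HH] := HH _ e10.
  have [N] := natr_gtP ((t - a) / d).
  rewrite ltr_pdivrMr// => Nd.
  pose eta := e / (8 * (N%:R + 1)).
  have N1 : 0 <= N%:R :> R by [].
  have eta0 : 0 < eta by rewrite divr_gt0//; lra.
  have etaE : N%:R * eta <= e / 8.
    rewrite /eta mulrCA ler_pM2l//.
    rewrite ler_pdivrMr; last lra.
    lra.
  have [n0 {}HH] := HH _ eta0.
  near_simpl.
  have main n n' : (n0 <= n)%N -> (n0 <= n')%N -> `|H n t - H n' t| < e.
    move=> nn0 nn0'.
    have : `|(H n t - H n' t) - (H n a - H n' a)| <= (2 * e1) * (t - a) + N%:R * (2 * eta).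
      apply: (@chop _ (fun t => H n t - H n' t) (2 * e1) (2 * eta) d) => //.
        by rewrite mulr_ge0// ltW.
      move=> u v su uv vt uvd.
      have vb : v <= b by lra.
      have h1 := HH n u v nn0 su uv vb uvd.
      have h2 := HH n' u v nn0' su uv vb uvd.
      have -> : H n v - H n' v - (H n u - H n' u) =
         (H n v - H n u - f u * (g v - g u)) - (H n' v - H n' u - f u * (g v - g u))
        by ring.
      have := ler_normB (H n v - H n u - f u * (g v - g u))
                        (H n' v - H n' u - f u * (g v - g u)).
      lra.
    rewrite !Ha subr0 subr0 => h; apply: (le_lt_trans h); lra.
  exists ([set n | (n0 <= n)%N], [set n | (n0 <= n)%N]) => /=.
    by split; exists n0.
  move=> [n n'] /= [nn0 nn0']; rewrite /ball /=; exact: main.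
pose h t := limn (fun n => H n t).
have hP t : a <= t -> t <= b -> (fun n => H n t) @ \oo --> h t.
  by move=> at_ tb; have [l cl] := cau t at_ tb; apply: cvgP cl.
exists h => e e0; have [d d0 {}HH] := HH _ e0; exists d => // s u t as_ su ut tb tsd.
apply/ler_addgt0Pr => eta eta0.
have [n0 {}HH] := HH _ eta0.
have c : `|H n t - H n s - f s * (g t - g s)| @[n --> \oo]
   --> `|h t - h s - f s * (g t - g s)|.
  apply: cvg_norm; apply: cvgB; last exact: cvg_cst.
  by apply: cvgB; apply: hP; lra.
apply: (cvgr_to_le c); exists n0 => // n /= nn0.
by apply: HH => //; lra.
Qed.

(** Cutting the integrator at t with [Num.min] keeps all the cells of the grid in the
    sum, so that the left-point sum is a path in t; inside a cell its increments are
    exact. *)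
Definition step_int f g a (delta : R) (N : nat) t : R :=
  \sum_(i < N) f (a + i%:R * delta) *
    (g (Num.min t (a + i.+1%:R * delta)) - g (Num.min t (a + i%:R * delta))).

Lemma step_int_start f g a delta N : 0 <= delta -> step_int f g a delta N a = 0.
Proof.
move=> d0; apply: big1 => i _.
have h k : Num.min a (a + k%:R * delta) = a.
  by apply: min_idPl; rewrite lerDl mulr_ge0.
by rewrite !h subrr mulr0.
Qed.

Lemma step_int_cell f g a delta N i s t : 0 < delta -> (i < N)%N ->
  a + i%:R * delta <= s -> s <= t -> t <= a + i.+1%:R * delta ->
  step_int f g a delta N t - step_int f g a delta N s
  = f (a + i%:R * delta) * (g t - g s).
Proof.
move=> d0 iN is_ st ti; rewrite /step_int.
rewrite (bigD1 (Ordinal iN))//= [X in _ - X](bigD1 (Ordinal iN))//=.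
rewrite [X in _ + X - _](_ : _ = \sum_(j < N | j != Ordinal iN)
   f (a + j%:R * delta) *
    (g (Num.min s (a + j.+1%:R * delta)) - g (Num.min s (a + j%:R * delta)))).
  rewrite (min_idPl ti) (min_idPr is_) (min_idPr (le_trans is_ st)).
  rewrite (min_idPl (le_trans st ti)).
  ring.
apply: eq_bigr => j; rewrite -val_eqE /= neq_ltn => /orP[ji|ij].
  have jd : a + j.+1%:R * delta <= a + i%:R * delta.
    by rewrite lerD2l ler_pM2r// ler_nat.
  have jd' : a + j%:R * delta <= a + j.+1%:R * delta.
    by rewrite lerD2l ler_pM2r// ler_nat.
  by rewrite !(min_idPr _)//; lra.
have jd : a + i.+1%:R * delta <= a + j%:R * delta.
  by rewrite lerD2l ler_pM2r// ler_nat.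
have jd' : a + j%:R * delta <= a + j.+1%:R * delta.
  by rewrite lerD2l ler_pM2r// ler_nat.
by rewrite !(min_idPl _); lra.
Qed.

(** At the finest scale at most one grid point has to be crossed. *)
Lemma cell_split a delta N s t : 0 < delta -> a <= s -> s <= t ->
  t <= a + N%:R * delta -> t - s <= delta -> s < t ->
  (exists2 i, (i < N)%N & a + i%:R * delta <= s /\ t <= a + i.+1%:R * delta) \/
  (exists2 i, (i.+1 < N)%N & [/\ a + i%:R * delta <= s, s <= a + i.+1%:R * delta,
     a + i.+1%:R * delta <= t & t <= a + i.+2%:R * delta]).
Proof.
move=> d0 as_ st tN tsd lst.
pose i := Num.truncn ((s - a) / delta).
have sa : 0 <= (s - a) / delta by rewrite divr_ge0 ?subr_ge0// ltW.
have /andP[i1 i2] := truncn_itv sa.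
rewrite -/i in i1 i2.
have {}i1 : a + i%:R * delta <= s by move: i1; rewrite ler_pdivlMr//; lra.
have {}i2 : s < a + i.+1%:R * delta by move: i2; rewrite ltr_pdivrMr//; lra.
have [ti|ti] := leP t (a + i.+1%:R * delta).
  left; exists i => //.
  rewrite -(ltr_nat R) -(ltr_pM2r d0); lra.
right; exists i.
  rewrite -(ltr_nat R) -(ltr_pM2r d0); lra.
by split; lra.
Qed.

Definition hol a b al f : Prop := exists2 C, 0 <= C &
  forall s t, a <= s -> s <= t -> t <= b -> `|f t - f s| <= C * (t - s) `^ al.

Lemma half_powR_lt1 (th : R) : 1 < th -> 2 * (2^-1 : R) `^ th < 1.
Proof.
move=> th1; have -> : th = 1 + (th - 1) by ring.
rewrite powRD; last by rewrite invr_neq0 ?implybT.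
rewrite powRr1// mulrA divff// mul1r.
have -> : (2^-1 : R) `^ (th - 1) = (2 `^ (th - 1)) ^-1.
  by rewrite -powR_inv1// -powRrM mulN1r powRN.
rewrite invf_lt1 ?powR_gt0//.
have := @gt0_ltr_powR _ (th - 1); rewrite subr_gt0 => /(_ th1 1 2).
rewrite powR1; apply; rewrite ?nnegrE//; lra.
Qed.

(** Bisecting [s, t] down to the size of a cell. Each level doubles the number of
    cell errors, while the defects of the germ form a convergent series because
    the total exponent exceeds 1. *)
Lemma step_int_young a b al be C C' f g N n : 0 < al -> 0 < be -> 1 < al + be ->
  let th := al + be in let A := C * C' in
  let K := A / (1 - 2 * (2^-1) `^ th) in
  0 <= C -> 0 <= C' ->
  (forall s t, a <= s -> s <= t -> t <= b -> `|f t - f s| <= C * (t - s) `^ al) ->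
  (forall s t, a <= s -> s <= t -> t <= b -> `|g t - g s| <= C' * (t - s) `^ be) ->
  forall delta, 0 < delta -> b = a + N%:R * delta ->
  forall s t, a <= s -> s <= t -> t <= b -> t - s <= 2 ^+ n * delta ->
  `|step_int f g a delta N t - step_int f g a delta N s - f s * (g t - g s)|
   <= K * (t - s) `^ th + 2 ^+ n * (3 * A * delta `^ th).
Proof.
move=> al0 be0 albe th A K C0 C'0 fC gC delta d0 bE.
have A0 : 0 <= A by rewrite mulr_ge0.
have q1 := half_powR_lt1 albe.
have K0 : 0 <= K by rewrite divr_ge0// subr_ge0 ltW.
(* One bisection turns K into two halves, each scaled by (1/2)^th, plus the defect A
   of the germ. *)
have KE : 2 * K * (2^-1) `^ th + A = K.
  rewrite /K; field; apply/negP => /eqP; lra.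
have fg s u t : a <= s -> s <= u -> u <= t -> t <= b ->
  `|(f u - f s) * (g t - g u)| <= A * (t - s) `^ th.
  move=> as_ su ut tb; rewrite normrM.
  have h1 : `|f u - f s| <= C * (t - s) `^ al.
    apply: le_trans (fC _ _ as_ su _) _; first lra.
    rewrite ler_wpM2l//; apply: ge0_ler_powR; rewrite ?nnegrE; try lra.
  have h2 : `|g t - g u| <= C' * (t - s) `^ be.
    apply: le_trans (gC _ _ _ ut tb) _; first lra.
    rewrite ler_wpM2l//; apply: ge0_ler_powR; rewrite ?nnegrE; try lra.
  apply: le_trans (ler_pM (normr_ge0 _) (normr_ge0 _) h1 h2) _.
  rewrite /th /A powRD; first by rewrite -!mulrA ler_wpM2l// mulrCA.
  by rewrite gt_eqF//; lra.
set h := step_int f g a delta N.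
have mono u v : 0 <= u -> u <= v -> u `^ th <= v `^ th.
  by move=> u0 uv; apply: ge0_ler_powR; rewrite ?nnegrE /th; lra.
have cell s t i : (i < N)%N -> a + i%:R * delta <= s -> s <= t ->
   t <= a + i.+1%:R * delta ->
  `|h t - h s - f s * (g t - g s)| <= A * delta `^ th.
  move=> iN is_ st ti; rewrite (step_int_cell f g d0 iN)//.
  have -> : f (a + i%:R * delta) * (g t - g s) - f s * (g t - g s) =
     - ((f s - f (a + i%:R * delta)) * (g t - g s)) by ring.
  have i0 : 0 <= i%:R * delta by rewrite mulr_ge0// ltW.
  have iN' : i.+1%:R * delta <= N%:R * delta by rewrite ler_pM2r// ler_nat.
  rewrite normrN; apply: le_trans (fg _ _ _ _ _ _ _) _; try lra.
  rewrite ler_wpM2l// mono//; first lra.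
  by move: ti; rewrite -natr1 mulrDl mul1r; lra.
elim: n => [|n IH] s t as_ st tb ts.
  rewrite !expr0 !mul1r in ts *.
  have E0 : 0 <= A * delta `^ th by rewrite mulr_ge0// powR_ge0.
  have E1 : 0 <= K * (t - s) `^ th by rewrite mulr_ge0// powR_ge0.
  have [ets|nts] := eqVneq s t.
    rewrite ets !subrr mulr0 subr0 normr0 addr_ge0//; rewrite -?ets ?subrr; try lra.
    by rewrite mulr_ge0 ?powR_ge0.
  have lst : s < t by rewrite lt_neqAle nts.
  rewrite bE in tb.
  have [[i iN [i1 i2]]|[i iN [i1 i2 i3 i4]]] := cell_split d0 as_ st tb ts lst.
    have := cell s t i iN i1 st i2; lra.
  set u := a + _ in i2 i3.
  have h1 := cell s u i (ltnW iN) i1 i2 (lexx _).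
  have h2 := cell u t i.+1 iN (lexx _) i3 i4.
  have h3 : `|(f u - f s) * (g t - g u)| <= A * delta `^ th.
    apply: le_trans (fg _ _ _ as_ i2 i3 _) _; first by rewrite bE.
    by rewrite ler_wpM2l// mono//; lra.
  have -> : h t - h s - f s * (g t - g s) = (h u - h s - f s * (g u - g s)) +
     (h t - h u - f u * (g t - g u)) + (f u - f s) * (g t - g u) by ring.
  have := ler_normD ((h u - h s - f s * (g u - g s)) +
     (h t - h u - f u * (g t - g u))) ((f u - f s) * (g t - g u)).
  have := ler_normD (h u - h s - f s * (g u - g s)) (h t - h u - f u * (g t - g u)).
  lra.
pose u := (s + t) / 2.
have us : u - s = (t - s) * 2^-1 by rewrite /u; lra.
have tu : t - u = (t - s) * 2^-1 by rewrite /u; lra.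
have ts0 : 0 <= t - s by lra.
rewrite exprS -mulrA in ts *.
have su : s <= u by lra.
have ut : u <= t by lra.
have ub : u <= b by lra.
have au : a <= u by lra.
have us2 : u - s <= 2 ^+ n * delta by rewrite us; lra.
have tu2 : t - u <= 2 ^+ n * delta by rewrite tu; lra.
have h1 := IH s u as_ su ub us2.
have h2 := IH u t au ut tb tu2.
have h3 : `|(f u - f s) * (g t - g u)| <= A * (t - s) `^ th by apply: fg; lra.
rewrite us powRM// in h1.
rewrite tu powRM// in h2.
have -> : h t - h s - f s * (g t - g s) = (h u - h s - f s * (g u - g s)) +
     (h t - h u - f u * (g t - g u)) + (f u - f s) * (g t - g u) by ring.
have := ler_normD ((h u - h s - f s * (g u - g s)) +
     (h t - h u - f u * (g t - g u))) ((f u - f s) * (g t - g u)).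
have := ler_normD (h u - h s - f s * (g u - g s)) (h t - h u - f u * (g t - g u)).
have -> : K * (t - s) `^ th = 2 * (K * ((t - s) `^ th * 2^-1 `^ th)) + A * (t - s) `^ th.
  by rewrite -[X in X * _ = _]KE; ring.
lra.
Qed.

End Sewing.

(** * Hoelder paths and their integrals *)

Section Hoelder.
Context {R : realType}.
Implicit Types (a b s t u v e : R) (f g h : R -> R).

Lemma germ_prim a b f g h : germ a b f g h ->
  small a b (fun s u t => (f u - f s) * (g t - g s)) -> prim a b f g h.
Proof.
move=> gh fg; apply: small_ext (smallD gh (smallZ (-1) fg)) => *; ring.
Qed.

Lemma ler_powRl (u v r : R) : 0 <= r -> 0 <= u -> u <= v -> u `^ r <= v `^ r.
Proof. by move=> r0 u0 uv; apply: ge0_ler_powR; rewrite ?nnegrE; lra. Qed.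

(** The oscillations of f and g are of order (t - s)^al and (t - s)^be. *)
Lemma hol_small a b al be f g : 0 < al -> 0 < be -> 1 < al + be ->
  hol a b al f -> hol a b be g ->
  small a b (fun s u t => (f u - f s) * (g t - g s)).
Proof.
move=> al0 be0 albe [C C0 fC] [C' C'0 gC].
apply: (@small_pow _ a b (C * C') _ _ albe) => s u t as_ su ut tb.
rewrite normrM powRD; last by rewrite gt_eqF//; lra.
rewrite mulrACA; apply: ler_pM => //; last by apply: gC; lra.
apply: le_trans (fC s u as_ su _) _; first lra.
by rewrite ler_wpM2l// ler_powRl//; lra.
Qed.

(** Young's theorem. The left-point sums over dyadic grids satisfy [sewing]: the
    additive error of [step_int_young] at the n-th grid is of order
    2^n (2^-n)^(al + be). *)
Lemma yint_hol a b al be f g : a <= b -> 0 < al -> 0 < be -> 1 < al + be ->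
  hol a b al f -> hol a b be g -> yint a b f g.
Proof.
move=> ab al0 be0 albe hf hg.
have fgs := hol_small al0 be0 albe hf hg.
suff [h gh] : exists h, germ a b f g h by exists h; apply: germ_prim.
have [C C0 fC] := hf; have [C' C'0 gC] := hg.
move: ab; rewrite le_eqVlt => /orP[/eqP <-|ab].
  exists (fun=> 0) => e e0; exists 1 => // s u t as_ su ut ta _.
  have -> : t = s by lra.
  by rewrite !subrr mulr0 subr0 normr0 mulr0.
pose A := C * C'; have A0 : 0 <= A by rewrite mulr_ge0.
have q1 := half_powR_lt1 albe.
set q := 2 * _ in q1.
have q0 : 0 <= q by rewrite mulr_ge0// powR_ge0.
pose del n : R := (b - a) / 2 ^+ n.
have del0 n : 0 < del n by rewrite divr_gt0 ?exprn_gt0// subr_gt0.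
have delE n : b = a + (2 ^ n)%:R * del n.
  by rewrite natrX /del mulrC divfK ?gt_eqF ?exprn_gt0//; ring.
pose B := 3 * A * (b - a) `^ (al + be).
have B0 : 0 <= B by rewrite !mulr_ge0// powR_ge0.
have BE n : 2 ^+ n * (3 * A * del n `^ (al + be)) = B * q ^+ n.
  rewrite /del powRM; [|lra|by rewrite invr_ge0 exprn_ge0].
  have -> : (2 ^+ n)^-1 `^ (al + be) = ((2^-1 : R) `^ (al + be)) ^+ n.
    by rewrite -exprVn -[in LHS]powR_mulrn// powRAC powR_mulrn ?powR_ge0.
  by rewrite /B /q exprMn; ring.
apply: (@sewing _ a b f g (fun n => step_int f g a (del n) (2 ^ n))).
- exact: ltW.
- by move=> n; rewrite step_int_start// ltW.
move=> e e0.
have [|d d0 H] := @small_pow _ a b (A / (1 - q)) _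
    (fun s _ t => A / (1 - q) * (t - s) `^ (al + be)) albe _ e e0.
  move=> s u t *; rewrite ger0_norm// mulr_ge0 ?powR_ge0// divr_ge0//; lra.
exists d => // eta eta0.
have /cvgrPdist_lt /(_ (eta / (B + 1))) : (fun n => q ^+ n) @ \oo --> 0.
  by apply: cvg_expr; rewrite ger0_norm.
case; first by rewrite divr_gt0//; lra.
move=> n0 _ n0P; exists n0 => n s t nn0 as_ st tb tsd.
have h1 : t - s <= 2 ^+ n * del n by have := delE n; rewrite natrX; lra.
have := @step_int_young _ a b al be C C' f g (2 ^ n) n al0 be0 albe C0 C'0 fC gC
   (del n) (del0 n) (delE n) s t as_ st tb h1.
move/le_trans; apply; apply: lerD.
  by apply: le_trans (H s s t as_ (lexx _) st tb tsd); rewrite ler_norm.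
rewrite BE.
have := n0P n nn0; rewrite /= sub0r normrN ger0_norm ?exprn_ge0//.
rewrite ltr_pdivlMr; last lra.
have : 0 <= q ^+ n by rewrite exprn_ge0.
lra.
Qed.

Definition ucont a b f : Prop := forall e, 0 < e -> exists2 delta, 0 < delta &
  forall s t, a <= s -> s <= t -> t <= b -> t - s < delta -> `|f t - f s| <= e.

Lemma lip_small a b L f g : ucont a b f ->
  (forall s t, a <= s -> s <= t -> t <= b -> `|g t - g s| <= L * (t - s)) ->
  small a b (fun s u t => (f u - f s) * (g t - g s)).
Proof.
move=> uf gL e e0.
pose L' := `|L| + 1; have L'0 : 0 < L' by rewrite ltr_wpDl.
have [d d0 H] := uf (e / L') (divr_gt0 e0 L'0).
exists d => // s u t as_ su ut tb tsd; rewrite normrM.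
have h1 : `|f u - f s| <= e / L' by apply: H => //; lra.
have h2 : `|g t - g s| <= L' * (t - s).
  have st : s <= t by lra.
  apply: le_trans (gL _ _ as_ st tb) _; rewrite ler_wpM2r//; first lra.
  by rewrite /L'; have := ler_norm L; lra.
apply: le_trans (ler_pM (normr_ge0 _) (normr_ge0 _) h1 h2) _.
by rewrite mulrA divfK ?gt_eqF.
Qed.

(** For a Lipschitz integrator a uniformly continuous integrand suffices: replacing
    f by f s on a short interval costs e per unit of length, cell by cell. *)
Lemma yint_lip a b L f g : a <= b -> ucont a b f ->
  (forall s t, a <= s -> s <= t -> t <= b -> `|g t - g s| <= L * (t - s)) ->
  yint a b f g.
Proof.
move=> ab uf gL.
suff [h gh] : exists h, germ a b f g h.
  by exists h; apply: germ_prim gh (lip_small uf gL).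
move: ab; rewrite le_eqVlt => /orP[/eqP <-|ab].
  exists (fun=> 0) => e e0; exists 1 => // s u t as_ su ut ta _.
  have -> : t = s by lra.
  by rewrite !subrr mulr0 subr0 normr0 mulr0.
pose del n : R := (b - a) / n.+1%:R.
have del0 n : 0 < del n by rewrite divr_gt0// subr_gt0.
have delE n : b = a + n.+1%:R * del n.
  by rewrite /del mulrC divfK ?gt_eqF//; ring.
apply: (@sewing _ a b f g (fun n => step_int f g a (del n) n.+1)).
- exact: ltW.
- by move=> n; rewrite step_int_start// ltW.
move=> e e0.
pose L' := `|L| + 1; have L'0 : 0 < L' by rewrite ltr_wpDl.
have [d d0 H] := uf (e / L') (divr_gt0 e0 L'0).
exists (d / 2); first lra.
move=> eta eta0; have [n0 n0P] := natr_gtP ((b - a) / (d / 2)).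
exists n0 => n s t nn0 as_ st tb tsd.
have deld : del n < d / 2.
  have n1 : n0%:R <= n.+1%:R :> R by rewrite ler_nat ltnW.
  move: n0P; rewrite /del !ltr_pdivrMr//; try lra.
  move=> n0P; apply: (lt_le_trans n0P); rewrite mulrC ler_pM2l//; lra.
pose k u := step_int f g a (del n) n.+1 u - f s * g u.
have kE : step_int f g a (del n) n.+1 t - step_int f g a (del n) n.+1 s -
    f s * (g t - g s) = k t - k s by rewrite /k; ring.
have cell i u v : (i < n.+1)%N -> s <= u -> a + i%:R * del n <= u -> u <= v ->
   v <= t -> v <= a + i.+1%:R * del n -> `|k v - k u| <= e * (v - u).
  move=> iN su iu uv vt vi.
  have -> : k v - k u = (f (a + i%:R * del n) - f s) * (g v - g u).
    have := step_int_cell f g (del0 n) iN iu uv vi.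
    by rewrite /k mulrBl => <-; ring.
  rewrite normrM; apply: (@le_trans _ _ (e / L' * (L' * (v - u)))); last first.
    by rewrite mulrA divfK ?gt_eqF.
  have i0 : 0 <= i%:R * del n by rewrite mulr_ge0// ltW.
  have ui : u < a + i%:R * del n + d / 2.
    by move: vi; rewrite -natr1 mulrDl mul1r; lra.
  apply: ler_pM => //.
    have [si|/ltW is_] := leP s (a + i%:R * del n).
      by apply: H => //; lra.
    by rewrite distrC; apply: H => //; lra.
  have au : a <= u by lra.
  have vb : v <= b by lra.
  apply: le_trans (gL _ _ au uv vb) _; rewrite ler_wpM2r//; first lra.
  by rewrite /L'; have := ler_norm L; lra.
rewrite kE; have [M MP] := natr_gtP ((t - s) / del n).
apply: (@le_trans _ _ (e * (t - s) + M%:R * 0)); last by rewrite mulr0; lra.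
apply: (@chop _ k e 0 (del n)) => //; first exact: ltW; last first.
  by rewrite -ltr_pdivrMr.
move=> u v su uv vt uvd; rewrite addr0.
have [->|nuv] := eqVneq u v; first by rewrite !subrr normr0 mulr0.
have luv : u < v by rewrite lt_neqAle nuv.
have au : a <= u by lra.
have vN : v <= a + n.+1%:R * del n by rewrite -delE; lra.
have [[i iN [i1 i2]]|[i iN [i1 i2 i3 i4]]] :=
    cell_split (del0 n) au uv vN (ltW uvd) luv.
  exact: (cell i).
set w := a + _ in i2 i3.
have h1 : `|k w - k u| <= e * (w - u) by apply: (cell i) => //; [exact: ltnW|lra].
have h2 : `|k v - k w| <= e * (v - w) by apply: (cell i.+1) => //; lra.
have -> : k v - k u = (k w - k u) + (k v - k w) by ring.
have := ler_normD (k w - k u) (k v - k w); lra.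
Qed.

Lemma hol_sub a b a' b' al f : a <= a' -> b' <= b -> hol a b al f -> hol a' b' al f.
Proof.
move=> aa bb [C C0 H]; exists C => // s t *; apply: H => //; lra.
Qed.

Lemma hol_ext a b al f f' : (forall t, a <= t -> t <= b -> f t = f' t) ->
  hol a b al f -> hol a b al f'.
Proof.
by move=> E [C C0 H]; exists C => // s t *; rewrite -!E//; try lra; apply: H.
Qed.

Lemma hol_cst a b al c : hol a b al (fun=> c).
Proof. by exists 0 => // s t *; rewrite subrr normr0 mul0r. Qed.

Lemma holD a b al f g : hol a b al f -> hol a b al g -> hol a b al (fun t => f t + g t).
Proof.
move=> [C C0 H] [C' C'0 H']; exists (C + C'); first exact: addr_ge0.
move=> s t as_ st tb; rewrite mulrDl.
have -> : f t + g t - (f s + g s) = (f t - f s) + (g t - g s) by ring.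
by apply: le_trans (ler_normD _ _) _; apply: lerD; [apply: H|apply: H'].
Qed.

Lemma holZ a b al c f : hol a b al f -> hol a b al (fun t => c * f t).
Proof.
move=> [C C0 H]; exists (`|c| * C); first exact: mulr_ge0.
move=> s t as_ st tb; rewrite -mulrBr normrM -mulrA ler_wpM2l//; exact: H.
Qed.

Lemma hol_sum a b al (I : Type) (r : seq I) (P : pred I) (f : I -> R -> R) :
  (forall i, P i -> hol a b al (f i)) ->
  hol a b al (fun t => \sum_(i <- r | P i) f i t).
Proof.
move=> H; elim: r => [|i r IH].
  by apply: hol_ext (hol_cst a b al 0) => t *; rewrite big_nil.
case: (boolP (P i)) => Pi.
  by apply: hol_ext (holD (H i Pi) IH) => t *; rewrite big_cons Pi.
by apply: hol_ext IH => t *; rewrite big_cons (negbTE Pi).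
Qed.

Lemma hol_bdd a b al f : 0 < al -> hol a b al f -> bdd a b f.
Proof.
move=> al0 [C C0 H]; exists (`|f a| + C * `|b - a| `^ al).
  by rewrite addr_ge0 ?mulr_ge0 ?powR_ge0.
move=> t at_ tb; have := H a t (lexx _) at_ tb.
have : C * (t - a) `^ al <= C * `|b - a| `^ al.
  by rewrite ler_wpM2l// ler_powRl//; try lra; rewrite ger0_norm; lra.
have -> : f t = (f t - f a) + f a by ring.
have := ler_normD (f t - f a) (f a); rewrite addrK; lra.
Qed.

Lemma holM a b al f g : 0 < al -> hol a b al f -> hol a b al g ->
  hol a b al (fun t => f t * g t).
Proof.
move=> al0 hf hg; have [A A0 fA] := hol_bdd al0 hf; have [B B0 gB] := hol_bdd al0 hg.
have [C C0 H] := hf; have [C' C'0 H'] := hg.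
exists (A * C' + B * C); first by rewrite addr_ge0 ?mulr_ge0.
move=> s t as_ st tb.
have -> : f t * g t - f s * g s = f t * (g t - g s) + g s * (f t - f s) by ring.
apply: le_trans (ler_normD _ _) _; rewrite mulrDl !normrM -!mulrA.
by apply: lerD; apply: ler_pM => //; [apply: fA|apply: H'|apply: gB|apply: H]; lra.
Qed.

Lemma powR_split (r al al' : R) : 0 <= r -> 0 < al -> al <= al' ->
  r `^ al' = r `^ (al' - al) * r `^ al.
Proof.
move=> r0 al0 aa; rewrite -powRD ?subrK//.
by apply/implyP => /eqP; lra.
Qed.

Lemma hol_le a b al al' f : 0 < al -> al <= al' -> hol a b al' f -> hol a b al f.
Proof.
move=> al0 aa [C C0 H]; exists (C * `|b - a| `^ (al' - al)).
  by rewrite mulr_ge0 ?powR_ge0.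
move=> s t as_ st tb; apply: le_trans (H _ _ as_ st tb) _.
rewrite -mulrA ler_wpM2l// (powR_split _ al0 aa) ?subr_ge0//.
by rewrite ler_wpM2r ?powR_ge0// ler_powRl//; try lra; rewrite ger0_norm; lra.
Qed.

Lemma hol_cat a b c al f : 0 < al -> a <= b -> b <= c ->
  hol a b al f -> hol b c al f -> hol a c al f.
Proof.
move=> al0 ab bc [C C0 H] [C' C'0 H']; exists (C + C'); first exact: addr_ge0.
move=> s t as_ st tc.
have p0 : 0 <= (t - s) `^ al by exact: powR_ge0.
have CC : C * (t - s) `^ al <= (C + C') * (t - s) `^ al by rewrite ler_wpM2r//; lra.
have CC' : C' * (t - s) `^ al <= (C + C') * (t - s) `^ al by rewrite ler_wpM2r//; lra.
have [tb|/ltW bt] := leP t b; first by have := H s t as_ st tb; lra.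
have [bs|/ltW sb] := leP b s; first by have := H' s t bs st tc; lra.
have h1 := H s b as_ sb (lexx _); have h2 := H' b t (lexx _) bt tc.
have h3 : C * (b - s) `^ al <= C * (t - s) `^ al by rewrite ler_wpM2l// ler_powRl//; lra.
have h4 : C' * (t - b) `^ al <= C' * (t - s) `^ al by rewrite ler_wpM2l// ler_powRl//; lra.
have -> : f t - f s = (f t - f b) + (f b - f s) by ring.
have := ler_normD (f t - f b) (f b - f s); lra.
Qed.

(** Over short intervals the germ f_s (g_t - g_s) dominates; longer ones are cut by
    [chop]. *)
Lemma hol_germ a b be f g h : 0 < be -> be <= 1 -> bdd a b f -> hol a b be g ->
  germ a b f g h -> hol a b be h.
Proof.
move=> be0 be1 [A A0 fA] [C C0 gC] gh.
have [d d0 H] := gh 1 ltr01.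
pose B := `|b - a| `^ (1 - be).
have B0 : 0 <= B by exact: powR_ge0.
pose C0' := A * C + B.
have C0'0 : 0 <= C0' by rewrite addr_ge0// mulr_ge0.
have loc s t : a <= s -> s <= t -> t <= b -> t - s < d ->
    `|h t - h s| <= C0' * (t - s) `^ be.
  move=> as_ st tb tsd.
  have := H s s t as_ (lexx _) st tb tsd; rewrite mul1r => h1.
  have h2 : `|f s * (g t - g s)| <= A * C * (t - s) `^ be.
    rewrite normrM -mulrA; apply: ler_pM => //; [apply: fA|exact: gC]; lra.
  have h3 : t - s <= B * (t - s) `^ be.
    rewrite -{1}(@powRr1 _ (t - s)) ?subr_ge0//.
    rewrite (powR_split _ be0 be1) ?subr_ge0// ler_wpM2r ?powR_ge0//.
    by rewrite ler_powRl//; try lra; rewrite ger0_norm; lra.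
  have -> : h t - h s = (h t - h s - f s * (g t - g s)) + f s * (g t - g s) by ring.
  have := ler_normD (h t - h s - f s * (g t - g s)) (f s * (g t - g s)).
  by rewrite /C0' mulrDl; lra.
have [n nP] := natr_gtP ((b - a) / d).
have n0 : 0 <= n%:R :> R by [].
pose E := C0' * `|b - a| `^ be.
have E0 : 0 <= E by rewrite mulr_ge0 ?powR_ge0.
have db0 : 0 < d `^ be by exact: powR_gt0.
exists (C0' + n%:R * E / d `^ be).
  by rewrite addr_ge0// divr_ge0 ?mulr_ge0// ltW.
move=> s t as_ st tb.
have p0 : 0 <= (t - s) `^ be by exact: powR_ge0.
have q0 : 0 <= n%:R * E / d `^ be by rewrite divr_ge0 ?mulr_ge0// ltW.
have [tsd|dts] := ltP (t - s) d.
  rewrite [leRHS]mulrDl; have := loc s t as_ st tb tsd.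
  have : 0 <= n%:R * E / d `^ be * (t - s) `^ be by rewrite mulr_ge0.
  lra.
apply: (@le_trans _ _ (0 * (t - s) + n%:R * E)).
  apply: (@chop _ h 0 E d) => //; last first.
    by move: nP; rewrite ltr_pdivrMr//; lra.
  move=> u v su uv vt uvd; rewrite mul0r add0r.
  have au : a <= u by lra.
  have vb : v <= b by lra.
  apply: le_trans (loc u v au uv vb uvd) _.
  by rewrite ler_wpM2l// ler_powRl//; try lra; rewrite ger0_norm; lra.
rewrite mul0r add0r [leRHS]mulrDl -[leLHS]add0r; apply: lerD; first exact: mulr_ge0.
rewrite mulrAC ler_pdivlMr// ler_wpM2l ?mulr_ge0// ler_powRl//; lra.
Qed.

End Hoelder.

(** * Calculus of Young integrals *)

Section Calculus.
Context {R : realType}.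
Implicit Types (a b s t u v : R) (f g h F G e : R -> R).

(** A path may be integrable for two reasons, its Hoelder exponent ([okf_young]) or,
    for be = 1, its continuity ([okf_ucont]); later statements do not distinguish. *)
Definition okf a b be f : Prop :=
  bdd a b f /\ forall g, hol a b be g -> yint a b f g.

(** The differential relation dh = \sum_i f_i dg_i. *)
Definition sgerm a b (I : Type) (r : seq I) (f g : I -> R -> R) h : Prop :=
  small a b (fun s _ t => h t - h s - \sum_(i <- r) f i s * (g i t - g i s)).

Lemma bdd_ext a b f f' : (forall t, a <= t -> t <= b -> f t = f' t) ->
  bdd a b f -> bdd a b f'.
Proof. by move=> E [C C0 H]; exists C => // t *; rewrite -E//; exact: H. Qed.

Lemma okf_ext a b be f f' : (forall t, a <= t -> t <= b -> f t = f' t) ->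
  okf a b be f -> okf a b be f'.
Proof.
move=> E [bf yf]; split; first exact: bdd_ext bf.
by move=> g /yf; apply: yint_ext.
Qed.

Lemma okf_young a b be al f : a <= b -> 0 < be -> 0 < al -> 1 < al + be ->
  hol a b al f -> okf a b be f.
Proof.
move=> ab be0 al0 albe hf; split; first exact: hol_bdd al0 hf.
by move=> g hg; apply: yint_hol hf hg.
Qed.

Lemma okf_hol a b be f : a <= b -> 2^-1 < be -> hol a b be f -> okf a b be f.
Proof. by move=> ab be2 hf; apply: (@okf_young a b be be) => //; lra. Qed.

Lemma okf_ucont a b f : a <= b -> ucont a b f -> okf a b 1 f.
Proof.
move=> ab uf; split; last first.
  move=> g [L L0 gL]; apply: (@yint_lip _ a b L) => // s t as_ st tb.
  by have := gL s t as_ st tb; rewrite powRr1 ?subr_ge0.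
have [d d0 H] := uf 1 ltr01; have [n nP] := natr_gtP ((b - a) / d).
move: nP; rewrite ltr_pdivrMr// => nP.
exists (`|f a| + n%:R * 1) => [|t at_ tb]; first by rewrite addr_ge0.
have : `|f t - f a| <= 0 * (t - a) + n%:R * 1.
  apply: (@chop _ f 0 1 d) => //; last lra.
  move=> u v *; rewrite mul0r add0r; apply: H => //; lra.
have -> : f t = (f t - f a) + f a by ring.
have := ler_normD (f t - f a) (f a); rewrite addrK; lra.
Qed.

Lemma okf_yint a b be f g : okf a b be f -> hol a b be g -> yint a b f g.
Proof. by case=> _; apply. Qed.

Lemma germ_RSint a b be f g : a <= b -> okf a b be f -> hol a b be g ->
  germ a b f g (fun t => RSint f g a t).
Proof. by move=> ab [_ yf] hg; apply/prim_germ/prim_RSint/yf. Qed.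

Lemma hol_RSint a b be f g : a <= b -> 0 < be -> be <= 1 ->
  okf a b be f -> hol a b be g -> hol a b be (fun t => RSint f g a t).
Proof.
move=> ab be0 be1 kf hg; apply: (hol_germ be0 be1 kf.1 hg).
exact: germ_RSint kf hg.
Qed.

Lemma sgerm1 a b f g h : germ a b f g h ->
  sgerm a b [:: tt] (fun=> f) (fun=> g) h.
Proof. by apply: small_ext => *; rewrite big_seq1. Qed.

Lemma sgerm_sum a b (I : Type) (r : seq I) (f g h : I -> R -> R) :
  (forall i, germ a b (f i) (g i) (h i)) ->
  sgerm a b r f g (fun t => \sum_(i <- r) h i t).
Proof.
move=> H; apply: small_ext (small_sum r (fun i (_ : xpredT i) => H i)) => *.
by rewrite -!sumrB.
Qed.

(** Both sides have the same germ and agree at a. *)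
Lemma sgermP a b be (I : Type) (r : seq I) (f g : I -> R -> R) h t : a <= b ->
  (forall i, okf a b be (f i)) -> (forall i, hol a b be (g i)) ->
  sgerm a b r f g h -> a <= t -> t <= b ->
  h t = h a + \sum_(i <- r) RSint (f i) (g i) a t.
Proof.
move=> ab kf hg sh; move: t; apply: small_eq; last first.
  by rewrite big1 ?addr0// => i _; rewrite RSintxx.
have H : sgerm a b r f g (fun t => \sum_(i <- r) RSint (f i) (g i) a t).
  by apply: (@sgerm_sum _ _ _ r f g) => i; apply: germ_RSint.
apply: small_ext (smallD sh (smallZ (-1) H)) => s u t _ _ _ _; ring.
Qed.

Lemma sgerm_RSint a b be (I : Type) (r : seq I) (f g : I -> R -> R) h c : a <= b ->
  (forall i, okf a b be (f i)) -> (forall i, hol a b be (g i)) ->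
  (forall t, a <= t -> t <= b -> h t = c + \sum_(i <- r) RSint (f i) (g i) a t) ->
  sgerm a b r f g h.
Proof.
move=> ab kf hg hE.
have H : sgerm a b r f g (fun t => \sum_(i <- r) RSint (f i) (g i) a t).
  by apply: (@sgerm_sum _ _ _ r f g) => i; apply: germ_RSint.
apply: small_ext H => s u t *; rewrite !hE; lra.
Qed.

(** A bounded integrand e multiplies the error in dh = \sum_i f_i dg_i by a bounded
    factor, so that e dh = \sum_i e f_i dg_i. *)
Lemma RSint_assoc a b be (I : Type) (r : seq I) e (f g : I -> R -> R) h t : a <= b ->
  okf a b be e -> hol a b be h ->
  (forall i, okf a b be (fun u => e u * f i u)) -> (forall i, hol a b be (g i)) ->
  sgerm a b r f g h -> a <= t -> t <= b ->
  RSint e h a t = \sum_(i <- r) RSint (fun u => e u * f i u) (g i) a t.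
Proof.
move=> ab ke hh kf hg sh at_ tb.
suff : sgerm a b r (fun i u => e u * f i u) g (fun t => RSint e h a t).
  by move/(sgermP ab kf hg) => -> //; rewrite RSintxx add0r.
have [[C C0 eC] _] := ke.
have := germ_RSint ab ke hh.
have : small a b (fun s _ t => e s * (h t - h s - \sum_(i <- r) f i s * (g i t - g i s))).
  by apply: (@smallMl _ _ _ C (fun s _ _ => e s)) sh => s u v *; apply: eC; lra.
move=> s1 s2; apply: small_ext (smallD s2 s1) => s u v *.
have -> : \sum_(i <- r) e s * f i s * (g i v - g i s) =
    e s * \sum_(i <- r) f i s * (g i v - g i s).
  by rewrite mulr_sumr; apply: eq_bigr => i _; ring.
ring.
Qed.

Lemma RSint_assoc1 a b be e f g h t : a <= b ->
  okf a b be e -> hol a b be h ->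
  okf a b be (fun u => e u * f u) -> hol a b be g ->
  germ a b f g h -> a <= t -> t <= b ->
  RSint e h a t = RSint (fun u => e u * f u) g a t.
Proof.
move=> ab ke hh kf hg sh at_ tb.
by rewrite (RSint_assoc ab ke hh (fun=> kf) (fun=> hg) (sgerm1 sh))// big_seq1.
Qed.

(** d(FG) = F dG + G dF, because the product of the increments of F and G is of
    order 2 be > 1. *)
Lemma germ_prod a b be F G : 2^-1 < be -> hol a b be F -> hol a b be G ->
  small a b (fun s _ t => F t * G t - F s * G s
      - (F s * (G t - G s) + G s * (F t - F s))).
Proof.
move=> be2 [C C0 FC] [C' C'0 GC].
apply: (@small_pow _ a b (C * C') (be + be)); first lra.
move=> s u t as_ su ut tb; have st : s <= t by lra.
have -> : F t * G t - F s * G s - (F s * (G t - G s) + G s * (F t - F s)) =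
  (F t - F s) * (G t - G s) by ring.
rewrite normrM powRD; last by rewrite gt_eqF//; lra.
by rewrite mulrACA; apply: ler_pM => //; [exact: FC|exact: GC].
Qed.

Lemma RSint_prod a b be F G t : a <= b -> 2^-1 < be ->
  hol a b be F -> hol a b be G -> a <= t -> t <= b ->
  F t * G t = F a * G a + (RSint F G a t + RSint G F a t).
Proof.
move=> ab be2 hF hG at_ tb.
pose f (i : bool) := if i then F else G.
pose g (i : bool) := if i then G else F.
have -> : RSint F G a t + RSint G F a t = \sum_(i <- [:: true; false]) RSint (f i) (g i) a t.
  by rewrite big_cons big_seq1.
apply: (sgermP (h := fun t => F t * G t) ab (be := be)) => //.
- by case; apply: okf_hol.
- by case.
by apply: small_ext (germ_prod be2 hF hG) => *; rewrite big_cons big_seq1.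
Qed.

Lemma RSint0 g s t : s <= t -> RSint (fun=> 0) g s t = 0.
Proof.
move=> st; rewrite (@RSint_prim _ s t _ _ (fun=> 0)) ?subrr//.
by apply: small_ext (small0 s t) => *; rewrite subrr mul0r subr0.
Qed.

Lemma RSint_congr a b be f f' g t : (forall u, a <= u -> u <= b -> f u = f' u) ->
  okf a b be f' -> hol a b be g -> a <= t -> t <= b ->
  RSint f g a t = RSint f' g a t.
Proof.
move=> E kf hg at_ tb.
apply: (@RSint_ext _ a b 0) => //; last exact: okf_yint kf hg.
by move=> u *; rewrite add0r.
Qed.

Lemma RSint_sum a b be (I : Type) (r : seq I) (f : I -> R -> R) g t :
  (forall i, okf a b be (f i)) -> hol a b be g -> a <= t -> t <= b ->
  RSint (fun u => \sum_(i <- r) f i u) g a t = \sum_(i <- r) RSint (f i) g a t.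
Proof.
move=> kf hg at_ tb.
have := @RSint_sumf _ a b I r xpredT (fun=> 1) f g t.
rewrite (_ : (fun u => \sum_(i <- r) 1 * f i u) = fun u => \sum_(i <- r) f i u); last first.
  by apply/funext => u; apply: eq_bigr => i _; rewrite mul1r.
move=> ->//; first by apply: eq_bigr => i _; rewrite mul1r.
by move=> i _; exact: okf_yint (kf i) hg.
Qed.

Lemma RSint_add a b be f f' g t : okf a b be f -> okf a b be f' -> hol a b be g ->
  a <= t -> t <= b ->
  RSint (fun u => f u + f' u) g a t = RSint f g a t + RSint f' g a t.
Proof.
move=> kf kf' hg at_ tb; pose F (i : bool) := if i then f else f'.
transitivity (RSint (fun u => \sum_(i <- [:: true; false]) F i u) g a t).
  by congr (RSint _ _ _ _); apply/funext => u; rewrite big_cons big_seq1.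
by rewrite (@RSint_sum a b be) => // [|[]//]; rewrite big_cons big_seq1.
Qed.

Lemma RSint_addg a b be f g g' s t : okf a b be f -> hol a b be g -> hol a b be g' ->
  a <= s -> s <= t -> t <= b ->
  RSint f (fun u => g u + g' u) s t = RSint f g s t + RSint f g' s t.
Proof.
move=> kf hg hg' as_ st tb.
have [h ph] := okf_yint kf hg; have [h' ph'] := okf_yint kf hg'.
have ps : prim a b f (fun u => g u + g' u) (fun u => h u + h' u).
  by apply: small_ext (smallD ph ph') => *; ring.
by rewrite (RSint_prim ps)// (RSint_prim ph)// (RSint_prim ph')//; ring.
Qed.

Lemma okfD a b be f f' : a <= b -> okf a b be f -> okf a b be f' ->
  okf a b be (fun u => f u + f' u).
Proof.
move=> ab [[C C0 H] yf] [[C' C'0 H'] yf']; split.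
  exists (C + C') => [|t at_ tb]; first exact: addr_ge0.
  by apply: le_trans (ler_normD _ _) _; apply: lerD; [exact: H|exact: H'].
move=> g hg; pose F (i : bool) := if i then f else f'.
apply: (@yint_ext _ a b (fun u => \sum_(i <- [:: true; false]) 1 * F i u) g) => //.
  by move=> t *; rewrite big_cons big_seq1 !mul1r.
by apply: yint_sumf => // -[] _; [exact: yf|exact: yf'].
Qed.

Lemma okf_sum a b be (I : Type) (r : seq I) (f : I -> R -> R) : a <= b -> 2^-1 < be ->
  (forall i, okf a b be (f i)) -> okf a b be (fun u => \sum_(i <- r) f i u).
Proof.
move=> ab be2 kf; elim: r => [|i r IH].
  apply: (@okf_ext a b be (fun=> 0)) => [t *|]; first by rewrite big_nil.
  by apply: okf_hol => //; exact: hol_cst.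
by apply: okf_ext (okfD ab (kf i) IH) => t *; rewrite big_cons.
Qed.

End Calculus.

(** * Functions of class C^k on column vectors *)

Section ClassCk.
Context {R : realType} {d : nat}.
Implicit Types (y z h : 'cV[R]_d) (f F G : 'cV[R]_d -> R).

Lemma cV_norm_coord z i : `|z i 0| <= `|z|.
Proof.
rewrite [leRHS]mx_normrE.
by apply: (@le_bigmax _ _ _ 0 (fun ij => `|z ij.1 ij.2|) (i, 0)).
Qed.

Lemma cV_norm_le z (c : R) : 0 <= c -> (forall i, `|z i 0| <= c) -> `|z| <= c.
Proof.
move=> c0 H; rewrite [leLHS]mx_normrE; apply/bigmax_leP; split => // -[i j] _ /=.
by rewrite (ord1 j).
Qed.

Lemma cV_ball_compact (r : R) : compact [set z : 'cV[R]_d | `|z| <= r].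
Proof.
have [r0|r0] := ltP r 0.
  rewrite (_ : mkset _ = set0); first exact: compact0.
  apply/seteqP; split => z //= zr; have := normr_ge0 z; lra.
have -> : [set z : 'cV[R]_d | `|z| <= r] =
    trmx @` [set v : 'rV[R]_d | forall i, [set` `[(-r), r]] (v ord0 i)].
  apply/seteqP; split => [z /= zr|_ [v /= vr <-]].
    exists z^T; last exact: trmxK.
    by move=> i; rewrite mxE in_itv/= -ler_norml (le_trans (cV_norm_coord _ _)).
  by apply: cV_norm_le => // i; have := vr i; rewrite mxE in_itv/= -ler_norml.
apply: continuous_compact; last first.
  by apply: (@rV_compact R d (fun=> [set` `[(- r), r]])) => _; exact: segment_compact.
apply: continuous_subspaceT => v A [P nP sP]; exists (fun i j => P j i).
  by move=> i j; have := nP j i; rewrite mxE.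
by move=> w wP; apply: sP => i j; rewrite mxE; apply: wP.
Qed.

Lemma continuous_ucont_ball F (r e : R) : continuous F -> 0 < e ->
  exists2 delta, 0 < delta & forall y z, `|y| <= r -> `|z - y| < delta ->
    `|F z - F y| <= e.
Proof.
move=> cF e0.
have /compact_near_coveringP := @cV_ball_compact r.
move=> /(_ R 0^'+ (fun del y => forall z, `|z - y| < del -> `|F z - F y| <= e) _) cov.
have [|d0 /= d00 H] := cov.
  move=> x xr; have e2 : 0 < e / 2 by lra.
  have /cvgrPdist_lt /(_ _ e2) /nbhs_ballP [d0 /= d00 H] := cF x.
  have d2 : 0 < d0 / 2 by lra.
  exists (ball x (d0 / 2), [set del | del < d0 / 2]) => /=.
    by split; [exact: nbhsx_ballx|exact: nbhs_right_lt].
  move=> [y del] /= []; rewrite -ball_normE /= => xy dd z zy.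
  have h1 : `|F x - F y| < e / 2 by apply: H; rewrite -ball_normE /=; lra.
  have h2 : `|F x - F z| < e / 2.
    apply: H; rewrite -ball_normE /=.
    have -> : x - z = (x - y) - (z - y) by rewrite opprB addrA subrK.
    have := ler_normB (x - y) (z - y); lra.
  have -> : F z - F y = (F x - F y) - (F x - F z) by ring.
  have := ler_normB (F x - F y) (F x - F z); lra.
exists (d0 / 2); first lra.
move=> y z yr; apply: H yr z; last lra.
by rewrite /ball_ /= sub0r normrN ger0_norm; lra.
Qed.

Lemma continuous_bounded_ball F (r : R) : continuous F ->
  exists2 C, 0 <= C & forall z, `|z| <= r -> `|F z| <= C.
Proof.
move=> cF.
have /compact_bounded : compact (F @` [set z : 'cV[R]_d | `|z| <= r]).
  apply: continuous_compact; last exact: cV_ball_compact.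
  exact: continuous_subspaceT.
case=> M [Mr H]; exists (`|M| + 1); first by rewrite addr_ge0.
move=> z zr; apply: (H (`|M| + 1)); last by exists z.
by have := ler_norm M; lra.
Qed.

(** The mean value theorem on each of the d segments, parallel to the axes, that
    lead from z to z + h. *)
Lemma mean_value F : (forall i y, derivable F y (delta_mx i 0)) ->
  forall z h, exists2 xi : 'I_d -> 'cV[R]_d, (forall i, `|xi i - z| <= `|h|) &
    F (z + h) - F z = \sum_i h i 0 * partial i F (xi i).
Proof.
move=> dF z h.
have one (i : 'I_d) (p : 'cV[R]_d) (c : R) : exists2 r : R, `|r| <= `|c| &
    F (p + c *: delta_mx i 0) - F p = c * partial i F (p + r *: delta_mx i 0).
  pose phi (r : R) := F (p + r *: delta_mx i 0).
  have quot (r : R) : (fun k : R => k^-1 *: ((phi \o shift r) (k *: 1) - phi r)) =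
      (fun k : R => k^-1 *: ((F \o shift (p + r *: delta_mx i 0)) (k *: delta_mx i 0)
                 - F (p + r *: delta_mx i 0))).
    apply/funext => k; rewrite /phi /=.
    by rewrite -[k *: 1]/(k * 1) mulr1 scalerDl addrCA.
  have dphi (r : R) : is_derive r 1 phi (partial i F (p + r *: delta_mx i 0)).
    apply: DeriveDef; first by rewrite /derivable quot; exact: dF.
    by rewrite /derive quot.
  have cphi (A : set R) : {within A, continuous phi}.
    apply: continuous_subspaceT => r.
    by apply: differentiable_continuous; apply/derivable1_diffP; case: (dphi r).
  have [c0|c0|->] := ltgtP c 0.
  - have [r] := MVT c0 (fun r _ => dphi r) (cphi _).
    rewrite in_itv /= => /andP[r1 r2] E; exists r.
      by rewrite !ltr0_norm//; lra.
    move: E; rewrite {2}/phi /phi scale0r addr0 => E; lra.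
  - have [r] := MVT c0 (fun r _ => dphi r) (cphi _).
    rewrite in_itv /= => /andP[r1 r2] E; exists r.
      by rewrite !gtr0_norm//; lra.
    move: E; rewrite /phi scale0r addr0 => E; lra.
  - by exists 0 => //; rewrite scale0r addr0 subrr mul0r.
pose p (k : nat) : 'cV[R]_d := z + \col_j (if (j < k)%N then h j 0 else 0).
have pS (i : 'I_d) : p i.+1 = p i + h i 0 *: delta_mx i 0.
  rewrite /p -addrA; congr (_ + _); apply/colP => j; rewrite !mxE ltnS leq_eqVlt.
  rewrite eqxx andbT -val_eqE /=; case: ltngtP => ji; rewrite ?mulr0 ?addr0 ?mulr1 ?add0r//.
  by congr (h _ 0); exact: val_inj.
pose rr i := sval (cid2 (one i (p i) (h i 0))).
have rrP i : `|rr i| <= `|h i 0| /\ F (p i + h i 0 *: delta_mx i 0) - F (p i) =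
     h i 0 * partial i F (p i + rr i *: delta_mx i 0).
  by rewrite /rr; case: cid2.
exists (fun i : 'I_d => p i + rr i *: delta_mx i 0).
  move=> i; apply: cV_norm_le => // j; rewrite !mxE.
  have [ji|ij] := ltnP j i.
    rewrite (_ : (j == i) = false) /=; last by apply/negbTE; rewrite neq_ltn ji.
    by rewrite mulr0 addr0 addrAC subrr add0r cV_norm_coord.
  have [->|ji] := eqVneq j i; last by rewrite mulr0 !addr0 subrr normr0.
  rewrite mulr1 addr0 addrAC subrr add0r.
  by apply: le_trans (cV_norm_coord _ i); case: (rrP i).
transitivity (F (p d) - F (p 0%N)).
  congr (F _ - F _); last first.
    by rewrite /p; apply/colP => j; rewrite !mxE ltn0 addr0.
  by rewrite /p; apply/colP => j; rewrite !mxE ltn_ord.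
rewrite -(telescope_sumr (fun k => F (p k)) (leq0n d)) big_mkord.
by apply: eq_bigr => i _; rewrite pS; case: (rrP i).
Qed.

Lemma is_Ck0 f : continuous f -> is_Ck 0 f.
Proof. by move=> cf [|//] _. Qed.

(** The last index of zeta is the first derivative taken, so it can be split off
    into f without commuting derivatives. *)
Lemma is_CkSP k f : is_Ck k.+1 f <->
  [/\ continuous f, forall i y, derivable f y (delta_mx i 0) &
      forall i, is_Ck k (partial i f)].
Proof.
split=> [H|[cf df H]].
  split=> [||i zeta zk]; [by case: (H [::])|by case: (H [::]) => // _; apply|].
  have := H (rcons zeta i); rewrite size_rcons /partials foldr_rcons.
  by move=> /(_ zk).
case/lastP => [|zeta i] zk; first by split.
by move: zk; rewrite size_rcons /partials foldr_rcons => zk; apply: H.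
Qed.

Lemma is_Ck_le k k' f : (k <= k')%N -> is_Ck k' f -> is_Ck k f.
Proof.
move=> kk H zeta zk; have [h1 h2] := H zeta (leq_trans zk kk); split=> // zk' .
by apply: h2; exact: leq_trans kk.
Qed.

Lemma is_Ck_continuous k f : is_Ck k f -> continuous f.
Proof. by move=> /(_ [::]) []. Qed.

Lemma is_Ck_derivable k f i y : is_Ck k.+1 f -> derivable f y (delta_mx i 0).
Proof. by case/is_CkSP. Qed.

Lemma is_Ck_partial k f i : is_Ck k.+1 f -> is_Ck k (partial i f).
Proof. by case/is_CkSP. Qed.

Lemma is_Ck_cst k (c : R) : is_Ck k (fun _ : 'cV[R]_d => c).
Proof.
have pc i (e : R) : partial i (fun _ : 'cV[R]_d => e) = fun=> 0.
  by apply/funext => y; rewrite /partial derive_cst.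
elim: k c => [|k IH] c; first by apply: is_Ck0; exact: cst_continuous.
by apply/is_CkSP; split=> [y|i y|i]; [exact: cst_continuous|exact: derivable_cst|rewrite pc; exact: IH].
Qed.

Lemma partialD f g i y : derivable f y (delta_mx i 0) -> derivable g y (delta_mx i 0) ->
  partial i (fun z => f z + g z) y = partial i f y + partial i g y.
Proof. exact: deriveD. Qed.

Lemma partialM f g i y : derivable f y (delta_mx i 0) -> derivable g y (delta_mx i 0) ->
  partial i (fun z => f z * g z) y = f y * partial i g y + g y * partial i f y.
Proof. exact: deriveM. Qed.

Lemma is_CkD k f g : is_Ck k f -> is_Ck k g -> is_Ck k (fun z => f z + g z).
Proof.
elim: k f g => [|k IH] f g.
  move=> /is_Ck_continuous cf /is_Ck_continuous cg; apply: is_Ck0 => y.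
  exact: cvgD (cf y) (cg y).
move=> /is_CkSP[cf df pf] /is_CkSP[cg dg pg]; apply/is_CkSP; split=> [y|i y|i].
- exact: cvgD (cf y) (cg y).
- exact: derivableD (df i y) (dg i y).
- have -> : partial i (fun z => f z + g z) = fun z => partial i f z + partial i g z.
    by apply/funext => y; rewrite partialD.
  exact: IH.
Qed.

Lemma is_CkM k f g : is_Ck k f -> is_Ck k g -> is_Ck k (fun z => f z * g z).
Proof.
elim: k f g => [|k IH] f g.
  move=> /is_Ck_continuous cf /is_Ck_continuous cg; apply: is_Ck0 => y.
  exact: cvgM (cf y) (cg y).
move=> Hf Hg; have [cf df pf] := (is_CkSP k f).1 Hf; have [cg dg pg] := (is_CkSP k g).1 Hg.
apply/is_CkSP; split=> [y|i y|i].
- exact: cvgM (cf y) (cg y).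
- exact: derivableM (df i y) (dg i y).
- have -> : partial i (fun z => f z * g z) =
      fun z => f z * partial i g z + g z * partial i f z.
    by apply/funext => y; rewrite partialM.
  by apply: is_CkD; apply: IH => //; [exact: is_Ck_le Hf|exact: is_Ck_le Hg].
Qed.

Lemma is_Ck_sum k (I : Type) (r : seq I) (P : pred I) (f : I -> 'cV[R]_d -> R) :
  (forall i, P i -> is_Ck k (f i)) -> is_Ck k (fun z => \sum_(i <- r | P i) f i z).
Proof.
move=> H; elim: r => [|i r IH].
  rewrite (_ : (fun z => _) = fun=> 0); first exact: is_Ck_cst.
  by apply/funext => z; rewrite big_nil.
case: (boolP (P i)) => Pi.
  rewrite (_ : (fun z => _) = fun z => f i z + \sum_(j <- r | P j) f j z).
    by apply: is_CkD; [exact: H|].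
  by apply/funext => z; rewrite big_cons Pi.
rewrite (_ : (fun z => _) = fun z => \sum_(j <- r | P j) f j z)//.
by apply/funext => z; rewrite big_cons (negbTE Pi).
Qed.

Lemma derivable_coord (i j : 'I_d) y :
  is_derive y (delta_mx i 0 : 'cV[R]_d) (fun z => z j 0) (i == j)%:R.
Proof.
have E : (fun k : R => k^-1 *: (((fun z : 'cV[R]_d => z j 0) \o shift y)
     (k *: delta_mx i 0) - y j 0)) @ 0^' --> ((i == j)%:R : R).
  apply: cvg_trans (cvg_cst ((i == j)%:R : R)).
  apply: near_eq_cvg.
    near=> k; rewrite /= !mxE eqxx andbT addrK eq_sym.
    rewrite -[_ *: _]/(_ * _) mulrA mulVf ?mul1r//.
    by near: k; exact: nbhs_dnbhs_neq.
  exact: dnbhs_filter.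
split; first exact: (cvgP _ E).
by apply: cvg_lim E; exact: Rhausdorff.
Unshelve. all: by end_near. Qed.

Lemma partial_coord (i j : 'I_d) : partial i (fun z => z j 0) = fun=> (i == j)%:R.
Proof. by apply/funext => y; case: (derivable_coord i j y). Qed.

Lemma is_Ck_lip f (r : R) : is_Ck 1 f -> exists2 L, 0 <= L &
  forall y z, `|y| <= r -> `|z| <= r -> `|f z - f y| <= L * `|z - y|.
Proof.
move=> Hf; have [cf df pf] := (is_CkSP 0 f).1 Hf.
have bnd i := continuous_bounded_ball (3 * r) (is_Ck_continuous (pf i)).
pose C i := sval (cid2 (bnd i)).
have CP i : 0 <= C i /\ forall z, `|z| <= 3 * r -> `|partial i f z| <= C i.
  by rewrite /C; case: cid2.
exists (\sum_i C i); first by apply: sumr_ge0 => i _; case: (CP i).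
move=> y z yr zr; have [xi xiP] := mean_value df y (z - y).
rewrite (addrC y) subrK => ->.
apply: le_trans (ler_norm_sum _ _ _) _; rewrite mulr_suml; apply: ler_sum => i _.
rewrite normrM mulrC; apply: ler_pM => //; last exact: cV_norm_coord.
apply: (CP i).2; have := xiP i; have := ler_normB z y.
have : `|xi i| <= `|xi i - y| + `|y| by rewrite -{1}(subrK y (xi i)) ler_normD.
lra.
Qed.

End ClassCk.

(** * Functions along Hoelder paths *)

Section PathComposition.
Context {R : realType} {d : nat}.
Implicit Types (a b s t al be : R) (Z : R -> 'cV[R]_d) (F G : 'cV[R]_d -> R).

Definition vhol a b al Z : Prop := forall i, hol a b al (fun t => Z t i 0).

Lemma vhol_norm a b al Z : vhol a b al Z -> exists2 C, 0 <= C &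
  forall s t, a <= s -> s <= t -> t <= b -> `|Z t - Z s| <= C * (t - s) `^ al.
Proof.
move=> hZ; pose C i := sval (cid2 (hZ i)).
have CP i : 0 <= C i /\ forall s t, a <= s -> s <= t -> t <= b ->
    `|Z t i 0 - Z s i 0| <= C i * (t - s) `^ al.
  by rewrite /C; case: cid2.
have C0 i : 0 <= C i by case: (CP i).
exists (\sum_i C i); first exact: sumr_ge0.
move=> s t as_ st tb; apply: cV_norm_le.
  by rewrite mulr_ge0 ?powR_ge0// sumr_ge0.
move=> i; rewrite !mxE; apply: le_trans ((CP i).2 _ _ as_ st tb) _.
by rewrite ler_wpM2r ?powR_ge0// (bigD1 i)//= lerDl sumr_ge0.
Qed.

Lemma vhol_bdd a b al Z : 0 < al -> vhol a b al Z -> exists2 r, 0 <= r &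
  forall t, a <= t -> t <= b -> `|Z t| <= r.
Proof.
move=> al0 hZ; have bZ i := hol_bdd al0 (hZ i).
pose C i := sval (cid2 (bZ i)).
have CP i : 0 <= C i /\ forall t, a <= t -> t <= b -> `|Z t i 0| <= C i.
  by rewrite /C; case: cid2.
have C0 i : 0 <= C i by case: (CP i).
exists (\sum_i C i); first exact: sumr_ge0.
move=> t at_ tb; apply: cV_norm_le; first exact: sumr_ge0.
move=> i; apply: le_trans ((CP i).2 _ at_ tb) _.
by rewrite (bigD1 i)//= lerDl sumr_ge0.
Qed.

Lemma hol_comp a b al F Z : 0 < al -> is_Ck 1 F -> vhol a b al Z ->
  hol a b al (fun t => F (Z t)).
Proof.
move=> al0 F1 hZ; have [r r0 Zr] := vhol_bdd al0 hZ.
have [C C0 ZC] := vhol_norm hZ; have [L L0 FL] := is_Ck_lip r F1.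
exists (L * C); first exact: mulr_ge0.
move=> s t as_ st tb; rewrite -mulrA; apply: le_trans (FL _ _ _ _) _.
- by apply: Zr => //; lra.
- by apply: Zr => //; lra.
- by rewrite ler_wpM2l//; exact: ZC.
Qed.

Lemma ucont_comp a b al F Z : 0 < al -> continuous F -> vhol a b al Z ->
  ucont a b (fun t => F (Z t)).
Proof.
move=> al0 cF hZ e e0; have [r r0 Zr] := vhol_bdd al0 hZ.
have [C C0 ZC] := vhol_norm hZ.
have [del del0 H] := continuous_ucont_ball r cF e0.
have C1 : 0 < C + 1 by lra.
exists ((del / (C + 1)) `^ al^-1); first exact/powR_gt0/divr_gt0.
move=> s t as_ st tb tsd; apply: H; first by apply: Zr => //; lra.
apply: le_lt_trans (ZC _ _ as_ st tb) _.
apply: (@le_lt_trans _ _ ((C + 1) * (t - s) `^ al)).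
  by rewrite ler_wpM2r ?powR_ge0//; lra.
rewrite mulrC -ltr_pdivlMr//.
have := @gt0_ltr_powR _ al al0 (t - s) ((del / (C + 1)) `^ al^-1).
rewrite -powRrM mulVf ?gt_eqF// powRr1; last by rewrite divr_ge0// ltW.
by apply; rewrite ?nnegrE ?powR_ge0//; lra.
Qed.

Lemma hol_comp_hoelder a b be gam F Z : 0 < be -> 0 < gam ->
  loc_hoelder gam F -> vhol a b be Z -> hol a b (be * gam) (fun t => F (Z t)).
Proof.
move=> be0 gam0 hF hZ; have [r r0 Zr] := vhol_bdd be0 hZ.
have [C C0 ZC] := vhol_norm hZ; have [L FL] := hF r.
exists (`|L| * C `^ gam); first by rewrite mulr_ge0 ?powR_ge0.
move=> s t as_ st tb.
rewrite powRrM -mulrA -powRM ?powR_ge0//.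
apply: (@le_trans _ _ (L * `|Z t - Z s| `^ gam)).
  by apply: FL; apply: Zr; lra.
apply: (@le_trans _ _ (`|L| * `|Z t - Z s| `^ gam)).
  by rewrite ler_wpM2r ?powR_ge0// ler_norm.
by rewrite ler_wpM2l// ler_powRl ?(ltW gam0)//; exact: ZC.
Qed.

(** The regularity that F needs for the chain rule of its primitives, and for
    F(Z) to be integrable, along every be-Hoelder path Z. *)
Definition young_reg be F : Prop :=
  continuous F /\ (be = 1 \/ exists2 gam, 1 < be * (1 + gam) & loc_hoelder gam F).

Lemma is_Ck_young be F : 2^-1 < be -> is_Ck 1 F -> young_reg be F.
Proof.
move=> be2 F1; split; first exact: is_Ck_continuous F1.
right; exists 1; first lra.
move=> r; have [L L0 H] := is_Ck_lip r F1; exists L => y z yr zr.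
by rewrite powRr1// distrC [X in _ <= _ * X]distrC; exact: H.
Qed.

Lemma okf_comp a b be F Z : a <= b -> 0 < be -> be <= 1 -> young_reg be F ->
  vhol a b be Z -> okf a b be (fun t => F (Z t)).
Proof.
move=> ab be0 be1 [cF [be_1|[gam bg hF]]] hZ.
  by rewrite be_1; apply: okf_ucont => //; exact: (ucont_comp be0 cF hZ).
have gam0 : 0 < gam.
  rewrite ltNge; apply/negP => g0.
  have : be * gam <= 0 by apply: mulr_ge0_le0 => //; exact: ltW.
  lra.
apply: (@okf_young _ a b be (be * gam)) => //.
- exact: mulr_gt0.
- lra.
- exact: hol_comp_hoelder.
Qed.

(** Only the size of xi s t - Z s matters; xi will collect the intermediate points
    of [mean_value]. *)
Lemma young_reg_small a b be G Z (xi : R -> R -> 'cV[R]_d) i : 0 < be ->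
  be <= 1 -> young_reg be G -> vhol a b be Z ->
  (forall s t, `|xi s t - Z s| <= `|Z t - Z s|) ->
  small a b (fun s _ t => (Z t i 0 - Z s i 0) * (G (xi s t) - G (Z s))).
Proof.
move=> be0 be1' [cG Greg] hZ xiZ.
have [r r0 Zr] := vhol_bdd be0 hZ; have [C C0 ZC] := vhol_norm hZ.
have Zi s t : a <= s -> s <= t -> t <= b ->
    `|Z t i 0 - Z s i 0| <= C * (t - s) `^ be.
  move=> as_ st tb; apply: le_trans (ZC _ _ as_ st tb).
  by have := cV_norm_coord (Z t - Z s) i; rewrite !mxE.
case: Greg => [be1|[gam bg hG]].
  move=> e e0.
  have C1 : 0 < C + 1 by lra.
  have [del del0 H] := continuous_ucont_ball r cG (divr_gt0 e0 C1).
  exists (del / (C + 1)); first exact: divr_gt0.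
  move=> s u t as_ su ut tb tsd; have st : s <= t by lra.
  rewrite normrM.
  have h1 := Zi s t as_ st tb; have h2 := ZC s t as_ st tb.
  rewrite be1 powRr1 ?subr_ge0// in h1 h2.
  have tsC : (C + 1) * (t - s) < del by move: tsd; rewrite ltr_pdivlMr//; lra.
  have h3 : `|G (xi s t) - G (Z s)| <= e / (C + 1).
    apply: H; first by apply: Zr; lra.
    apply: le_lt_trans (xiZ s t) _; lra.
  apply: (@le_trans _ _ ((C + 1) * (t - s) * (e / (C + 1)))).
    by apply: ler_pM => //; lra.
  by rewrite mulrAC mulrCA divff ?mulr1// gt_eqF.
have gam0 : 0 < gam.
  rewrite ltNge; apply/negP => g0.
  have : be * gam <= 0 by apply: mulr_ge0_le0 => //; exact: ltW.
  lra.
have [L GL] := hG (3 * r).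
apply: (@small_pow _ a b (`|L| * C `^ (1 + gam)) (be * (1 + gam)) _ bg).
move=> s u t as_ su ut tb; have st : s <= t by lra.
rewrite normrM powRrM -mulrA -powRM ?powR_ge0//.
have hZ1 := Zr s as_ (le_trans st tb).
have hZ2 : `|Z t| <= r by apply: Zr; lra.
have h1 : `|xi s t| <= 3 * r.
  have := xiZ s t; have := ler_normB (Z t) (Z s).
  have : `|xi s t| <= `|xi s t - Z s| + `|Z s|.
    by rewrite -{1}(subrK (Z s) (xi s t)) ler_normD.
  lra.
have h2 : `|Z s| <= 3 * r by lra.
set D := C * (t - s) `^ be.
have D0 : 0 <= D by rewrite mulr_ge0 ?powR_ge0.
have hD : `|Z t - Z s| <= D by exact: ZC.
rewrite powRD; last by rewrite gt_eqF//; lra.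
rewrite powRr1// mulrCA; apply: ler_pM => //; first exact: Zi.
apply: le_trans (GL _ _ h1 h2) _.
apply: (@le_trans _ _ (`|L| * `|xi s t - Z s| `^ gam)).
  by rewrite ler_wpM2r ?powR_ge0// ler_norm.
by rewrite ler_wpM2l// ler_powRl ?(ltW gam0)// (le_trans (xiZ _ _)).
Qed.

(** By [mean_value] the error in dF(Z) = \sum_i partial_i F(Z) dZ^i consists of the
    increments of Z^i times oscillations of partial_i F. *)
Lemma sgerm_chain a b be F Z : 0 < be -> be <= 1 ->
  (forall i y, derivable F y (delta_mx i 0)) ->
  (forall i, young_reg be (partial i F)) -> vhol a b be Z ->
  sgerm a b (index_enum 'I_d) (fun i t => partial i F (Z t)) (fun i t => Z t i 0)
     (fun t => F (Z t)).
Proof.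
move=> be0 be1 dF rF hZ.
pose xi i s t := sval (cid2 (mean_value dF (Z s) (Z t - Z s))) i.
have xiP i s t : `|xi i s t - Z s| <= `|Z t - Z s|.
  by rewrite /xi; case: cid2.
have FE s t : F (Z t) - F (Z s) =
    \sum_i (Z t i 0 - Z s i 0) * partial i F (xi i s t).
  rewrite /xi; case: cid2 => /= x _; rewrite (addrC (Z s)) subrK => ->.
  by apply: eq_bigr => i _; rewrite !mxE.
apply: small_ext (small_sum (index_enum 'I_d) (fun i (_ : xpredT i) =>
    young_reg_small i be0 be1 (rF i) hZ (xiP i))) => s u t *.
by rewrite FE -sumrB; apply: eq_bigr => i _; ring.
Qed.

End PathComposition.


(** * The averaged Jacobian *)

Section AveragedJacobian.
Context {R : realType} {d : nat}.
Implicit Types (y z p q : 'cV[R]_d) (F G : 'cV[R]_d -> R).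

Local Notation mu := (@lebesgue_measure R).

Lemma segment_continuous p q : continuous (fun lam : R => lam *: p + (1 - lam) *: q).
Proof.
move=> lam; apply: cvgD; apply: cvgZr_tmp; first exact: cvg_id.
by apply: cvgB; [exact: cvg_cst|exact: cvg_id].
Qed.

Lemma segment_comp_continuous G p q : continuous G ->
  continuous (fun lam : R => G (lam *: p + (1 - lam) *: q)).
Proof.
move=> cG lam.
apply: (@continuous_comp _ _ _ (fun lam : R => lam *: p + (1 - lam) *: q) G).
  exact: segment_continuous.
exact: cG.
Qed.

Lemma continuous_integrable01 (f : R -> R) : continuous f ->
  mu.-integrable `[0, 1] (EFin \o f).
Proof.
move=> cf; apply: continuous_compact_integrable; first exact: segment_compact.
exact: continuous_subspaceT.
Qed.

Lemma segment_norm (r : R) p q lam : 0 <= lam <= 1 -> `|p| <= r -> `|q| <= r ->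
  `|lam *: p + (1 - lam) *: q| <= r.
Proof.
move=> /andP[l0 l1] pr qr; apply: le_trans (ler_normD _ _) _.
rewrite !normrZ (ger0_norm l0) ger0_norm ?subr_ge0//.
have h1 : lam * `|p| <= lam * r by rewrite ler_wpM2l.
have h2 : (1 - lam) * `|q| <= (1 - lam) * r by rewrite ler_wpM2l// subr_ge0.
lra.
Qed.

Lemma Rintegral01_sum (I : Type) (r : seq I) (f : I -> R -> R) (c : I -> R) :
  (forall i, continuous (f i)) ->
  \int[mu]_(lam in `[0, 1]) (\sum_(i <- r) c i * f i lam) =
  \sum_(i <- r) c i * \int[mu]_(lam in `[0, 1]) (f i lam).
Proof.
move=> cf; have cS s : continuous (fun lam => \sum_(i <- s) c i * f i lam).
  apply: (@continuous_big _ _ +%R 0 xpredT) => [|i _ x]; first exact: add_continuous.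
  by apply: cvgM; [exact: cvg_cst|exact: cf].
elim: r => [|i r IH].
  rewrite big_nil (_ : (fun _ => _) = fun=> 0).
    by rewrite Rintegral_cst// mul0r.
  by apply/funext => lam; rewrite big_nil.
rewrite big_cons -IH -RintegralZl//; last exact: continuous_integrable01.
rewrite -RintegralD//; last 2 first.
- apply: continuous_integrable01 => x.
  by apply: cvgM; [exact: cvg_cst|exact: cf].
- exact: continuous_integrable01.
by congr (Rintegral _ _ _); apply/funext => lam; rewrite big_cons.
Qed.

Lemma segment_derive F p q (lam : R) : is_Ck 1 F ->
  is_derive lam 1 (fun l : R => F (l *: p + (1 - l) *: q))
    (\sum_i (p - q) i 0 * partial i F (lam *: p + (1 - lam) *: q)).
Proof.
move=> /is_CkSP[cF dF pF].
set w := p - q; set z := lam *: p + _.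
pose xi k i := sval (cid2 (mean_value dF z (k *: w))) i.
have xiP k i : `|xi k i - z| <= `|k| * `|w|.
  by rewrite -normrZ /xi; case: cid2.
have FE k : F (z + k *: w) - F z = \sum_i (k *: w) i 0 * partial i F (xi k i).
  by rewrite /xi; case: cid2.
have E : (fun k : R => k^-1 *: (((fun l : R => F (l *: p + (1 - l) *: q)) \o shift lam)
     (k *: 1) - F z)) @ 0^' --> (\sum_i w i 0 * partial i F z : R).
  have c : (fun k => \sum_i w i 0 * partial i F (xi k i)) @ 0^' -->
      (\sum_i w i 0 * partial i F z : R).
    apply: cvg_big => [|i _]; first exact: add_continuous.
    apply: cvgM; first exact: cvg_cst.
    apply: (@cvg_comp _ _ _ (fun k => xi k i) (partial i F) _ (nbhs z)).
      apply/cvgrPdist_lt => e e0; near=> k.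
      rewrite distrC; apply: le_lt_trans (xiP k i) _.
      apply: (@le_lt_trans _ _ (`|k| * (`|w| + 1))).
        by rewrite ler_wpM2l// lerDl.
      rewrite -ltr_pdivlMr ?ltr_wpDl//; near: k.
      apply: dnbhs0_lt; rewrite divr_gt0 ?ltr_wpDl//.
    exact: (is_Ck_continuous (pF i)).
  apply: cvg_trans c; apply: near_eq_cvg; near=> k.
  have -> : ((fun l : R => F (l *: p + (1 - l) *: q)) \o shift lam) (k *: 1) =
      F (z + k *: w).
    congr F; rewrite /z /w /= -[k *: 1]/(k * 1) mulr1; apply/colP => i; rewrite !mxE; ring.
  rewrite FE -[_ *: _]/(k^-1 * _) mulr_sumr; apply: eq_bigr => i _.
  rewrite [X in _ = _ * (X * _)]mxE !mulrA mulVf ?mul1r//.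
  by near: k; exact: nbhs_dnbhs_neq.
split; first exact: (cvgP _ E).
by apply: cvg_lim E; exact: Rhausdorff.
Unshelve. all: by end_near. Qed.

(** The fundamental theorem of calculus on the segment from q to p. *)
Lemma segment_increment F p q : is_Ck 1 F -> F p - F q =
  \sum_i (\int[mu]_(lam in `[0, 1]) partial i F (lam *: p + (1 - lam) *: q))
     * (p i 0 - q i 0).
Proof.
move=> F1; have [cF dF pF] := (is_CkSP 0 F).1 F1.
pose phi (l : R) := F (l *: p + (1 - l) *: q).
have cp i : continuous (fun lam : R => partial i F (lam *: p + (1 - lam) *: q)).
  by apply: segment_comp_continuous; exact: (is_Ck_continuous (pF i)).
have cphi : continuous phi by exact: segment_comp_continuous.
have -> : F p - F q = phi 1 - phi 0.
  by rewrite /phi subrr subr0 !scale0r !scale1r addr0 add0r.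
transitivity (\sum_i (p - q) i 0 *
    \int[mu]_(lam in `[0, 1]) partial i F (lam *: p + (1 - lam) *: q)); last first.
  by apply: eq_bigr => i _; rewrite !mxE mulrC.
rewrite -Rintegral01_sum// /Rintegral (@continuous_FTC2 _ _ phi)//=.
- apply: continuous_subspaceT => x.
  apply: (@continuous_big _ _ +%R 0 xpredT) => [|i _ y]; first exact: add_continuous.
  by apply: cvgM; [exact: cvg_cst|exact: cp].
- split => [l _||].
  + by case: (segment_derive p q l F1).
  + by apply: cvg_at_right_filter; exact: cphi.
  + by apply: cvg_at_left_filter; exact: cphi.
- move=> l _; rewrite derive1E; by case: (segment_derive p q l F1).
Qed.

Lemma hol_segment_average a b al G (Y Z : R -> 'cV[R]_d) : 0 < al -> is_Ck 1 G ->
  vhol a b al Y -> vhol a b al Z ->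
  hol a b al (fun t => \int[mu]_(lam in `[0, 1]) G (lam *: Y t + (1 - lam) *: Z t)).
Proof.
move=> al0 G1 hY hZ.
have [r r0 Yr] := vhol_bdd al0 hY; have [r' r'0 Zr] := vhol_bdd al0 hZ.
have [C C0 YC] := vhol_norm hY; have [C' C'0 ZC] := vhol_norm hZ.
have [L L0 GL] := is_Ck_lip (r + r') G1.
have cG := is_Ck_continuous G1.
exists (L * (C + C')); first by rewrite mulr_ge0// addr_ge0.
move=> s t as_ st tb.
have at_ : a <= t by lra.
have sb : s <= b by lra.
have ci u : continuous (fun lam : R => G (lam *: Y u + (1 - lam) *: Z u)).
  exact: segment_comp_continuous.
rewrite -RintegralB//; try exact: continuous_integrable01.
have cB : continuous (fun lam : R => G (lam *: Y t + (1 - lam) *: Z t) -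
    G (lam *: Y s + (1 - lam) *: Z s)).
  by move=> lam; apply: cvgB; exact: ci.
apply: le_trans (le_normr_Rintegral _ _) _ => //.
  exact: continuous_integrable01.
set K := L * (C + C') * (t - s) `^ al.
have -> : K = \int[mu]_(lam in `[0, 1]) K.
  rewrite Rintegral_cst// -[LHS]mulr1; congr (_ * _); apply/esym.
  have : mu (`[0, 1]%classic : set R) = 1%E.
    by rewrite lebesgue_measure_itv/= lte_fin ltr01 sube0.
  by move=> E; transitivity (fine (1%E : \bar R)) => //; congr fine.
apply: le_Rintegral => //.
- by apply: continuous_integrable01 => lam; apply: cvg_norm; exact: cB.
- by apply: continuous_integrable01 => lam; exact: cvg_cst.
move=> lam /=; rewrite in_itv/= => lam01.
have [l0 l1] := andP lam01.
have hs : `|lam *: Y s + (1 - lam) *: Z s| <= r + r'.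
  apply: segment_norm => //.
    by have := Yr s as_ sb; lra.
  by have := Zr s as_ sb; lra.
have ht : `|lam *: Y t + (1 - lam) *: Z t| <= r + r'.
  apply: segment_norm => //.
    by have := Yr t at_ tb; lra.
  by have := Zr t at_ tb; lra.
apply: le_trans (GL _ _ hs ht) _.
rewrite /K -mulrA ler_wpM2l//.
have -> : lam *: Y t + (1 - lam) *: Z t - (lam *: Y s + (1 - lam) *: Z s) =
    lam *: (Y t - Y s) + (1 - lam) *: (Z t - Z s).
  by apply/colP => i; rewrite !mxE; ring.
apply: le_trans (ler_normD _ _) _; rewrite mulrDl; apply: lerD.
  rewrite normrZ (ger0_norm l0); apply: le_trans (YC _ _ as_ st tb).
  by rewrite ler_piMl.
rewrite normrZ ger0_norm ?subr_ge0//; apply: le_trans (ZC _ _ as_ st tb).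
by rewrite ler_piMl//; lra.
Qed.

End AveragedJacobian.

(** * Shuffles and ordered shuffles of words *)

Section Shuffles.
Variable A : Type.
Implicit Types (u v w : seq A) (bs : seq (seq A)).

Fixpoint shuffles u : seq A -> seq (seq A) :=
  match u with
  | [::] => fun v => [:: v]
  | a :: u' =>
    fix shuffles_u v :=
      match v with
      | [::] => [:: u]
      | b :: v' => map (cons a) (shuffles u' v) ++ map (cons b) (shuffles_u v')
      end
  end.

Lemma shuffles_nilr u : shuffles u [::] = [:: u].
Proof. by case: u. Qed.

Lemma shuffles_cons a u b v : shuffles (a :: u) (b :: v) =
  map (cons a) (shuffles u (b :: v)) ++ map (cons b) (shuffles (a :: u) v).
Proof. by []. Qed.

(** The shuffles of the words of bs in which the first letters of these words stay
    in the order of bs. *)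
Fixpoint oshuffles bs : seq (seq A) :=
  match bs with
  | [::] => [:: [::]]
  | [::] :: bs' => oshuffles bs'
  | (j :: w) :: bs' => [seq j :: v | v <- [seq v | u <- oshuffles bs', v <- shuffles w u]]
  end.

End Shuffles.

Lemma map_shuffles (A B : Type) (f : A -> B) u v :
  shuffles (map f u) (map f v) = map (map f) (shuffles u v).
Proof.
elim: u v => [//|a u IHu]; elim=> [//|b v IHv].
rewrite [map f (a :: u)]/= [map f (b :: v)]/= !shuffles_cons map_cat -!map_comp.
congr (_ ++ _).
  by rewrite -[f b :: map f v]/(map f (b :: v)) IHu -map_comp; apply: eq_map.
by rewrite -[f a :: map f u]/(map f (a :: u)) IHv -map_comp; apply: eq_map.
Qed.

Lemma map_oshuffles (A B : Type) (f : A -> B) bs :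
  oshuffles (map (map f) bs) = map (map f) (oshuffles bs).
Proof.
elim: bs => [//|[|j w] bs IH] //=; rewrite IH.
elim: (oshuffles bs) => [//|u s IHs] /=.
by rewrite !map_cat IHs map_shuffles -!map_comp; congr (_ ++ _); apply: eq_map.
Qed.

Section ShufflesEq.
Variable A : eqType.
Implicit Types (u v w : seq A) (bs : seq (seq A)).

Lemma mem_map_cons a c v (s : seq (seq A)) :
  (c :: v \in map (cons a) s) = (c == a) && (v \in s).
Proof.
apply/mapP/andP => [[w ws [-> ->]]|[/eqP -> vs]]; first by rewrite eqxx.
by exists v.
Qed.

Lemma subseq_perm_eq u v : subseq u v -> perm_eq v u -> v = u.
Proof.
move=> uv /perm_size s; apply/eqP; rewrite eq_sym.
by have [_ <-] := size_subseq_leqif uv; rewrite s.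
Qed.

(** A word v that starts with neither a nor b would leave too little room for both
    a :: u and b :: w. *)
Lemma mem_shuffles u w v : uniq (u ++ w) ->
  (v \in shuffles u w) = [&& perm_eq v (u ++ w), subseq u v & subseq w v].
Proof.
elim: u w v => [|a u IHu] w v.
  move=> _; rewrite [shuffles _ _]/= mem_seq1 sub0seq.
  apply/eqP/idP => [->|/and3P[vw _ wv]]; first by rewrite perm_refl subseq_refl.
  exact: subseq_perm_eq.
elim: w v => [|b w IHw] v U.
  rewrite shuffles_nilr mem_seq1 sub0seq andbT cats0.
  apply/eqP/idP => [->|/andP[vw wv]]; first by rewrite perm_refl subseq_refl.
  exact: subseq_perm_eq.
rewrite shuffles_cons mem_cat.
case: v => [|c v].
  rewrite [subseq _ _]/= andbF.
  by apply/negbTE/norP; split; apply/negP => /mapP[].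
rewrite !mem_map_cons.
have Ua : uniq (u ++ b :: w) by case/andP: U.
have Pb : perm_eq ((a :: u) ++ b :: w) (b :: (a :: u) ++ w).
  exact/permPl/(perm_catCA (a :: u) [:: b]).
have Ub : uniq ((a :: u) ++ w) by move: U; rewrite (perm_uniq Pb) => /andP[].
have ab : a != b.
  by case/andP: U => /= + _; rewrite mem_cat inE !negb_or => /and3P[].
rewrite IHu// IHw//.
have [->|ca] := eqVneq c a.
  rewrite (negbTE ab) orbF /= perm_cons eqxx.
  by rewrite eq_sym (negbTE ab).
have [->|cb] := eqVneq c b.
  by rewrite (permPr Pb) perm_cons /= eqxx (negbTE ab).
apply/esym/negbTE/and3P => -[p].
rewrite /= (eq_sym a) (negbTE ca) (eq_sym b) (negbTE cb) => sa sb.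
have := uniq_leq_size U (s2 := v); rewrite -[(a :: u) ++ _]/(a :: u ++ b :: w).
rewrite -(perm_size p) /= ltnn => H; suff : false by [].
apply: H => z; rewrite -[a :: u ++ b :: w]/((a :: u) ++ b :: w) mem_cat => /orP[].
  exact: mem_subseq sa z.
exact: mem_subseq sb z.
Qed.

Lemma uniq_shuffles u w : uniq (u ++ w) -> uniq (shuffles u w).
Proof.
elim: u w => [//|a u IHu]; elim=> [//|b w IHw] U.
have Ua : uniq (u ++ b :: w) by case/andP: U.
have ab : a != b.
  by case/andP: U => /= + _; rewrite mem_cat inE !negb_or => /and3P[].
have Ub : uniq ((a :: u) ++ w).
  by move: U; rewrite !cat_uniq /= negb_or => /and3P[-> /andP[_ ->] /andP[_ ->]].
rewrite shuffles_cons cat_uniq !map_inj_uniq ?IHu ?IHw//; try by move=> ? ? [].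
rewrite andbT; apply/hasPn => _ /mapP[v _ ->]; rewrite /= mem_map_cons.
by rewrite eq_sym (negbTE ab).
Qed.

Definition heads bs : seq A := flatten [seq take 1 b | b <- bs].

(** The letters of v outside w are, in order, those of the word that was shuffled
    with w. *)
Lemma shuffles_inj w u u' v : uniq (w ++ u) -> uniq (w ++ u') ->
  v \in shuffles w u -> v \in shuffles w u' -> u = u'.
Proof.
suff H x : uniq (w ++ x) -> v \in shuffles w x -> [seq a <- v | a \notin w] = x.
  by move=> U U' /(H _ U) <- /(H _ U') <-.
move=> U; rewrite mem_shuffles// => /and3P[p _ xv].
have xw : all (fun a => a \notin w) x.
  apply/allP => a ax; move: U; rewrite cat_uniq => /and3P[_ /hasPn + _].
  by apply.
apply: subseq_perm_eq; first by rewrite subseq_filter xw.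
apply: perm_trans (perm_filter _ p) _; rewrite filter_cat.
rewrite (_ : [seq a <- w | a \notin w] = [::]) ?cat0s; last first.
  by apply/eqP; rewrite -[_ == _]negbK -has_filter; apply/hasPn => a /= ->.
by move/all_filterP: xw => ->.
Qed.

Lemma oshuffles_perm bs v : uniq (flatten bs) -> v \in oshuffles bs ->
  perm_eq v (flatten bs).
Proof.
elim: bs v => [|[|j w] bs IH] v /=; first by rewrite mem_seq1 => _ /eqP ->.
  exact: IH.
move=> /andP[jw U] /mapP[_ /allpairsPdep[u [v' [ub v'wu ->]]] ->].
have Ub : uniq (flatten bs) by move: U; rewrite cat_uniq => /and3P[].
have pu := IH u Ub ub.
have Uw : uniq (w ++ u) by rewrite (perm_uniq (perm_cat (perm_refl w) pu)).
move: v'wu; rewrite mem_shuffles// => /and3P[p _ _].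
by rewrite perm_cons (perm_trans p)// perm_cat2l.
Qed.

Lemma uniq_oshuffles bs : uniq (flatten bs) -> uniq (oshuffles bs).
Proof.
elim: bs => [//|[|j w] bs IH] //= /andP[jw U].
have Ub : uniq (flatten bs) by move: U; rewrite cat_uniq => /and3P[].
have Uw u : u \in oshuffles bs -> uniq (w ++ u).
  move=> ub; rewrite (perm_uniq (perm_cat (perm_refl w) (oshuffles_perm Ub ub))).
  by [].
rewrite map_inj_uniq; last by move=> ? ? [].
apply: allpairs_uniq_dep; first exact: IH.
  by move=> u ub; apply: uniq_shuffles; exact: Uw.
move=> [u v] [u' v'] /allpairsPdep[x [y [xb yw [-> ->]]]].
move=> /allpairsPdep[x' [y' [xb' yw' [-> ->]]]] /= E.
rewrite -{y'}E in yw' *.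
by rewrite (shuffles_inj (Uw _ xb) (Uw _ xb') yw yw').
Qed.

(** For the converse inclusion, the first letter of v has to be j: it lies in some
    block, hence is the head of that block, and j precedes all the other heads. *)
Lemma mem_oshuffles bs v : uniq (flatten bs) -> all (fun b => b != [::]) bs ->
  (v \in oshuffles bs) =
  [&& perm_eq v (flatten bs), all (fun b => subseq b v) bs & subseq (heads bs) v].
Proof.
elim: bs v => [|[//|j w] bs IH] v U /=.
  move=> _; rewrite mem_seq1 /heads /= sub0seq !andbT.
  by apply/eqP/idP => [->//|/perm_nilP].
move=> nb; have {U} : uniq (j :: w ++ flatten bs) by [].
rewrite cons_uniq => /andP[jw U].
have Ub : uniq (flatten bs) by move: U; rewrite cat_uniq => /and3P[].
apply/idP/and3P.
  move=> /mapP[_ /allpairsPdep[u [v' [ub v'wu ->]]] ->].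
  have pu := oshuffles_perm Ub ub.
  have Uw : uniq (w ++ u) by rewrite (perm_uniq (perm_cat (perm_refl w) pu)).
  move: v'wu; rewrite mem_shuffles// => /and3P[p sw su].
  move: ub; rewrite IH// => /and3P[_ sb hb].
  split.
  - by rewrite perm_cons (perm_trans p)// perm_cat2l.
  - rewrite /= eqxx sw /=; apply/allP => b bb.
    apply: subseq_trans (subseq_cons v' j).
    by apply: subseq_trans su; exact: (allP sb).
  - rewrite /heads /= eqxx take0 /=.
    exact: subseq_trans hb su.
case: v => [|c v] [p /andP[sw sb] sh]; first by [].
have Uv : uniq (c :: v) by rewrite (perm_uniq p) /= jw.
have cv : c \notin v by case/andP: Uv.
have sub_head (h : A) t : c \in h :: t -> subseq (h :: t) (c :: v) -> h = c.
  move=> ct /=; case: eqVneq => // hc st.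
  by move: (mem_subseq st ct); rewrite (negbTE cv).
have cj : j = c.
  have ch : c \in heads ((j :: w) :: bs).
    have /flattenP[b bb cb] : c \in flatten ((j :: w) :: bs).
      by rewrite -(perm_mem p) mem_head.
    have sbv : subseq b (c :: v).
      move: bb; rewrite inE => /orP[/eqP ->//|]; exact: (allP sb).
    apply/flattenP; exists (take 1 b); first exact: map_f.
    case: b bb cb sbv => // h t _ ct st.
    by rewrite (sub_head h t)//= take0 mem_head.
  apply: (sub_head j (heads bs)); last by move: sh; rewrite /heads /= take0.
  by move: ch; rewrite /heads /= take0.
subst c.
rewrite mem_map_cons eqxx /=.
move: p; rewrite perm_cons => p.
pose u := [seq a <- v | a \in flatten bs].
have wbs : [seq a <- w | a \in flatten bs] = [::].
  apply/eqP; rewrite -[_ == _]negbK -has_filter; apply/hasPn => a aw.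
  apply/negP => ab; move: U; rewrite cat_uniq => /and3P[_ /hasPn + _].
  by move=> /(_ _ ab); rewrite /= aw.
have pu : perm_eq u (flatten bs).
  apply: perm_trans (perm_filter _ p) _; rewrite filter_cat wbs /=.
  by rewrite (_ : [seq a <- flatten bs | a \in flatten bs] = flatten bs)//; apply/all_filterP/allP.
have jbs : j \notin flatten bs by move: jw; rewrite mem_cat => /norP[].
have tl s : all (fun a => a \in flatten bs) s -> subseq s (j :: v) -> subseq s u.
  move=> sall; rewrite /u subseq_filter sall /=.
  case: s sall => [|h t] //=; first by rewrite sub0seq.
  move=> /andP[hb _]; case: eqVneq => // hj.
  by move: jbs; rewrite -hj hb.
apply/allpairsPdep; exists u, v; split => //.
  rewrite IH// pu /=; apply/andP; split.
    apply/allP => b bb; apply: tl; last exact: (allP sb).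
    by apply/allP => a ab; apply/flattenP; exists b.
  apply: tl.
    apply/allP => a /flattenP[_ /mapP[b bb ->] ab]; apply/flattenP; exists b => //.
    exact: mem_take ab.
  apply: subseq_trans sh; rewrite /heads /= take0.
  exact: subseq_cons.
rewrite mem_shuffles; last by rewrite (perm_uniq (perm_cat (perm_refl w) pu)).
apply/and3P; split.
- by rewrite (perm_trans p)// perm_cat2l perm_sym.
- by move: sw; rewrite /= eqxx.
- exact: filter_subseq.
Qed.

End ShufflesEq.

(** * The permutations of Xi enumerate ordered shuffles *)

Section PermutationWords.
Variables (r : nat).
Implicit Types (rho : 'S_r) (B : seq 'I_r).

(** The positions in the order in which rho arranges them. *)
Definition perm_word rho : seq 'I_r := [seq (rho^-1)%g i | i <- enum 'I_r].

Lemma perm_word_perm rho : perm_eq (perm_word rho) (enum 'I_r).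
Proof.
apply: uniq_perm; first by rewrite map_inj_uniq ?enum_uniq//; exact: perm_inj.
  exact: enum_uniq.
move=> i; rewrite mem_enum inE; apply/mapP; exists (rho i); first by rewrite mem_enum.
by rewrite permK.
Qed.

Lemma perm_word_inj : injective perm_word.
Proof.
move=> rho rho' /eq_in_map H; suff E : (rho^-1 = rho'^-1)%g.
  by rewrite -[rho]invgK E invgK.
by apply/permP => i; apply: H; rewrite mem_enum.
Qed.

Lemma perm_word_surj (v : seq 'I_r) : perm_eq v (enum 'I_r) ->
  exists rho, v = perm_word rho.
Proof.
move=> p; have sv : size v = r by rewrite (perm_size p) size_enum_ord.
have uv : uniq v by rewrite (perm_uniq p) enum_uniq.
pose f (i : 'I_r) := nth i v i.
have fi : injective f.
  move=> i j; rewrite /f (set_nth_default j); last by rewrite sv.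
  by move/eqP; rewrite nth_uniq ?sv// => /eqP /val_inj.
exists ((perm fi)^-1)%g; rewrite /perm_word invgK.
case: (posnP r) => [r0|r_gt0].
  have -> : v = [::] by apply: size0nil; rewrite sv.
  by apply/esym/size0nil; rewrite size_map size_enum_ord.
apply: (@eq_from_nth _ (Ordinal r_gt0)); first by rewrite size_map size_enum_ord.
move=> i; rewrite sv => ir; rewrite (nth_map (Ordinal r_gt0)) ?size_enum_ord//.
rewrite permE /f nth_enum_ord//.
by apply: set_nth_default; rewrite sv.
Qed.

Lemma enum_pairwise : pairwise (fun a c : 'I_r => (a < c)%N) (enum 'I_r).
Proof.
have := @pairwise_map _ _ val ltn (enum 'I_r) => /= <-.
rewrite val_enum_ord -sorted_pairwise; last exact: ltn_trans.
exact: iota_ltn_sorted.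
Qed.

Lemma perm_word_pairwise rho :
  pairwise (fun a c => (rho a < rho c)%N) (perm_word rho).
Proof.
rewrite pairwise_map; apply: sub_pairwise enum_pairwise => i j /=.
by rewrite !permKV.
Qed.

Lemma subseq_perm_word rho B :
  subseq B (perm_word rho) = pairwise (fun a c => (rho a < rho c)%N) B.
Proof.
have tr : transitive (fun a c => (rho a < rho c)%N) by move=> ? ? ?; exact: ltn_trans.
apply/idP/idP => [/subseq_pairwise|]; first by apply; exact: perm_word_pairwise.
move=> pB.
have -> : B = [seq a <- perm_word rho | a \in B].
  apply: (irr_sorted_eq tr).
  - by move=> a; rewrite ltnn.
  - by rewrite sorted_pairwise.
  - rewrite sorted_pairwise//.
    exact: subseq_pairwise (filter_subseq _ _) (perm_word_pairwise rho).
  - by move=> a; rewrite mem_filter (perm_mem (perm_word_perm rho)) mem_enum andbT.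
exact: filter_subseq.
Qed.

(** On an increasing list of positions, the order of the list is that of the
    positions. *)
Lemma subseq_perm_wordP rho B : subseq B (enum 'I_r) ->
  reflect (forall a c : 'I_r, a \in B -> c \in B -> (a < c)%N -> (rho a < rho c)%N)
    (subseq B (perm_word rho)).
Proof.
move=> sB; rewrite subseq_perm_word.
have uB : uniq B by apply: subseq_uniq sB (enum_uniq _).
have iB : pairwise (fun a c : 'I_r => (a < c)%N) B by apply: subseq_pairwise sB enum_pairwise.
apply: (iffP idP) => [pB a c aB cB ac|H].
  have /(pairwiseP a) {}iB := iB; have /(pairwiseP a) {}pB := pB.
  have ia : (index a B < size B)%N by rewrite index_mem.
  have ic : (index c B < size B)%N by rewrite index_mem.
  have := pB (index a B) (index c B) ia ic; rewrite !nth_index//; apply.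
  have := iB (index c B) (index a B) ic ia; rewrite !nth_index// => K.
  rewrite ltnNge; apply/negP; rewrite leq_eqVlt => /orP[/eqP E|/K].
    have := nth_index a cB; rewrite E nth_index// => ac'.
    by rewrite ac' ltnn in ac.
  by rewrite ltnNge (ltnW ac).
case: B => [//|a0 B'] in sB uB iB H *.
apply/(pairwiseP a0) => i j iB' jB' ij; apply: H; try exact: mem_nth.
by move/(pairwiseP a0): iB; apply.
Qed.

End PermutationWords.

Section OrderedShuffles.
Variables (m : nat).
Implicit Types (gs : seq (seq 'I_m)).

Lemma foldl_addn (k : nat) (s : seq nat) : foldl addn k s = (k + sumn s)%N.
Proof. by elim: s k => [|n s IH] k /=; rewrite ?addn0// IH addnA. Qed.

Section Blocks.
Variables (sh : seq nat).
Let r := sumn sh.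
Let tau := scanl addn 0%N sh.
Let blocks : seq (seq 'I_r) := reshape sh (enum 'I_r).
Hypothesis sh_gt0 : all (fun n => 0 < n)%N sh.

Lemma nth_tau i : (i < size sh)%N -> nth 0%N tau i = sumn (take i.+1 sh).
Proof. by move=> ish; rewrite /tau nth_scanl// foldl_addn. Qed.

Lemma nth_tau0 i : (i < size sh)%N -> nth 0%N (0%N :: tau) i = sumn (take i sh).
Proof.
case: i => [|i] ish; first by rewrite take0.
by rewrite /= nth_tau// ltnW.
Qed.

Lemma sumn_takeS i : (i < size sh)%N ->
  sumn (take i.+1 sh) = (sumn (take i sh) + nth 0 sh i)%N.
Proof. by move=> ish; rewrite (take_nth 0%N)// sumn_rcons. Qed.

Lemma size_blocks : size blocks = size sh.
Proof. by rewrite /blocks size_reshape. Qed.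

Lemma flatten_blocks : flatten blocks = enum 'I_r.
Proof. by rewrite reshapeKr// size_enum_ord. Qed.

Lemma val_block i : (i < size sh)%N ->
  map val (nth [::] blocks i) = iota (sumn (take i sh)) (nth 0%N sh i).
Proof.
move=> ish; rewrite nth_reshape map_take map_drop val_enum_ord drop_iota add0n.
rewrite take_iota; congr (iota _ _); apply/minn_idPl.
rewrite leq_subRL; last first.
  by rewrite /r -[in leqRHS](cat_take_drop i sh) sumn_cat leq_addr.
rewrite -sumn_takeS//.
by rewrite /r -[in leqRHS](cat_take_drop i.+1 sh) sumn_cat leq_addr.
Qed.

Lemma mem_block i (a : 'I_r) : (i < size sh)%N ->
  (a \in nth [::] blocks i) = (nth 0 (0 :: tau) i <= a < nth 0 tau i)%N.
Proof.
move=> ish; rewrite -(mem_map val_inj) val_block// mem_iota.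
by rewrite nth_tau0// nth_tau// sumn_takeS.
Qed.

Lemma mem_last_block i (a : 'I_r) : (i < size sh)%N ->
  (a \in take 1 (rev (nth [::] blocks i))) = (a.+1 == nth 0 tau i)%N.
Proof.
move=> ish; rewrite -(mem_map val_inj) map_take map_rev val_block//.
have : (0 < nth 0 sh i)%N by apply: (allP sh_gt0); exact: mem_nth.
rewrite nth_tau// sumn_takeS//; case: (nth _ _ _) => // n _.
rewrite -[n.+1]addn1 iotaD rev_cat /= take0 mem_seq1 addn1 addnS eqSS.
by [].
Qed.

Lemma tau_incr i j : (i < j)%N -> (j < size sh)%N -> (nth 0 tau i < nth 0 tau j)%N.
Proof.
move=> ij jsh; rewrite !nth_tau//; last exact: ltn_trans jsh.
have nj : (0 < nth 0 sh j)%N by apply: (allP sh_gt0); exact: mem_nth.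
rewrite (sumn_takeS jsh) -[in ltnRHS](cat_take_drop i.+1 (take j sh)) sumn_cat.
rewrite take_takel//; lia.
Qed.

Lemma heads_subseq (A : eqType) (bs : seq (seq A)) : subseq (heads bs) (flatten bs).
Proof.
elim: bs => [//|b bs IH]; rewrite /heads /=; apply: cat_subseq => //.
exact: take_subseq.
Qed.

Lemma block_subseq (B : seq 'I_r) : B \in blocks -> subseq B (enum 'I_r).
Proof.
rewrite -flatten_blocks; elim: blocks => [//|B' s IH] /=.
rewrite inE => /orP[/eqP ->|/IH sB]; first exact: prefix_subseq.
by apply: subseq_trans sB _; exact: suffix_subseq.
Qed.

(** Both sides say that rho preserves the order inside each block and among the ends
    of the blocks; after reversal these ends are the heads in [mem_oshuffles]. *)
Lemma mem_Xi (rho : 'S_r) : (rho \in Xi r tau) =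
  (rev (perm_word rho) \in oshuffles (rev (map rev blocks))).
Proof.
have fl : flatten (rev (map rev blocks)) = rev (enum 'I_r).
  by rewrite -rev_flatten flatten_blocks.
have stau : size tau = size sh by rewrite /tau size_scanl.
rewrite mem_oshuffles; first last.
- apply/allP => w; rewrite mem_rev => /mapP[B /(nthP [::])[i + <-] ->].
  rewrite size_blocks => ish; rewrite -size_eq0 size_rev -(size_map val) val_block//.
  rewrite size_iota -lt0n; apply: (allP sh_gt0); exact: mem_nth.
- by rewrite fl rev_uniq enum_uniq.
have -> : perm_eq (rev (perm_word rho)) (flatten (rev (map rev blocks))).
  by rewrite fl perm_rev perm_sym perm_rev perm_sym perm_word_perm.
rewrite /=.
set hd := heads _.
have shd : subseq (rev hd) (enum 'I_r).
  by rewrite -(revK (enum 'I_r)) subseq_rev -fl heads_subseq.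
have hdP (a : 'I_r) : reflect (exists2 i, (i < size sh)%N & a.+1 = nth 0%N tau i) (a \in rev hd).
  rewrite mem_rev; apply: (iffP flattenP) => [[s /mapP[b]]|[i ish ai]].
    rewrite mem_rev => /mapP[B /(nthP [::])[i + <-] ->] ->.
    by rewrite size_blocks => ish; rewrite mem_last_block// => /eqP; exists i.
  exists (take 1 (rev (nth [::] blocks i))).
    by apply: map_f; rewrite mem_rev; apply: map_f; rewrite mem_nth// size_blocks.
  by rewrite mem_last_block// ai.
rewrite -(revK hd) subseq_rev inE andbC; congr (_ && _).
  apply/forallP/allP => H.
    move=> w; rewrite mem_rev => /mapP[B BB ->]; rewrite subseq_rev.
    have [i + BE] := nthP [::] BB; rewrite size_blocks => ish.
    have Bs := block_subseq BB.
    apply/(subseq_perm_wordP rho Bs) => a c; rewrite -BE !mem_block//.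
    move=> /andP[a1 _] /andP[_ c2] ac.
    have ish' : (i < size tau)%N by rewrite stau.
    have /forallP /(_ a) /forallP /(_ c) /implyP := H (Ordinal ish').
    by apply; rewrite /= a1 ac c2.
  move=> [i /= ish']; apply/forallP => a; apply/forallP => c; apply/implyP.
  move=> /and3P[a1 ac c2].
  have ish : (i < size sh)%N by rewrite -stau.
  have BB : nth [::] blocks i \in blocks by rewrite mem_nth// size_blocks.
  have := H (rev (nth [::] blocks i)); rewrite mem_rev map_f// => /(_ isT).
  rewrite subseq_rev.
  have Bs := block_subseq BB.
  move/(subseq_perm_wordP rho Bs); apply => //; rewrite mem_block//.
    by rewrite a1 (ltn_trans ac).
  by rewrite c2 andbT (leq_trans a1)// ltnW.
apply/forallP/(subseq_perm_wordP rho shd) => H.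
  move=> a c /hdP[i ish ai] /hdP[j jsh cj] ac.
  have ij : (i < j)%N.
    rewrite ltnNge; apply/negP; rewrite leq_eqVlt => /orP[/eqP E|ji].
      by move: ai cj; rewrite E => <- [] E'; rewrite E' ltnn in ac.
    have := tau_incr ji ish; rewrite -ai -cj ltnS ltnNge.
    by rewrite ltnW.
  have ish' : (i < size tau)%N by rewrite stau.
  have jsh' : (j < size tau)%N by rewrite stau.
  have /forallP /(_ (Ordinal jsh')) /forallP /(_ a) /forallP /(_ c) /implyP :=
     H (Ordinal ish').
  by apply; rewrite /= ij ai cj !eqxx.
move=> [i /= ish']; apply/forallP => -[j /= jsh']; apply/forallP => a; apply/forallP => c.
apply/implyP => /and3P[ij /eqP ai /eqP cj].
rewrite stau in ish' jsh'.
apply: H; [by apply/hdP; exists i|by apply/hdP; exists j|].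
by rewrite -ltnS ai cj tau_incr.
Qed.

End Blocks.

(** The words gam o rho^-1, rho in Xi, are the ordered shuffles of the words whose
    concatenation is gam. Words are reversed, since [oshuffles] lists the blocks
    and their letters starting from the outermost integrator. *)
Lemma Xi_oshuffles gs : all (fun w => 0 < size w)%N gs ->
  perm_eq [seq rev (act_word rho) |
      rho <- enum (Xi (size (flatten gs)) (scanl addn 0%N (map size gs)))]
    (oshuffles (rev (map rev gs))).
Proof.
move=> gs0; set gam := flatten gs.
have sg : size gam = sumn (map size gs) by rewrite size_flatten.
have shgt : all (fun n => 0 < n)%N (map size gs) by rewrite all_map.
pose lab := tnth (in_tuple gam).
have labE : map lab (enum 'I_(size gam)) = gam.
  exact: (map_tnth_enum (in_tuple gam)).
have -> : [seq rev (act_word rho) | rho <- enum (Xi (size gam) (scanl addn 0%N (map size gs)))]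
  = map (map lab) [seq rev (perm_word rho) |
      rho <- enum (Xi (size gam) (scanl addn 0%N (map size gs)))].
  rewrite -map_comp; apply: eq_map => rho /=.
  by rewrite map_rev /perm_word -map_comp.
have -> : rev (map rev gs) =
    map (map lab) (rev (map rev (reshape (map size gs) (enum 'I_(size gam))))).
  rewrite map_rev -map_comp; congr rev.
  transitivity (map rev (map (map lab) (reshape (map size gs) (enum 'I_(size gam))))).
    by rewrite map_reshape labE -/(shape gs) flattenK.
  by rewrite -map_comp; apply: eq_map => s /=; rewrite map_rev.
rewrite map_oshuffles; apply: perm_map.
clear labE lab; rewrite -/(shape gs) in sg shgt *.
move: (size gam) sg => r ->.
apply: uniq_perm.
- rewrite map_inj_uniq ?enum_uniq// => rho rho' /(can_inj revK); exact: perm_word_inj.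
- apply: uniq_oshuffles; rewrite -rev_flatten rev_uniq flatten_blocks; exact: enum_uniq.
move=> v; apply/mapP/idP => [[rho]|vo].
  by rewrite mem_enum mem_Xi// => H ->.
have := oshuffles_perm _ vo; rewrite -rev_flatten flatten_blocks rev_uniq enum_uniq.
move=> /(_ isT) p.
have [|rho E] := @perm_word_surj _ (rev v).
  by rewrite perm_rev (perm_trans p)// perm_rev.
exists rho; last by rewrite -E revK.
by rewrite mem_enum mem_Xi// -E revK.
Qed.

End OrderedShuffles.

(** * Sums over tuples and bounded sequences *)

Section TupleSums.
Variables (V : nmodType) (I : finType).
Implicit Types F : seq I -> V.

Lemma big_tuple0 F : \sum_(g : 0.-tuple I) F g = F [::].
Proof.
rewrite (big_pred1 [tuple])//= => g; apply/esym/eqP; exact: tuple0.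
Qed.

Lemma big_tuple_rcons p F :
  \sum_(g : p.+1.-tuple I) F g = \sum_(g : p.-tuple I) \sum_i F (rcons g i).
Proof.
pose h (gi : p.-tuple I * I) : p.+1.-tuple I := [tuple of rcons gi.1 gi.2].
have hi : injective h.
  move=> [g i] [g' i'] /(congr1 val) /= /rcons_inj[E ->].
  by congr (_, _); exact: val_inj.
rewrite pair_bigA (reindex h) //=; apply: onW_bij; apply: inj_card_bij hi _.
by rewrite card_prod !card_tuple expnS mulnC.
Qed.

Lemma big_bseq N F :
  \sum_(w : N.-bseq I) F w = \sum_(r < N.+1) \sum_(g : r.-tuple I) F g.
Proof.
rewrite sig_big_dep /= (reindex (@bseq_tagged_tuple N I)) /=.
  by apply: eq_bigr => w _.
by apply: onW_bij; exact: bseq_tagged_tuple_bij.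
Qed.

End TupleSums.

(** * Iterated integrals of a path *)

Section Words.
Context {R : realType} {m : nat}.
Variables (a b be : R) (x : R -> 'cV[R]_m).
Hypotheses (ab : a <= b) (be2 : 2^-1 < be) (be1 : be <= 1) (hx : vhol a b be x).
Implicit Types (w : seq 'I_m) (t : R).

Let be0 : 0 < be. Proof. by move: be2; lra. Qed.

Lemma iterated_int_rcons (f : R -> R) gs g s t :
  iterated_int f (rcons gs g) s t = RSint (iterated_int f gs s) g s t.
Proof. by rewrite /iterated_int foldl_rcons. Qed.

Lemma xint_rcons w j s t :
  xint x (rcons w j) s t = RSint (xint x w s) (fun u => x u j 0) s t.
Proof. by rewrite /xint map_rcons iterated_int_rcons. Qed.

Lemma xintxx w s : (0 < size w)%N -> xint x w s s = 0.
Proof. by case/lastP: w => // w j _; rewrite xint_rcons RSintxx. Qed.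

(** [rint w] is the iterated integral of the word w read backwards, so that the
    head of w is the outermost integrator. *)
Definition rint w t : R := xint x (rev w) a t.

Lemma rint_cons j w t : rint (j :: w) t = RSint (rint w) (fun u => x u j 0) a t.
Proof. by rewrite /rint rev_cons xint_rcons. Qed.

Lemma hol_xint w : hol a b be (fun t => xint x w a t).
Proof.
elim/last_ind: w => [|w j IH]; first exact: hol_cst.
rewrite (_ : (fun t => _) = fun t => RSint (xint x w a) (fun u => x u j 0) a t).
  by apply: hol_RSint => //; exact: okf_hol.
by apply/funext => t; rewrite xint_rcons.
Qed.

Lemma hol_rint w : hol a b be (rint w). Proof. exact: hol_xint. Qed.

Lemma okf_rint w : okf a b be (rint w).
Proof. by apply: okf_hol => //; exact: hol_rint. Qed.

(** By the product rule either word may provide the outermost integrator, just as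
    either may provide the first letter of a shuffle. *)
Lemma rint_shuffles (u v : seq 'I_m) t : a <= t -> t <= b ->
  rint u t * rint v t = \sum_(w <- shuffles u v) rint w t.
Proof.
elim: u v t => [|j u IHu] v t at_ tb; first by rewrite big_seq1 -[rint [::] t]/(1 : R) mul1r.
elim: v t at_ tb => [|k v IHv] t at_ tb.
  by rewrite shuffles_nilr big_seq1 -[rint [::] t]/(1 : R) mulr1.
rewrite shuffles_cons big_cat !big_map.
rewrite (RSint_prod ab be2 (hol_rint (j :: u)) (hol_rint (k :: v)) at_ tb).
have -> : rint (j :: u) a = 0 by rewrite rint_cons RSintxx.
rewrite mul0r add0r [LHS]addrC.
have gj i w : germ a b (rint w) (fun u => x u i 0) (rint (i :: w)).
  rewrite (_ : rint (i :: w) = fun t => RSint (rint w) (fun u => x u i 0) a t); last first.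
    by apply/funext => s; rewrite rint_cons.
  exact: germ_RSint ab (okf_rint _) (hx _).
have kM w w' : okf a b be (fun u => rint w u * rint w' u).
  by apply: okf_hol => //; apply: holM => //; exact: hol_rint.
rewrite (RSint_assoc1 ab (okf_rint _) (hol_rint _) (kM _ _) (hx j) (gj j u))//.
rewrite (RSint_assoc1 ab (okf_rint _) (hol_rint _) (kM _ _) (hx k) (gj k v))//.
congr (_ + _).
  rewrite (@RSint_congr _ a b be _ (fun s => \sum_(w <- shuffles u (k :: v)) rint w s)) //.
  - rewrite (@RSint_sum _ a b be)//; first by apply: eq_bigr => w _; rewrite rint_cons.
    by move=> w; exact: okf_rint.
  - by move=> s as_ sb; rewrite mulrC IHu.
  - by apply: okf_hol => //; apply: hol_sum => w _; exact: hol_rint.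
rewrite (@RSint_congr _ a b be _ (fun s => \sum_(w <- shuffles (j :: u) v) rint w s)) //.
- rewrite (@RSint_sum _ a b be)//; first by apply: eq_bigr => w _; rewrite rint_cons.
  by move=> w; exact: okf_rint.
- by apply: okf_hol => //; apply: hol_sum => w _; exact: hol_rint.
Qed.

(** The iterated integral whose successive integrators are themselves the iterated
    integrals of the words of gs. *)
Definition word_int (gs : seq (seq 'I_m)) t : R :=
  iterated_int (fun=> 1) [seq (fun u => xint x g a u) | g <- gs] a t.

Lemma word_int_rcons gs g t :
  word_int (rcons gs g) t = RSint (word_int gs) (fun u => xint x g a u) a t.
Proof. by rewrite /word_int map_rcons iterated_int_rcons. Qed.

Lemma hol_word_int gs : hol a b be (word_int gs).
Proof.
elim/last_ind: gs => [|gs g IH]; first exact: hol_cst.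
rewrite (_ : word_int _ = fun t => RSint (word_int gs) (fun u => xint x g a u) a t).
  by apply: hol_RSint => //; [exact: okf_hol|exact: hol_xint].
by apply/funext => t; rewrite word_int_rcons.
Qed.

(** Integrating an iterated integral Y against the iterated integral of w multiplies
    Y by the integral of w without its last letter; only that letter has to come
    after all those of Y. *)
Lemma word_int_oshuffles gs t : a <= t -> t <= b ->
  all (fun w => 0 < size w)%N gs ->
  word_int gs t = \sum_(v <- oshuffles (rev (map rev gs))) rint v t.
Proof.
move=> + + gs0; elim/last_ind: gs gs0 t => [|gs g IH] gs0 t at_ tb.
  by rewrite big_seq1.
move: gs0; rewrite all_rcons => /andP[g0 gs0].
case/lastP: g g0 => // w j _.
rewrite word_int_rcons map_rcons rev_rcons rev_rcons /=.
have gj : germ a b (rint (rev w)) (fun u => x u j 0) (fun u => xint x (rcons w j) a u).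
  rewrite (_ : (fun u => xint x (rcons w j) a u) =
      fun t => RSint (rint (rev w)) (fun u => x u j 0) a t); last first.
    by apply/funext => s; rewrite xint_rcons /rint revK.
  exact: germ_RSint ab (okf_rint _) (hx _).
have kM : okf a b be (fun u => word_int gs u * rint (rev w) u).
  by apply: okf_hol => //; apply: holM => //; [exact: hol_word_int|exact: hol_rint].
rewrite (RSint_assoc1 ab _ (hol_xint _) kM (hx j) gj)//; last first.
  by apply: okf_hol => //; exact: hol_word_int.
rewrite big_map.
set s := [seq v | u <- _, v <- _].
rewrite (@RSint_congr _ a b be _ (fun u => \sum_(v <- s) rint v u)) //.
- rewrite (@RSint_sum _ a b be)//; first by apply: eq_bigr => v _; rewrite rint_cons.
  by move=> v; exact: okf_rint.
- move=> u au ub; rewrite IH// /s big_allpairs_dep /= mulr_suml.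
  by apply: eq_bigr => v _; rewrite mulrC rint_shuffles.
- by apply: okf_hol => //; apply: hol_sum => v _; exact: hol_rint.
Qed.

Lemma sum_Xi_word_int gs t : a <= t -> t <= b -> all (fun w => 0 < size w)%N gs ->
  \sum_(rho in Xi (size (flatten gs)) (scanl addn 0%N (map size gs)))
     xint x (act_word rho) a t = word_int gs t.
Proof.
move=> at_ tb gs0; rewrite word_int_oshuffles//.
rewrite -(perm_big _ (Xi_oshuffles gs0)) /= big_map -big_enum /=.
by apply: eq_bigr => rho _; rewrite /rint revK.
Qed.

End Words.

(** * The homogeneous parts of the Taylor expansion *)

Section VectorFields.
Context {R : realType} {d m : nat}.
Variables (V : 'cV[R]_d -> 'M[R]_(d, m)) (M : nat).
Hypothesis VM : forall i j, is_Ck M (fun y => V y i j).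
Implicit Types (f g : 'cV[R]_d -> R).

Lemma vfields_rcons w j f : vfields V (rcons w j) f = vfields V w (vfield V j f).
Proof. by rewrite /vfields foldr_rcons. Qed.

Lemma vfield_Ck k j f : (k <= M)%N -> is_Ck k.+1 f -> is_Ck k (vfield V j f).
Proof.
move=> kM Hf; apply: is_Ck_sum => i _; apply: is_CkM; first exact: is_Ck_le kM _.
exact: is_Ck_partial.
Qed.

Lemma vfieldD k j f g : is_Ck k.+1 f -> is_Ck k.+1 g ->
  vfield V j (fun y => f y + g y) = fun y => vfield V j f y + vfield V j g y.
Proof.
move=> Hf Hg; apply/funext => y; rewrite /vfield -big_split /=.
apply: eq_bigr => i _.
by rewrite partialD ?mulrDr//; [exact: is_Ck_derivable Hf|exact: is_Ck_derivable Hg].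
Qed.

Lemma vfieldM k j f g : is_Ck k.+1 f -> is_Ck k.+1 g ->
  vfield V j (fun y => f y * g y) =
  fun y => f y * vfield V j g y + g y * vfield V j f y.
Proof.
move=> Hf Hg; apply/funext => y; rewrite /vfield !mulr_sumr -big_split /=.
apply: eq_bigr => i _.
rewrite partialM; [|exact: is_Ck_derivable Hf|exact: is_Ck_derivable Hg]; ring.
Qed.

Lemma vfield_coord i j : vfield V j (fun y => y i 0) = fun y => V y i j.
Proof.
apply/funext => y; rewrite /vfield (bigD1 i)//= big1 ?addr0 => [|l li].
  by rewrite partial_coord eqxx mulr1.
by rewrite partial_coord (negbTE li) mulr0.
Qed.

Lemma vfieldsD w f g y : (size w <= M)%N -> is_Ck (size w) f -> is_Ck (size w) g ->
  vfields V w (fun y => f y + g y) y = vfields V w f y + vfields V w g y.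
Proof.
elim/last_ind: w f g => [//|w j IH] f g; rewrite size_rcons => wM Hf Hg.
rewrite !vfields_rcons (vfieldD j Hf Hg) IH//; first exact: ltnW.
  by apply: vfield_Ck => //; exact: ltnW.
by apply: vfield_Ck => //; exact: ltnW.
Qed.

Lemma vfields0 w y : (size w <= M)%N -> vfields V w (fun=> 0) y = 0.
Proof.
move=> wM; have C0 := @is_Ck_cst R d (size w) 0.
have := vfieldsD y wM C0 C0.
rewrite (_ : (fun _ : 'cV[R]_d => 0 + 0) = fun=> 0); last by apply/funext => ?; rewrite addr0.
by move=> /eqP; rewrite -subr_eq0 opprD addrA subrr sub0r oppr_eq0 => /eqP.
Qed.

Lemma vfields_sum w (I : Type) (r : seq I) (f : I -> 'cV[R]_d -> R) y :
  (size w <= M)%N -> (forall i, is_Ck (size w) (f i)) ->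
  vfields V w (fun y => \sum_(i <- r) f i y) y = \sum_(i <- r) vfields V w (f i) y.
Proof.
move=> wM Hf; elim: r => [|i r IH].
  rewrite big_nil -[RHS](vfields0 y wM); congr (vfields _ _ _ _).
  by apply/funext => ?; rewrite big_nil.
rewrite big_cons -IH -vfieldsD//; last by apply: is_Ck_sum.
by congr (vfields _ _ _ _); apply/funext => ?; rewrite big_cons.
Qed.

End VectorFields.

Section Homogeneous.
Context {R : realType} {d m : nat}.
Variables (a b be : R) (x : R -> 'cV[R]_m) (V : 'cV[R]_d -> 'M[R]_(d, m)).
Variables (z : 'cV[R]_d) (M : nat).
Hypotheses (ab : a <= b) (be2 : 2^-1 < be) (be1 : be <= 1) (hx : vhol a b be x).
Hypothesis VM : forall i j, is_Ck M (fun y => V y i j).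
Implicit Types (f g : 'cV[R]_d -> R) (t : R).

Let be0 : 0 < be. Proof. by move: be2; lra. Qed.

(** The part of order r of the Taylor expansion of f, started at z at time a. *)
Definition homog r f t : R :=
  \sum_(g : r.-tuple 'I_m) xint x g a t * vfields V g f z.

Lemma homog0 f t : homog 0 f t = f z.
Proof.
by rewrite /homog (big_tuple0 (fun w : seq 'I_m => xint x w a t * vfields V w f z)) mul1r.
Qed.

Lemma hol_homog r f : hol a b be (homog r f).
Proof.
apply: hol_sum => g _; apply: hol_ext (holZ (vfields V g f z) _) => [t _ _|].
  by rewrite mulrC.
exact: hol_xint.
Qed.

Lemma okf_homog r f : okf a b be (homog r f).
Proof. by apply: okf_hol => //; exact: hol_homog. Qed.

Lemma homogS r f t : a <= t -> t <= b ->
  homog r.+1 f t = \sum_j RSint (homog r (vfield V j f)) (fun u => x u j 0) a t.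
Proof.
move=> at_ tb.
rewrite /homog (big_tuple_rcons r (fun w : seq 'I_m => xint x w a t * vfields V w f z)).
rewrite exchange_big /=; apply: eq_bigr => j _.
have := @RSint_sumf _ a b _ (index_enum (r.-tuple 'I_m)) xpredT
   (fun w => vfields V w (vfield V j f) z) (fun w u => xint x w a u) (fun u => x u j 0) t.
rewrite (_ : (fun u => \sum_(w : r.-tuple 'I_m) vfields V w (vfield V j f) z * xint x w a u)
   = homog r (vfield V j f)); last first.
  by apply/funext => u; apply: eq_bigr => g _; rewrite mulrC.
move=> ->//; first by apply: eq_bigr => g _; rewrite xint_rcons vfields_rcons mulrC.
move=> g _; apply: okf_yint (hx j).
by apply: okf_hol => //; exact: hol_xint.
Qed.

Lemma homogS_start r f : homog r.+1 f a = 0.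
Proof. by rewrite homogS// big1// => j _; rewrite RSintxx. Qed.

Lemma sgerm_homog r f : sgerm a b (index_enum 'I_m)
  (fun j => homog r (vfield V j f)) (fun j u => x u j 0) (homog r.+1 f).
Proof.
apply: (@sgerm_RSint _ a b be _ _ _ _ _ 0) => //.
- by move=> j; exact: okf_homog.
- by move=> t at_ tb; rewrite add0r homogS.
Qed.

Lemma homogD r f g t : (r <= M)%N -> is_Ck r f -> is_Ck r g ->
  homog r (fun y => f y + g y) t = homog r f t + homog r g t.
Proof.
move=> rM Hf Hg; rewrite /homog -big_split /=; apply: eq_bigr => w _.
by rewrite (vfieldsD VM) ?size_tuple// mulrDr.
Qed.

Lemma homog_sum r (I : Type) (s : seq I) (f : I -> 'cV[R]_d -> R) t : (r <= M)%N ->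
  (forall i, is_Ck r (f i)) ->
  homog r (fun y => \sum_(i <- s) f i y) t = \sum_(i <- s) homog r (f i) t.
Proof.
move=> rM Hf; rewrite /homog exchange_big /=; apply: eq_bigr => w _.
by rewrite (vfields_sum VM) ?size_tuple ?mulr_sumr// => i; rewrite size_tuple.
Qed.

Lemma RSint_homog_homog k l f g t : a <= t -> t <= b ->
  RSint (homog k f) (homog l.+1 g) a t =
  \sum_j RSint (fun u => homog k f u * homog l (vfield V j g) u) (fun u => x u j 0) a t.
Proof.
move=> at_ tb; apply: (RSint_assoc ab (okf_homog k f) (hol_homog _ _) _ hx
  (sgerm_homog l g) at_ tb).
by move=> j; apply: okf_hol => //; apply: holM => //; exact: hol_homog.
Qed.

Lemma RSint_homog0 k f g t : a <= t -> t <= b -> RSint (homog k f) (homog 0 g) a t = 0.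
Proof.
move=> at_ tb; have y0 := okf_yint (okf_homog k f) (hol_homog 0 g).
rewrite (@RSint_germ _ a b _ _ (fun=> 0))//; first by rewrite subrr.
by apply: small_ext (small0 a b) => s u v *; rewrite !homog0 !subrr mulr0 subr0.
Qed.

(** Taking Taylor expansions is multiplicative: the Leibniz rule for the vector
    fields matches the product rule for the integrals. *)
Lemma homogM r f g t : (r <= M)%N -> is_Ck r f -> is_Ck r g -> a <= t -> t <= b ->
  homog r (fun y => f y * g y) t = \sum_(k < r.+1) homog k f t * homog (r - k) g t.
Proof.
elim: r f g t => [|r IH] f g t rM Hf Hg at_ tb.
  by rewrite big_ord1 !homog0.
have rM' : (r <= M)%N by exact: ltnW.
have P (k : 'I_r.+2) : homog k f t * homog (r.+1 - k) g t =
    RSint (homog k f) (homog (r.+1 - k) g) a t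
    + RSint (homog (r.+1 - k) g) (homog k f) a t.
  rewrite (RSint_prod ab be2 (hol_homog _ _) (hol_homog _ _) at_ tb).
  have -> : homog k f a * homog (r.+1 - k) g a = 0.
    case: k => -[|k] kr /=; first by rewrite subn0 homogS_start mulr0.
    by rewrite homogS_start mul0r.
  by rewrite add0r.
rewrite (eq_bigr _ (fun k _ => P k)) big_split /=.
rewrite big_ord_recr /= subnn RSint_homog0// addr0.
rewrite [X in _ + X]big_ord_recl /= RSint_homog0// add0r homogS//.
have F1 (k : 'I_r.+1) : RSint (homog k f) (homog (r.+1 - k) g) a t =
  \sum_j RSint (fun u => homog k f u * homog (r - k) (vfield V j g) u)
     (fun u => x u j 0) a t.
  have kr : (k <= r)%N by rewrite -ltnS.
  by rewrite (subSn kr) RSint_homog_homog.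
have F2 (k : 'I_r.+1) : RSint (homog (r.+1 - bump 0 k) g) (homog (bump 0 k) f) a t =
  \sum_j RSint (fun u => homog (r - k) g u * homog k (vfield V j f) u)
     (fun u => x u j 0) a t.
  have -> : bump 0 k = k.+1 by [].
  by rewrite subSS RSint_homog_homog.
rewrite (eq_bigr _ (fun k _ => F1 k)) (eq_bigr _ (fun k _ => F2 k)).
rewrite [X in _ = X + _]exchange_big [X in _ = _ + X]exchange_big /= -big_split /=.
apply: eq_bigr => j _.
have hh k l f' g' : okf a b be (fun u => homog k f' u * homog l g' u).
  by apply: okf_hol => //; apply: holM => //; exact: hol_homog.
pose ff (i : bool) u := if i
  then \sum_(k < r.+1) homog k f u * homog (r - k) (vfield V j g) u
  else \sum_(k < r.+1) homog (r - k) g u * homog k (vfield V j f) u.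
have kff i : okf a b be (ff i).
  apply: okf_hol => //; case: i; apply: hol_sum => k _;
    by apply: holM => //; exact: hol_homog.
transitivity (RSint (fun u => \sum_(i <- [:: true; false]) ff i u) (fun u => x u j 0) a t);
  last first.
  rewrite (RSint_sum _ kff (hx j))// big_cons big_seq1.
  by congr (_ + _); rewrite (@RSint_sum _ a b be)// => k; exact: hh.
apply: (RSint_congr _ _ (hx j)) => //.
  move=> u au ub; rewrite big_cons big_seq1 /ff (vfieldM V j Hf Hg).
  have Cf := vfield_Ck VM j rM' Hf; have Cg := vfield_Ck VM j rM' Hg.
  have Hf' : is_Ck r f by exact: is_Ck_le Hf.
  have Hg' : is_Ck r g by exact: is_Ck_le Hg.
  rewrite homogD//; [|exact: is_CkM|exact: is_CkM].
  rewrite IH// IH//; congr (_ + _).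
  rewrite (reindex_inj rev_ord_inj) /=; apply: eq_bigr => k _.
  by rewrite subSS subKn// -ltnS.
apply: okf_hol => //; apply: hol_sum => -[] _; apply: hol_sum => k _;
  by apply: holM => //; exact: hol_homog.
Qed.

(** Write V_j f = \sum_i V_ij partial_i f and expand the products by [homogM]: the
    parts of V_ij, integrated against dx^j, are those of the i-th coordinate. *)
Lemma homog_chain r f t : (r <= M)%N -> is_Ck r.+1 f -> a <= t -> t <= b ->
  homog r.+1 f t = \sum_i \sum_(k < r.+1)
    RSint (homog k (partial i f)) (homog (r.+1 - k) (fun y => y i 0)) a t.
Proof.
move=> rM Hf at_ tb; rewrite homogS//.
have Cp i : is_Ck r (partial i f) by exact: is_Ck_partial.
have CV i j : is_Ck r (fun y => V y i j) by exact: is_Ck_le rM _.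
have hh k l f' g' : okf a b be (fun u => homog k f' u * homog l g' u).
  by apply: okf_hol => //; apply: holM => //; exact: hol_homog.
have hs i j : okf a b be (fun u => \sum_(k < r.+1) homog k (partial i f) u *
    homog (r - k) (fun y => V y i j) u).
  by apply: okf_hol => //; apply: hol_sum => k _; apply: holM => //; exact: hol_homog.
transitivity (\sum_j \sum_i \sum_(k < r.+1)
    RSint (fun u => homog k (partial i f) u * homog (r - k) (fun y => V y i j) u)
      (fun u => x u j 0) a t).
  apply: eq_bigr => j _.
  rewrite (RSint_congr (f' := fun u => \sum_i \sum_(k < r.+1) homog k (partial i f) u *
    homog (r - k) (fun y => V y i j) u) _ _ (hx j))//.
  - rewrite (RSint_sum _ (hs^~ j) (hx j))//; apply: eq_bigr => i _.
    by rewrite (RSint_sum _ _ (hx j)).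
  - move=> u au ub; rewrite (homog_sum _ _ rM); last by move=> i; exact: is_CkM.
    apply: eq_bigr => i _.
    rewrite -(homogM rM (Cp i) (CV i j) au ub).
    by congr (homog _ _ _); apply/funext => y; rewrite mulrC.
  - apply: okf_hol => //; apply: hol_sum => i _; apply: hol_sum => k _.
    by apply: holM => //; exact: hol_homog.
rewrite exchange_big /=; apply: eq_bigr => i _.
rewrite exchange_big /=; apply: eq_bigr => k _.
have kr : (k <= r)%N by rewrite -ltnS.
rewrite (subSn kr) RSint_homog_homog//.
by apply: eq_bigr => j _; rewrite vfield_coord.
Qed.

(** [comp_int zeta r] sums, over all (n_1, ..., n_p) with n_i >= 1 and total r, the
    iterated integrals of the parts of order n_i of the coordinates zeta_i; zeta is
    read backwards, so that its head is the outermost integrator. *)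
Fixpoint comp_int (zeta : seq 'I_d) (r : nat) (t : R) : R :=
  match zeta with
  | [::] => (r == 0%N)%:R
  | i :: zeta' => \sum_(k < r)
      RSint (comp_int zeta' k) (homog (r - k) (fun y => y i 0)) a t
  end.

Lemma hol_comp_int zeta r : hol a b be (comp_int zeta r).
Proof.
elim: zeta r => [|i zeta IH] r; first exact: hol_cst.
apply: hol_sum => k _; apply: hol_RSint => //; last exact: hol_homog.
exact: okf_hol.
Qed.

Lemma okf_comp_int zeta r : okf a b be (comp_int zeta r).
Proof. by apply: okf_hol => //; exact: hol_comp_int. Qed.

Lemma comp_int_eq0 zeta r t : (r < size zeta)%N -> a <= t -> t <= b ->
  comp_int zeta r t = 0.
Proof.
elim: zeta r t => [//|i zeta IH] r t; rewrite [size _]/= ltnS => rz at_ tb.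
rewrite /= big1// => k _.
have k0 : okf a b be (fun=> 0) by apply: okf_hol => //; exact: hol_cst.
rewrite (RSint_congr (f' := fun=> 0) _ k0 (hol_homog _ _))//.
  by rewrite RSint0.
by move=> u au ub; apply: IH => //; exact: leq_trans (ltn_ord k) rz.
Qed.

(** Iterating [homog_chain] until only values of derivatives of f at z are left. *)
Lemma homog_comp r q f t : (r <= M)%N -> (r < q)%N -> is_Ck r f -> a <= t -> t <= b ->
  homog r f t = \sum_(p < q) \sum_(zeta : p.-tuple 'I_d)
    partials zeta f z * comp_int (rev zeta) r t.
Proof.
elim/ltn_ind: r q f t => -[_|r IH] q f t rM rq Hf at_ tb.
  case: q rq => // q _; rewrite big_ord_recl /=.
  rewrite (big_tuple0 (fun zeta => partials zeta f z * comp_int (rev zeta) 0 t)) /=.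
  rewrite mulr1 homog0 big1 ?addr0// => p _; apply: big1 => zeta _.
  by rewrite comp_int_eq0 ?mulr0// size_rev size_tuple.
case: q rq => // q rq; rewrite big_ord_recl /=.
rewrite (big_tuple0 (fun zeta => partials zeta f z * comp_int (rev zeta) r.+1 t)) /=.
rewrite mulr0 add0r.
have Cp i : is_Ck r (partial i f) by exact: is_Ck_partial.
have S (p : 'I_q) : \sum_(zeta : (bump 0 p).-tuple 'I_d)
    partials zeta f z * comp_int (rev zeta) r.+1 t =
  \sum_i \sum_(zeta : p.-tuple 'I_d) \sum_(k < r.+1) partials zeta (partial i f) z *
     RSint (comp_int (rev zeta) k) (homog (r.+1 - k) (fun y => y i 0)) a t.
  rewrite /bump /= -[(1 + p)%N]/p.+1.
  rewrite (big_tuple_rcons p (fun zeta => partials zeta f z * comp_int (rev zeta) r.+1 t)).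
  rewrite exchange_big /=; apply: eq_bigr => i _; apply: eq_bigr => zeta _.
  by rewrite /partials foldr_rcons rev_rcons /= mulr_sumr.
rewrite (eq_bigr _ (fun p _ => S p)) exchange_big /= (homog_chain (ltnW rM) Hf at_ tb).
apply: eq_bigr => i _.
rewrite (eq_bigr _ (fun (p : 'I_q) _ => exchange_big _ _ _ _ _ _)) exchange_big /=.
apply: eq_bigr => k _.
have hI := hol_homog (r.+1 - k) (fun y => y i 0).
have hz p (zeta : p.-tuple 'I_d) :
    okf a b be (fun u => partials zeta (partial i f) z * comp_int (rev zeta) k u).
  by apply: okf_hol => //; apply: holZ; exact: hol_comp_int.
have hp (p : 'I_q) : okf a b be (fun u => \sum_(zeta : p.-tuple 'I_d)
     partials zeta (partial i f) z * comp_int (rev zeta) k u).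
  by apply: okf_hol => //; apply: hol_sum => zeta _; apply: holZ; exact: hol_comp_int.
rewrite (RSint_congr (f' := fun u => \sum_(p < q) \sum_(zeta : p.-tuple 'I_d)
  partials zeta (partial i f) z * comp_int (rev zeta) k u) _ _ hI)//.
- rewrite (RSint_sum _ hp hI)//; apply: eq_bigr => p _.
  rewrite (@RSint_sumf _ a b)// => zeta _.
  by apply: okf_yint hI; exact: okf_comp_int.
- move=> u au ub; have kr : (k <= r)%N by rewrite -ltnS.
  apply: (IH k (ltn_ord k)) => //.
  + exact: leq_trans kr (ltnW rM).
  + exact: leq_ltn_trans kr rq.
  + exact: is_Ck_le kr (Cp i).
- apply: okf_hol => //; apply: hol_sum => p _; apply: hol_sum => zeta _.
  by apply: holZ; exact: hol_comp_int.
Qed.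

End Homogeneous.

(** * Truncated expansions and the terms of high order *)

Section Truncation.
Context {R : realType} {d m : nat}.
Variables (a b be : R) (x : R -> 'cV[R]_m) (V : 'cV[R]_d -> 'M[R]_(d, m)).
Variables (z : 'cV[R]_d) (N : nat).
Hypotheses (ab : a <= b) (be2 : 2^-1 < be) (be1 : be <= 1) (hx : vhol a b be x).
Implicit Types (zeta : seq 'I_d) (t : R) (P : pred nat) (g : seq (N.-bseq 'I_m)).

Let be0 : 0 < be. Proof. by move: be2; lra. Qed.

Let coef (w : seq 'I_m) (i : 'I_d) : R := vfields V w (fun y => y i 0) z.

(** The part of the iterated integral of the truncated expansions of the coordinates
    zeta that comes from words whose total length satisfies P. *)
Definition word_sum p zeta P t : R :=
  \sum_(g : p.-tuple (N.-bseq 'I_m) |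
       all (fun w : N.-bseq 'I_m => 0 < size w)%N g && P (sumn [seq size (bseqval w) | w <- g]))
    (\prod_(wi <- zip g zeta) vfields V wi.1 (fun y => y wi.2 0) z) *
    word_int a x [seq bseqval w | w <- g] t.

Lemma hol_word_sum p zeta P : hol a b be (word_sum p zeta P).
Proof. by apply: hol_sum => g _; apply: holZ; exact: hol_word_int. Qed.

Lemma okf_word_sum p zeta P : okf a b be (word_sum p zeta P).
Proof. by apply: okf_hol => //; exact: hol_word_sum. Qed.

Lemma word_sum_rcons p zeta i P t : size zeta = p -> a <= t -> t <= b ->
  word_sum p.+1 (rcons zeta i) P t =
  \sum_(w : N.-bseq 'I_m | (0 < size w)%N) coef w i *
    RSint (word_sum p zeta (fun k => P (k + size w)%N)) (fun u => xint x w a u) a t.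
Proof.
move=> zp at_ tb; rewrite /word_sum big_mkcond /=.
rewrite (big_tuple_rcons p (fun g => if
   all (fun w : N.-bseq 'I_m => 0 < size w)%N g && P (sumn [seq size (bseqval w) | w <- g])
   then (\prod_(wi <- zip g (rcons zeta i)) vfields V wi.1 (fun y => y wi.2 0) z) *
    word_int a x [seq bseqval w | w <- g] t else 0)).
rewrite exchange_big [RHS]big_mkcond /=; apply: eq_bigr => w _.
case: ifP => w0; last by apply: big1 => g _; rewrite all_rcons w0.
have -> : RSint (fun u => \sum_(g : p.-tuple (N.-bseq 'I_m) |
      all (fun w : N.-bseq 'I_m => 0 < size w)%N g &&
       P (sumn [seq size (bseqval w) | w <- g] + size w)%N)
    (\prod_(wi <- zip g zeta) vfields V wi.1 (fun y => y wi.2 0) z) *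
    word_int a x [seq bseqval w | w <- g] u) (fun u => xint x w a u) a t
  = \sum_(g : p.-tuple (N.-bseq 'I_m) |
      all (fun w : N.-bseq 'I_m => 0 < size w)%N g &&
       P (sumn [seq size (bseqval w) | w <- g] + size w)%N)
     (\prod_(wi <- zip g zeta) vfields V wi.1 (fun y => y wi.2 0) z) *
     RSint (word_int a x [seq bseqval w | w <- g]) (fun u => xint x w a u) a t.
  apply: (@RSint_sumf _ a b) => // g _.
  apply: okf_yint (hol_xint ab be2 be1 hx w).
  by apply: okf_hol => //; exact: hol_word_int.
rewrite mulr_sumr [RHS]big_mkcond /=; apply: eq_bigr => g _.
rewrite all_rcons w0 map_rcons sumn_rcons; case: ifP => // _.
rewrite zip_rcons ?size_tuple// -cats1 big_cat big_seq1 /= map_rcons word_int_rcons.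
by rewrite -mulrA mulrCA.
Qed.

Lemma Taylor_coord t i : Taylor x V N a t z i 0 =
  \sum_(w : N.-bseq 'I_m | (0 < size w)%N) coef w i * xint x w a t.
Proof.
rewrite big_mkcond (big_bseq N (fun w => if (0 < size w)%N then coef w i * xint x w a t else 0)).
rewrite big_ord_recl /= big1 ?add0r; last by move=> g _; rewrite size_tuple.
rewrite /Taylor big_add1 /= summxE big_mkord; apply: eq_bigr => r _.
rewrite summxE; apply: eq_bigr => g _.
by rewrite !mxE size_tuple /bump /= mulrC.
Qed.

Lemma Taylor_homog t i : Taylor x V N a t z i 0 =
  \sum_(1 <= r < N.+1) homog a x V z r (fun y => y i 0) t.
Proof.
rewrite /Taylor summxE; apply: eq_bigr => r _.
by rewrite summxE; apply: eq_bigr => g _; rewrite !mxE.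
Qed.

Lemma hol_Taylor i : hol a b be (fun t => Taylor x V N a t z i 0).
Proof.
apply: hol_ext (_ : hol a b be (fun t => \sum_(w : N.-bseq 'I_m | (0 < size w)%N)
    coef w i * xint x w a t)); first by move=> t *; rewrite Taylor_coord.
by apply: hol_sum => w _; apply: holZ; exact: hol_xint.
Qed.

Lemma Eint1_rcons (E : R -> R -> 'cV[R]_d -> 'cV[R]_d) zeta i s t y :
  Eint1 E (rcons zeta i) s t y =
  RSint (fun u => Eint1 E zeta s u y) (fun u => E s u y i 0) s t.
Proof. by rewrite /Eint1 /Eint map_rcons iterated_int_rcons. Qed.

Lemma word_sum_Eint1 p zeta t : size zeta = p -> a <= t -> t <= b ->
  word_sum p zeta xpredT t = Eint1 (Taylor x V N) zeta a t z.
Proof.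
elim/last_ind: zeta p t => [|zeta i IH] p t.
  move=> /= <- _ _; rewrite /word_sum (big_pred1 [tuple]) /=.
    by rewrite big_nil mul1r.
  by move=> g; rewrite (tuple0 g) /=; apply/esym/eqP.
rewrite size_rcons => <- at_ tb; rewrite word_sum_rcons// Eint1_rcons.
have kw : okf a b be (word_sum (size zeta) zeta xpredT) by exact: okf_word_sum.
transitivity (RSint (word_sum (size zeta) zeta xpredT)
    (fun u => Taylor x V N a u z i 0) a t); last first.
  apply: (@RSint_ext _ a b 0) => //.
  - by move=> u *; rewrite IH.
  - by move=> u *; rewrite add0r.
  - apply: yint_ext (okf_yint kw (hol_Taylor i)) => // u au ub.
    by rewrite IH.
transitivity (RSint (word_sum (size zeta) zeta xpredT)
    (fun u => \sum_(w : N.-bseq 'I_m | (0 < size w)%N) coef w i * xint x w a u) a t).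
  rewrite (@RSint_sumg _ a b)// => w _.
  by apply: okf_yint kw _; exact: hol_xint.
by congr (RSint _ _ _ _); apply/funext => u; rewrite Taylor_coord.
Qed.

Lemma comp_intE zeta r t : (r <= N)%N -> a <= t -> t <= b ->
  word_sum (size zeta) zeta (fun k => k == r) t = comp_int a x V z (rev zeta) r t.
Proof.
elim/last_ind: zeta r t => [|zeta i IH] r t rN at_ tb.
  rewrite /word_sum big_mkcond (big_pred1 [tuple]) /=; last first.
    by move=> g; rewrite (tuple0 g) /=; apply/esym/eqP.
  by rewrite big_nil mul1r eq_sym; case: (r == 0)%N.
rewrite size_rcons word_sum_rcons// rev_rcons /=.
pose G n := if (0 < n <= r)%N then
  RSint (comp_int a x V z (rev zeta) (r - n)) (homog a x V z n (fun y => y i 0)) a t else 0.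
transitivity (\sum_(n < N.+1) G n).
  rewrite big_mkcond (big_bseq N (fun w => if (0 < size w)%N then coef w i *
    RSint (word_sum (size zeta) zeta (fun k => k + size w == r)%N)
      (fun u => xint x w a u) a t else 0)).
  apply: eq_bigr => n _; rewrite /G.
  have [n0|n0] := posnP n.
    have {}n0 : (0 < n)%N = false by rewrite n0.
    by apply: big1 => g _; rewrite size_tuple n0.
  rewrite /=; case: leqP => [nr|rn]; last first.
    apply: big1 => g _; rewrite size_tuple n0 (_ : word_sum _ _ _ = fun=> 0).
      by rewrite RSint0// mulr0.
    apply/funext => u; rewrite /word_sum big_pred0// => g'.
    by apply/negP => /andP[_ /eqP E]; move: rn; rewrite -E ltnNge leq_addl.
  transitivity (RSint (comp_int a x V z (rev zeta) (r - n))
    (fun u => \sum_(g : n.-tuple 'I_m) coef g i * xint x g a u) a t); last first.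
    by congr (RSint _ _ _ _); apply/funext => u; apply: eq_bigr => g _; rewrite mulrC.
  rewrite (@RSint_sumg _ a b)//; last first.
    move=> g _; apply: okf_yint (hol_xint ab be2 be1 hx g).
    exact: okf_comp_int.
  apply: eq_bigr => g _; rewrite size_tuple n0; congr (_ * _).
  apply: (RSint_congr _ _ (hol_xint ab be2 be1 hx g)) => //; last exact: okf_comp_int.
  move=> u au ub; rewrite -IH//; last exact: leq_trans (leq_subr _ _) rN.
  apply: eq_bigl => g'; congr (_ && _).
  by rewrite -(eqn_add2r n (sumn _)) subnK.
rewrite -(big_mkord xpredT G) (@big_cat_nat _ _ _ r.+1)//=.
rewrite [X in _ + X]big_nat [X in _ + X]big1 ?addr0; last first.
  by move=> n /andP[rn _]; rewrite /G [(n <= r)%N]leqNgt rn andbF.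
rewrite big_nat_recl//= {1}/G /= add0r big_mkord (reindex_inj rev_ord_inj) /=.
apply: eq_bigr => k _; rewrite subnSK// /G subn_gt0 ltn_ord leq_subr.
by rewrite subKn// ltnW.
Qed.

Lemma word_sum_split p zeta P t : word_sum p zeta xpredT t =
  word_sum p zeta P t + word_sum p zeta (predC P) t.
Proof.
rewrite /word_sum (bigID (fun g : p.-tuple (N.-bseq 'I_m) =>
   P (sumn [seq size (bseqval w) | w <- g]))) /=.
by congr (_ + _); apply: eq_bigl => g; rewrite andbT.
Qed.

Lemma word_sum_lt p zeta r t : word_sum p zeta (fun k => (k < r)%N) t =
  \sum_(k < r) word_sum p zeta (fun l => l == k) t.
Proof.
elim: r => [|r IH].
  by rewrite big_ord0 /word_sum big_pred0// => g; rewrite ltn0 andbF.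
rewrite big_ord_recr /= -IH /word_sum (bigID (fun g : p.-tuple (N.-bseq 'I_m) =>
   (sumn [seq size (bseqval w) | w <- g] < r)%N)) /=.
congr (_ + _); apply: eq_bigl => g; set k := sumn _; case: (all _ _) => //=; lia.
Qed.

Lemma Hblock_vfields (w : seq 'I_m) (i : 'I_d) : (0 < size w)%N ->
  Hblock V w i = vfields V w (fun y => y i 0).
Proof.
case: w => // j w _; rewrite /Hblock [j :: w in RHS]lastI vfields_rcons.
by rewrite vfield_coord.
Qed.

Lemma H_zip p (zeta : p.-tuple 'I_d) (g : p.-tuple (N.-bseq 'I_m)) :
  all (fun w : N.-bseq 'I_m => 0 < size w)%N g ->
  H V (flatten [seq bseqval w | w <- g]) zeta
    (scanl addn 0%N [seq size (bseqval w) | w <- g]) z =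
  \prod_(wi <- zip g zeta) vfields V wi.1 (fun y => y wi.2 0) z.
Proof.
move=> g0; set gs := [seq bseqval w | w <- g]; set sh := [seq _ | w <- g].
have shE : sh = shape gs by rewrite /shape /gs -map_comp.
have sp : size sh = p by rewrite size_map size_tuple.
rewrite (big_tuple _ _ (zip_tuple g zeta)) /H; apply: eq_bigr => i _.
have ip : (i < size sh)%N by rewrite sp.
rewrite (nth_tau0 ip) (nth_tau ip) (sumn_takeS ip) addnC -take_drop.
rewrite shE -nth_reshape flattenK /gs.
rewrite (tnth_nth (tnth g i, tnth zeta i)) /= nth_zip ?size_tuple//=.
rewrite (nth_map (tnth g i)) ?size_tuple//.
rewrite -!tnth_nth.
by rewrite Hblock_vfields//; apply: (allP g0); exact: mem_tnth.
Qed.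

Lemma Q_word_sum p (zeta : p.-tuple 'I_d) M t : a <= t -> t <= b ->
  Q x V N M zeta a t z = word_sum p zeta (fun k => (M < k)%N) t.
Proof.
move=> at_ tb; rewrite /Q /word_sum.
rewrite (eq_bigl (fun g : p.-tuple (N.-bseq 'I_m) =>
   all (fun w : N.-bseq 'I_m => 0 < size w)%N g &&
    (M < sumn [seq size (bseqval w) | w <- g])%N)); last first.
  by move=> g; rewrite sumnE big_map.
apply: eq_bigr => g /andP[g0 _].
rewrite -mulr_sumr H_zip//; congr (_ * _).
have -> : [seq size (bseqval w) | w <- g] = map size [seq bseqval w | w <- g].
  by rewrite -map_comp.
rewrite (sum_Xi_word_int ab be2 be1 hx)//.
by rewrite all_map.
Qed.

(** What Q leaves of the truncated expansions is their part of total order < N. *)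
Lemma Eint1_sub_Q p (zeta : p.-tuple 'I_d) t : (0 < N)%N -> a <= t -> t <= b ->
  Eint1 (Taylor x V N) zeta a t z - Q x V N N.-1 zeta a t z =
  \sum_(r < N) comp_int a x V z (rev zeta) r t.
Proof.
move=> N0 at_ tb; rewrite -(@word_sum_Eint1 p)// ?size_tuple// Q_word_sum//.
rewrite (word_sum_split _ _ (fun k => (k < N)%N)).
rewrite (_ : word_sum p zeta (predC _) t = word_sum p zeta (fun k => (N.-1 < k)%N) t).
  rewrite addrK word_sum_lt; apply: eq_bigr => r _.
  by rewrite -comp_intE ?size_tuple// ltnW.
by apply: eq_bigl => g; congr (_ && _); rewrite /= -leqNgt prednK.
Qed.

End Truncation.

(** * The error equation of one step *)

Section OneStep.
Context {R : realType} {d m : nat}.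
Variables (a b be : R) (x : R -> 'cV[R]_m) (V : 'cV[R]_d -> 'M[R]_(d, m)).
Variables (z : 'cV[R]_d) (N : nat) (Gt : {fset seq 'I_m}).
Hypotheses (ab : a <= b) (be2 : 2^-1 < be) (be1 : be <= 1) (hx : vhol a b be x).
Hypotheses (N0 : (0 < N)%N) (VN : forall i j, is_Ck N.+1 (fun y => V y i j)).
Hypothesis Vtop : forall (zeta : N.+1.-tuple 'I_d) i j,
  young_reg be (partials zeta (fun y => V y i j)).
Hypothesis Gt_words : forall g : seq 'I_m, g \in Gt -> (0 < size g)%N.
Implicit Types (zeta : seq 'I_d) (t u : R) (F : 'cV[R]_d -> R).

Let be0 : 0 < be. Proof. by move: be2; lra. Qed.

Lemma Eint_rcons (E : R -> R -> 'cV[R]_d -> 'cV[R]_d) zeta i f s t y :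
  Eint E (rcons zeta i) f s t y =
  RSint (fun u => Eint E zeta f s u y) (fun u => E s u y i 0) s t.
Proof. by rewrite /Eint map_rcons iterated_int_rcons. Qed.

Section Expansion.
Variable E : R -> R -> 'cV[R]_d -> 'cV[R]_d.
Hypothesis hE : vhol a b be (fun u => E a u z).

Lemma okf_Eint zeta f : okf a b be f -> okf a b be (fun u => Eint E zeta f a u z).
Proof.
move=> kf; elim/last_ind: zeta => [|zeta i IH]; first exact: kf.
apply: (@okf_ext _ _ _ _ (fun t => RSint (fun u => Eint E zeta f a u z)
    (fun u => E a u z i 0) a t)); first by move=> t *; rewrite Eint_rcons.
by apply: okf_hol => //; apply: hol_RSint.
Qed.

Lemma hol_Eint zeta f : (0 < size zeta)%N -> okf a b be f ->
  hol a b be (fun u => Eint E zeta f a u z).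
Proof.
case/lastP: zeta => // zeta i _ kf.
apply: (@hol_ext _ _ _ _ (fun t => RSint (fun u => Eint E zeta f a u z)
    (fun u => E a u z i 0) a t)); first by move=> t *; rewrite Eint_rcons.
by apply: hol_RSint => //; exact: okf_Eint.
Qed.

Lemma hol_Eint1 zeta : hol a b be (fun u => Eint1 E zeta a u z).
Proof.
case: zeta => [|i zeta]; first exact: hol_cst.
by apply: hol_Eint => //; apply: okf_hol => //; exact: hol_cst.
Qed.

Hypothesis Ea : E a a z = 0.

Let Z u := z + E a u z.

Lemma vhol_shift : vhol a b be Z.
Proof.
move=> i; apply: (@hol_ext _ _ _ _ (fun u => z i 0 + E a u z i 0)).
  by move=> t *; rewrite !mxE.
by apply: holD (hE i); exact: hol_cst.
Qed.

(** Taylor's formula along Z, by iterating the chain rule on the innermost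
    integrand. *)
Lemma Taylor_formula k F t : is_Ck k F ->
  (forall zeta : k.-tuple 'I_d, young_reg be (partials zeta F)) ->
  a <= t -> t <= b ->
  F (Z t) = \sum_(p < k) \sum_(zeta : p.-tuple 'I_d) partials zeta F z * Eint1 E zeta a t z
    + \sum_(zeta : k.-tuple 'I_d) Eint E zeta (fun u => partials zeta F (Z u)) a t z.
Proof.
elim: k F t => [|k IH] F t Fk Ftop at_ tb.
  rewrite big_ord0 add0r.
  by rewrite (big_tuple0 (fun zeta => Eint E zeta (fun u => partials zeta F (Z u)) a t z)).
have Ftop' i (zeta : k.-tuple 'I_d) : young_reg be (partials zeta (partial i F)).
  by have := Ftop [tuple of rcons zeta i]; rewrite /partials foldr_rcons.
have Fi i : is_Ck k (partial i F) by exact: is_Ck_partial.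
have Freg i : young_reg be (partial i F).
  case: k {IH Fk} Fi Ftop' Ftop => [|k] Fi Ftop' _; first exact: (Ftop' i [tuple]).
  by apply: is_Ck_young => //; exact: is_Ck_le (Fi i).
have kF i : okf a b be (fun u => partial i F (Z u)).
  exact: okf_comp ab be0 be1 (Freg i) vhol_shift.
have ktop i (zeta : k.-tuple 'I_d) :
    okf a b be (fun u => partials zeta (partial i F) (Z u)).
  exact: okf_comp ab be0 be1 (Ftop' i zeta) vhol_shift.
have k1 i p (zeta : p.-tuple 'I_d) : okf a b be (fun u =>
    partials zeta (partial i F) z * Eint1 E zeta a u z).
  by apply: okf_hol => //; apply: holZ; exact: hol_Eint1.
have k2 i (zeta : k.-tuple 'I_d) : okf a b be (fun u =>
    Eint E zeta (fun u => partials zeta (partial i F) (Z u)) a u z).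
  exact: okf_Eint.
have chain := sgerm_chain be0 be1 (fun i y => @is_Ck_derivable _ _ k F i y Fk) Freg vhol_shift.
rewrite (sgermP ab kF vhol_shift chain)//.
rewrite big_ord_recl /=.
rewrite (big_tuple0 (fun zeta => partials zeta F z * Eint1 E zeta a t z)) /=.
rewrite /Eint1 /= {1}/Eint /= mulr1 /Z Ea addr0 -/Z -addrA; congr (_ + _).
have S1 (p : 'I_k) : \sum_(zeta : (bump 0 p).-tuple 'I_d)
    partials zeta F z * Eint1 E zeta a t z =
  \sum_i \sum_(zeta : p.-tuple 'I_d) partials zeta (partial i F) z *
     RSint (fun u => Eint1 E zeta a u z) (fun u => E a u z i 0) a t.
  have -> : bump 0 p = p.+1 by [].
  rewrite (big_tuple_rcons p (fun zeta => partials zeta F z * Eint1 E zeta a t z)).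
  rewrite exchange_big /=; apply: eq_bigr => i _; apply: eq_bigr => zeta _.
  by rewrite /partials foldr_rcons Eint1_rcons.
rewrite (eq_bigr _ (fun p _ => S1 p)).
rewrite (big_tuple_rcons k (fun zeta => Eint E zeta (fun u => partials zeta F (Z u)) a t z)).
rewrite [X in _ = X + _]exchange_big [X in _ = _ + X]exchange_big /= -big_split /=.
apply: eq_bigr => i _.
transitivity (RSint (fun u => partial i F (Z u)) (fun u => E a u z i 0) a t).
  apply: (@RSint_ext _ a b (z i 0)) => //; last exact: okf_yint (kF i) (hE i).
  by move=> u *; rewrite !mxE.
have kk1 : okf a b be (fun u => \sum_(p < k) \sum_(zeta : p.-tuple 'I_d)
    partials zeta (partial i F) z * Eint1 E zeta a u z).
  by apply: okf_sum => // p; apply: okf_sum.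
have kk2 : okf a b be (fun u => \sum_(zeta : k.-tuple 'I_d)
    Eint E zeta (fun u => partials zeta (partial i F) (Z u)) a u z).
  exact: okf_sum.
rewrite (RSint_congr (fun u au ub => IH _ u (Fi i) (Ftop' i) au ub) (okfD ab kk1 kk2) (hE i))//.
rewrite (RSint_add kk1 kk2 (hE i))//; congr (_ + _).
  rewrite (@RSint_sum _ a b be)//; last by move=> p; exact: okf_sum.
  apply: eq_bigr => p _; rewrite (@RSint_sumf _ a b)// => zeta _.
  by apply: okf_yint (hE i); apply: okf_hol => //; exact: hol_Eint1.
rewrite (@RSint_sum _ a b be)//; apply: eq_bigr => zeta _.
by rewrite /partials foldr_rcons Eint_rcons.
Qed.

End Expansion.

Lemma RSint_mulmx_coord (F : R -> 'M[R]_(d, m)) s t i :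
  RSint_mulmx F x s t i 0 = \sum_j RSint (fun u => F u i j) (fun u => x u j 0) s t.
Proof. by rewrite mxE. Qed.

Lemma hol_TaylorOn : vhol a b be (fun t => TaylorOn x V Gt a t z).
Proof.
move=> i; apply: (@hol_ext _ _ _ _ (fun t => \sum_(g <- Gt) vfieldsI V g z i 0 * xint x g a t)).
  by move=> t *; rewrite /TaylorOn summxE; apply: eq_bigr => g _; rewrite !mxE mulrC.
by apply: hol_sum => g _; apply: holZ; exact: hol_xint.
Qed.

Lemma TaylorOn_start s : TaylorOn x V Gt s s z = 0.
Proof.
rewrite /TaylorOn big_seq big1// => g gG.
by rewrite xintxx ?scale0r//; exact: Gt_words.
Qed.

Lemma Taylor_start s : Taylor x V N s s z = 0.
Proof.
rewrite /Taylor big_nat big1// => r /andP[r0 _]; apply: big1 => g _.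
by rewrite xintxx ?scale0r// size_tuple.
Qed.

Local Notation dV zeta i j := (partials zeta (fun y => V y i j)).
Local Notation Z u := (z + TaylorOn x V Gt a u z).

(** The integrands of R1, R2, R3. *)
Let A1 i j u : R :=
  \sum_(zeta : N.-tuple 'I_d) Eint1 (Taylor x V N) zeta a u z * dV zeta i j z
  + \sum_(1 <= p < N) \sum_(zeta : p.-tuple 'I_d) Q x V N N.-1 zeta a u z * dV zeta i j z.

Let A2 i j u : R := \sum_(zeta : N.+1.-tuple 'I_d)
  Eint (TaylorOn x V Gt) zeta (fun v => dV zeta i j (Z v)) a u z.

Let A3 i j u : R := \sum_(1 <= p < N.+1) \sum_(zeta : p.-tuple 'I_d)
  (Eint1 (TaylorOn x V Gt) zeta a u z - Eint1 (Taylor x V N) zeta a u z) * dV zeta i j z.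

Let kE zeta c : okf a b be (fun u => Eint1 (Taylor x V N) zeta a u z * c).
Proof.
apply: okf_hol => //.
apply: hol_ext (holZ c (hol_Eint1 (hol_Taylor V z N ab be2 be1 hx) zeta)) => t *.
by rewrite mulrC.
Qed.

Let hol_Q p (zeta : p.-tuple 'I_d) : hol a b be (fun u => Q x V N N.-1 zeta a u z).
Proof.
apply: hol_ext (hol_word_sum V z N ab be2 be1 hx p zeta (fun k => (N.-1 < k)%N)) => t *.
by rewrite (Q_word_sum V z N ab be2 be1 hx).
Qed.

Let kQ p (zeta : p.-tuple 'I_d) c : okf a b be (fun u => Q x V N N.-1 zeta a u z * c).
Proof.
by apply: okf_hol => //; apply: hol_ext (holZ c (hol_Q zeta)) => t *; rewrite mulrC.
Qed.

Let k3 zeta c : okf a b be (fun u =>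
  (Eint1 (TaylorOn x V Gt) zeta a u z - Eint1 (Taylor x V N) zeta a u z) * c).
Proof.
apply: okf_hol => //.
apply: hol_ext (holZ c (holD (hol_Eint1 hol_TaylorOn zeta)
  (holZ (-1) (hol_Eint1 (hol_Taylor V z N ab be2 be1 hx) zeta)))) => t *.
by rewrite mulrC mulN1r.
Qed.

Let kV (zeta : N.+1.-tuple 'I_d) i j : okf a b be (fun v => dV zeta i j (Z v)).
Proof.
exact: okf_comp ab be0 be1 (Vtop zeta i j) (vhol_shift hol_TaylorOn).
Qed.

Let k2 (zeta : N.+1.-tuple 'I_d) i j : okf a b be (fun u =>
  Eint (TaylorOn x V Gt) zeta (fun v => dV zeta i j (Z v)) a u z).
Proof. exact: okf_Eint hol_TaylorOn zeta _ (kV zeta i j). Qed.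

Let kA1a i j : okf a b be (fun u =>
  \sum_(zeta : N.-tuple 'I_d) Eint1 (Taylor x V N) zeta a u z * dV zeta i j z).
Proof. by apply: okf_sum => // zeta. Qed.

Let kA1b i j : okf a b be (fun u =>
  \sum_(1 <= p < N) \sum_(zeta : p.-tuple 'I_d) Q x V N N.-1 zeta a u z * dV zeta i j z).
Proof. by apply: okf_sum => // p; apply: okf_sum => // zeta. Qed.

Let kA1 i j : okf a b be (A1 i j). Proof. exact: okfD. Qed.

Let kA2 i j : okf a b be (A2 i j). Proof. exact: okf_sum. Qed.

Let kA3 i j : okf a b be (A3 i j).
Proof. by apply: okf_sum => // p; apply: okf_sum => // zeta. Qed.

Let R1_coord t i : a <= t -> t <= b ->
  R1 x V N a t z i 0 = \sum_j RSint (A1 i j) (fun u => x u j 0) a t.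
Proof.
move=> at_ tb; rewrite /R1 mxE.
under [RHS]eq_bigr => j _ do rewrite (RSint_add (kA1a i j) (kA1b i j) (hx j) at_ tb).
rewrite big_split /=; congr (_ + _).
  under [RHS]eq_bigr => j _ do
    rewrite (@RSint_sum _ a b be _ _ _ _ _ (fun zeta : N.-tuple 'I_d => kE zeta (dV zeta i j z)) (hx j))//.
  rewrite exchange_big /= summxE; apply: eq_bigr => zeta _.
  rewrite RSint_mulmx_coord; apply: eq_bigr => j _.
  by congr (RSint _ _ _ _); apply/funext => u; rewrite !mxE.
under [RHS]eq_bigr => j _ do
  rewrite (@RSint_sum _ a b be _ _ _ _ _
    (fun p => okf_sum _ ab be2 (fun zeta : p.-tuple 'I_d => kQ zeta (dV zeta i j z))) (hx j))//.
rewrite exchange_big /= summxE; apply: eq_bigr => p _.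
under [RHS]eq_bigr => j _ do
  rewrite (@RSint_sum _ a b be _ _ _ _ _ (fun zeta : p.-tuple 'I_d => kQ zeta (dV zeta i j z)) (hx j))//.
rewrite exchange_big /= summxE; apply: eq_bigr => zeta _.
rewrite RSint_mulmx_coord; apply: eq_bigr => j _.
by congr (RSint _ _ _ _); apply/funext => u; rewrite !mxE.
Qed.

Let R2_coord t i : a <= t -> t <= b ->
  R2 x V N Gt a t z i 0 = \sum_j RSint (A2 i j) (fun u => x u j 0) a t.
Proof.
move=> at_ tb; rewrite /R2 summxE.
under [RHS]eq_bigr => j _ do
  rewrite (@RSint_sum _ a b be _ _ _ _ _ (fun zeta : N.+1.-tuple 'I_d => k2 zeta i j) (hx j))//.
rewrite [RHS]exchange_big /=; apply: eq_bigr => zeta _.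
rewrite RSint_mulmx_coord; apply: eq_bigr => j _.
congr (RSint _ _ _ _); apply/funext => u; rewrite !mxE.
by congr (Eint _ _ _ _ _ _); apply/funext => v; rewrite mxE.
Qed.

Let R3_coord t i : a <= t -> t <= b ->
  R3 x V N Gt a t z i 0 = \sum_j RSint (A3 i j) (fun u => x u j 0) a t.
Proof.
move=> at_ tb; rewrite /R3 summxE.
under [RHS]eq_bigr => j _ do
  rewrite (@RSint_sum _ a b be _ _ _ _ _
    (fun p => okf_sum _ ab be2 (fun zeta : p.-tuple 'I_d => k3 zeta (dV zeta i j z))) (hx j))//.
rewrite [RHS]exchange_big /=; apply: eq_bigr => p _.
under [RHS]eq_bigr => j _ do
  rewrite (@RSint_sum _ a b be _ _ _ _ _ (fun zeta : p.-tuple 'I_d => k3 zeta (dV zeta i j z)) (hx j))//.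
rewrite [RHS]exchange_big /= summxE; apply: eq_bigr => zeta _.
rewrite RSint_mulmx_coord; apply: eq_bigr => j _.
by congr (RSint _ _ _ _); apply/funext => u; rewrite !mxE.
Qed.

Lemma vhol_R1 : vhol a b be (fun t => R1 x V N a t z).
Proof.
move=> i; apply: (@hol_ext _ _ _ _ (fun t => \sum_j RSint (A1 i j) (fun u => x u j 0) a t)).
  by move=> t *; rewrite R1_coord.
by apply: hol_sum => j _; apply: hol_RSint.
Qed.

Lemma vhol_R2 : vhol a b be (fun t => R2 x V N Gt a t z).
Proof.
move=> i; apply: (@hol_ext _ _ _ _ (fun t => \sum_j RSint (A2 i j) (fun u => x u j 0) a t)).
  by move=> t *; rewrite R2_coord.
by apply: hol_sum => j _; apply: hol_RSint.
Qed.

Lemma vhol_R3 : vhol a b be (fun t => R3 x V N Gt a t z).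
Proof.
move=> i; apply: (@hol_ext _ _ _ _ (fun t => \sum_j RSint (A3 i j) (fun u => x u j 0) a t)).
  by move=> t *; rewrite R3_coord.
by apply: hol_sum => j _; apply: hol_RSint.
Qed.

Lemma vhol_R4 : vhol a b be (fun t => R4 x V N Gt a t z).
Proof.
move=> i; apply: (@hol_ext _ _ _ _
    (fun t => Taylor x V N a t z i 0 + -1 * TaylorOn x V Gt a t z i 0)).
  by move=> t *; rewrite !mxE mulN1r.
by apply: holD (holZ _ (hol_TaylorOn i)); exact: hol_Taylor.
Qed.

Let V_along i j u : a <= u -> u <= b -> V (Z u) i j =
  \sum_(r < N) homog a x V z r (fun y => V y i j) u + (A1 i j u + (A2 i j u + A3 i j u)).
Proof.
move=> au ub.
rewrite (Taylor_formula hol_TaylorOn (TaylorOn_start a) (VN i j) (fun zeta : N.+1.-tuple 'I_d => Vtop zeta i j) au ub).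
rewrite -/(A2 i j u) [A2 i j u + A3 i j u]addrC !addrA; congr (_ + _).
have VNr r : (r < N)%N -> is_Ck r (fun y => V y i j).
  by move=> rN; apply: is_Ck_le (VN i j); exact: ltnW (leqW rN).
have hc (r : 'I_N) : homog a x V z r (fun y => V y i j) u =
    \sum_(p < N) \sum_(zeta : p.-tuple 'I_d) dV zeta i j z * comp_int a x V z (rev zeta) r u.
  apply: (homog_comp z ab be2 be1 hx VN _ (ltn_ord r) (VNr _ (ltn_ord r)) au ub).
  exact: ltnW (leqW (ltn_ord r)).
rewrite (eq_bigr _ (fun r _ => hc r)) exchange_big /=.
have hQ (p : 'I_N) : \sum_(r < N) \sum_(zeta : p.-tuple 'I_d)
    dV zeta i j z * comp_int a x V z (rev zeta) r u =
    \sum_(zeta : p.-tuple 'I_d) dV zeta i j z *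
      (Eint1 (Taylor x V N) zeta a u z - Q x V N N.-1 zeta a u z).
  rewrite exchange_big /=; apply: eq_bigr => zeta _.
  by rewrite -mulr_sumr (Eint1_sub_Q V z ab be2 be1 hx).
rewrite (eq_bigr _ (fun p _ => hQ p)) /A1 /A3.
pose e p := \sum_(zeta : p.-tuple 'I_d) dV zeta i j z * Eint1 (Taylor x V N) zeta a u z.
pose q p := \sum_(zeta : p.-tuple 'I_d) dV zeta i j z * Q x V N N.-1 zeta a u z.
pose w p := \sum_(zeta : p.-tuple 'I_d) dV zeta i j z * Eint1 (TaylorOn x V Gt) zeta a u z.
have eq (p : 'I_N) : \sum_(zeta : p.-tuple 'I_d) dV zeta i j z *
    (Eint1 (Taylor x V N) zeta a u z - Q x V N N.-1 zeta a u z) = e p - q p.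
  by rewrite /e /q -sumrB; apply: eq_bigr => zeta _; rewrite mulrBr.
have eN : \sum_(zeta : N.-tuple 'I_d) Eint1 (Taylor x V N) zeta a u z * dV zeta i j z = e N.
  by apply: eq_bigr => zeta _; rewrite mulrC.
have qs : \sum_(1 <= p < N) \sum_(zeta : p.-tuple 'I_d) Q x V N N.-1 zeta a u z * dV zeta i j z
    = \sum_(1 <= p < N) q p.
  by apply: eq_bigr => p _; apply: eq_bigr => zeta _; rewrite mulrC.
have we : \sum_(1 <= p < N.+1) \sum_(zeta : p.-tuple 'I_d)
    (Eint1 (TaylorOn x V Gt) zeta a u z - Eint1 (Taylor x V N) zeta a u z) * dV zeta i j z
    = \sum_(1 <= p < N.+1) (w p - e p).
  apply: eq_bigr => p _; rewrite /w /e -sumrB; apply: eq_bigr => zeta _.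
  by rewrite mulrC mulrBr.
rewrite (eq_bigr _ (fun p _ => eq p)) eN qs we.
rewrite -(big_mkord xpredT w) -(big_mkord xpredT (fun p => e p - q p)).
rewrite (big_ltn (ltn0Sn N)) (big_ltn N0) !sumrB (big_nat_recr N 1 e)//=.
have w0 : w 0 = V z i j.
  by rewrite /w (big_tuple0 (fun zeta => dV zeta i j z * Eint1 (TaylorOn x V Gt) zeta a u z)) mulr1.
have e0 : e 0 = V z i j.
  by rewrite /e (big_tuple0 (fun zeta => dV zeta i j z * Eint1 (Taylor x V N) zeta a u z)) mulr1.
have q0 : q 0 = 0.
  apply: big1 => zeta _; rewrite /Q big_pred0 ?mulr0// => g.
  by rewrite (tuple0 g) /= big_nil.
rewrite w0 e0 q0; ring.
Qed.

(** Expand V along the scheme. The integrand of R2 is the remainder of Taylor's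
    formula, that of R3 corrects the iterated integrals of the scheme into those of
    the full expansion, and that of R1 collects their terms of total order N or more.
    The terms of lower order are, by [homog_comp], the expansion of V, and they
    integrate to the full expansion of the solution, from which R4 leads back. *)
Lemma one_step_error t i : a <= t -> t <= b ->
  \sum_j RSint (fun u => V (Z u) i j) (fun u => x u j 0) a t =
  TaylorOn x V Gt a t z i 0 + (R1 x V N a t z i 0 + (R2 x V N Gt a t z i 0 +
    (R3 x V N Gt a t z i 0 + R4 x V N Gt a t z i 0))).
Proof.
move=> at_ tb; rewrite R1_coord// R2_coord// R3_coord//.
have kh j : okf a b be (fun u => \sum_(r < N) homog a x V z r (fun y => V y i j) u).
  by apply: okf_hol => //; apply: hol_sum => r _; exact: hol_homog.
have S j : RSint (fun u => V (Z u) i j) (fun u => x u j 0) a t =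
   \sum_(r < N) RSint (homog a x V z r (fun y => V y i j)) (fun u => x u j 0) a t +
   (RSint (A1 i j) (fun u => x u j 0) a t + (RSint (A2 i j) (fun u => x u j 0) a t +
    RSint (A3 i j) (fun u => x u j 0) a t)).
  have k23 := okfD ab (kA2 i j) (kA3 i j); have k123 := okfD ab (kA1 i j) k23.
  rewrite (RSint_congr (V_along i j) (okfD ab (kh j) k123) (hx j))//.
  rewrite (RSint_add (kh j) k123 (hx j))// (RSint_add (kA1 i j) k23 (hx j))//.
  rewrite (RSint_add (kA2 i j) (kA3 i j) (hx j))//.
  by rewrite (@RSint_sum _ a b be)// => r; exact: okf_homog.
rewrite (eq_bigr _ (fun j _ => S j)) !big_split /=.
have -> : \sum_j \sum_(r < N) RSint (homog a x V z r (fun y => V y i j)) (fun u => x u j 0) a t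
   = Taylor x V N a t z i 0.
  rewrite Taylor_homog big_add1 big_mkord exchange_big /=; apply: eq_bigr => r _.
  rewrite (homogS V z ab be2 be1 hx)//; apply: eq_bigr => j _.
  by rewrite vfield_coord.
rewrite /R4 !mxE; ring.
Qed.

End OneStep.

(** * The grid and paths glued along it *)

Section GridPaths.
Context {R : realType}.
Variables (T : R) (n : nat).
Hypotheses (T_gt0 : 0 < T) (n_gt0 : (0 < n)%N).

Lemma grid0 : grid T n 0 = 0.
Proof. by rewrite /grid !mul0r. Qed.

Lemma gridn : grid T n n = T.
Proof. by rewrite /grid mulrAC divff ?mul1r// pnatr_eq0 -lt0n. Qed.

Lemma ler_grid k l : (k <= l)%N -> grid T n k <= grid T n l.
Proof.
move=> kl; rewrite /grid ler_pM2r ?invr_gt0 ?ltr0n// ler_pM2r// ler_nat.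
exact: kl.
Qed.

Lemma ltr_grid k l : (k < l)%N -> grid T n k < grid T n l.
Proof.
by move=> kl; rewrite /grid ltr_pM2r ?invr_gt0 ?ltr0n// ltr_pM2r// ltr_nat.
Qed.

Lemma grid_ge0 k : 0 <= grid T n k.
Proof. by rewrite -grid0 ler_grid. Qed.

Lemma grid_leT k : (k <= n)%N -> grid T n k <= T.
Proof. by move=> kn; rewrite -[leRHS]gridn ler_grid. Qed.

Lemma grid_index_itv t : 0 <= t ->
  grid T n (grid_index T n t) <= t < grid T n (grid_index T n t).+1.
Proof.
move=> t0; have h0 : 0 <= n%:R * t / T by rewrite divr_ge0 ?mulr_ge0// ltW.
have /andP[h1 h2] := truncn_itv h0.
have n0 : 0 < n%:R :> R by rewrite ltr0n.
rewrite /grid ler_pdivrMr// ltr_pdivlMr// /grid_index.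
move: h1 h2; rewrite ler_pdivlMr// ltr_pdivrMr// => h1 h2.
by rewrite [t * _]mulrC h1.
Qed.

Lemma grid_index_eq k t : grid T n k <= t -> t < grid T n k.+1 -> grid_index T n t = k.
Proof.
move=> kt tk; have t0 : 0 <= t by apply: le_trans kt; exact: grid_ge0.
have /andP[h1 h2] := grid_index_itv t0.
apply/eqP; rewrite eqn_leq; apply/andP; split.
  by rewrite leqNgt; apply/negP => /ler_grid; lra.
by rewrite leqNgt; apply/negP => /ler_grid; lra.
Qed.

Lemma grid_index_le t : t <= T -> 0 <= t -> (grid_index T n t <= n)%N.
Proof.
move=> tT t0; have /andP[h1 h2] := grid_index_itv t0.
by rewrite leqNgt; apply/negP => /ltr_grid; rewrite gridn; lra.
Qed.

(** The index of T itself is n, and no cell starts there. *)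
Lemma grid_cell t : 0 <= t -> t <= T ->
  (grid_index T n t < n)%N \/ t = grid T n (grid_index T n t).
Proof.
move=> t0 tT; have := grid_index_le tT t0; rewrite leq_eqVlt => /orP[/eqP E|]; last by left.
right; have /andP[h1 h2] := grid_index_itv t0; move: h1; rewrite {1}E gridn => h1.
by rewrite E gridn; lra.
Qed.

Lemma hol_grid be (f : R -> R) : 0 < be ->
  (forall k, (k < n)%N -> hol (grid T n k) (grid T n k.+1) be f) -> hol 0 T be f.
Proof.
move=> be0 H; suff K k : (k <= n)%N -> hol 0 (grid T n k) be f.
  by rewrite -gridn; exact: K.
elim: k => [_|k IH kn].
  rewrite grid0; exists 0 => // s t s0 st t0.
  have -> : s = t by lra.
  by rewrite subrr normr0 mul0r.
apply: (hol_cat be0 (grid_ge0 k) (ler_grid (leqnSn k))); last exact: H.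
by apply: IH; exact: ltnW.
Qed.

Section Glue.
Context {d : nat}.
Variables (Re : R -> R -> 'cV[R]_d -> 'cV[R]_d) (yn : R -> 'cV[R]_d).
Hypothesis Re_start : forall s y, Re s s y = 0.

(** At the right end of a cell the index has already changed; there the new term
    vanishes by Re_start, so the formula of the cell remains valid. *)
Lemma glue_grid_cell k t : (k < n)%N -> grid T n k <= t -> t <= grid T n k.+1 ->
  glue_grid T n Re yn t =
  \sum_(0 <= l < k) Re (grid T n l) (grid T n l.+1) (yn (grid T n l))
  + Re (grid T n k) t (yn (grid T n k)).
Proof.
move=> kn kt; rewrite le_eqVlt => /orP[/eqP ->|tk]; last first.
  by rewrite /glue_grid /Defs.eta (grid_index_eq kt tk).
have E : grid_index T n (grid T n k.+1) = k.+1.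
  by apply: grid_index_eq => //; exact: ltr_grid.
by rewrite /glue_grid /Defs.eta E Re_start addr0 big_nat_recr.
Qed.

Variable be : R.
Hypotheses (be2 : 2^-1 < be) (be1 : be <= 1).
Hypothesis Re_hol : forall k, (k < n)%N ->
  vhol (grid T n k) (grid T n k.+1) be (fun t => Re (grid T n k) t (yn (grid T n k))).

Let be0 : 0 < be. Proof. by move: be2; lra. Qed.

Lemma vhol_glue_grid : vhol 0 T be (glue_grid T n Re yn).
Proof.
move=> i; apply: hol_grid => // k kn.
apply: (@hol_ext _ _ _ _ (fun t => (\sum_(0 <= l < k) Re (grid T n l) (grid T n l.+1)
   (yn (grid T n l))) i 0 + Re (grid T n k) t (yn (grid T n k)) i 0)).
  by move=> t kt tk; rewrite (glue_grid_cell kn kt tk) mxE.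
apply: holD; first exact: hol_cst.
exact: (Re_hol kn i).
Qed.

(** In the k-th cell the glued path and Re (grid k) differ by a constant. *)
Lemma RSint_glue_grid (f : R -> R) i t : okf 0 T be f -> 0 <= t -> t <= T ->
  RSint f (fun u => glue_grid T n Re yn u i 0) 0 t =
  \sum_(0 <= k < (grid_index T n t).+1)
    RSint f (fun u => Re (grid T n k) u (yn (grid T n k)) i 0)
      (grid T n k) (Num.min (grid T n k.+1) t).
Proof.
move=> kf t0 tT.
have yi := okf_yint kf (vhol_glue_grid i).
have cell k s : (k < n)%N -> grid T n k <= s -> s <= grid T n k.+1 ->
    RSint f (fun u => glue_grid T n Re yn u i 0) (grid T n k) s =
    RSint f (fun u => Re (grid T n k) u (yn (grid T n k)) i 0) (grid T n k) s.
  move=> kn ks sk.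
  pose c := (\sum_(0 <= l < k) Re (grid T n l) (grid T n l.+1) (yn (grid T n l))) i 0.
  have gE u : grid T n k <= u -> u <= grid T n k.+1 ->
      glue_grid T n Re yn u i 0 = c + Re (grid T n k) u (yn (grid T n k)) i 0.
    by move=> ku uk; rewrite (glue_grid_cell kn ku uk) mxE.
  apply: (@RSint_ext _ (grid T n k) (grid T n k.+1) c) => //.
  have kf' : yint (grid T n k) (grid T n k.+1) f (fun u => glue_grid T n Re yn u i 0).
    by apply: yint_sub yi; [exact: grid_ge0|exact: grid_leT].
  have [h ph] := kf'; exists h; apply: small_ext ph => a u b ka au ub bk.
  by rewrite (gE b) ?(gE a); lra.
have full k : (k <= n)%N -> RSint f (fun u => glue_grid T n Re yn u i 0) 0 (grid T n k) =
    \sum_(0 <= l < k) RSint f (fun u => Re (grid T n l) u (yn (grid T n l)) i 0)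
      (grid T n l) (grid T n l.+1).
  elim: k => [_|k IH kn]; first by rewrite grid0 big_geq// RSintxx.
  rewrite big_nat_recr//= -IH; last exact: ltnW.
  rewrite (RSintD yi (lexx 0) (grid_ge0 k) (ler_grid (leqnSn k)) (grid_leT kn)).
  by rewrite cell//; exact: ler_grid.
set K := grid_index T n t.
have /andP[Kt tK] := grid_index_itv t0; rewrite -/K in Kt tK.
rewrite (RSintD yi (lexx 0) (grid_ge0 K) Kt tT) full; last exact: grid_index_le.
rewrite big_nat_recr//=; congr (_ + _).
  rewrite big_nat [RHS]big_nat; apply: eq_bigr => k /andP[_ kK].
  by rewrite (min_idPl _)//; apply: le_trans Kt; exact: ler_grid.
rewrite (min_idPr (ltW tK)).
have [Kn|tE] := grid_cell t0 tT; first by rewrite cell// ltW.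
have -> : grid T n K = t by [].
by rewrite !RSintxx.
Qed.

End Glue.

End GridPaths.

(** * The global error *)

Section Regularity.
Context {R : realType}.
Implicit Types (a b al be t : R).

Lemma hoelder_on_hol p q a b al (f : R -> 'M[R]_(p, q)) i j :
  hoelder_on a b al f -> hol a b al (fun t => f t i j).
Proof.
move=> [C H]; exists `|C| => // s t as_ st tb.
have sI : a <= s <= b by rewrite as_ /=; lra.
have tI : a <= t <= b by rewrite tb andbT; lra.
have h : `|f t i j - f s i j| <= `|f t - f s|.
  rewrite [leRHS]mx_normrE.
  by have := @le_bigmax _ _ _ 0 (fun ij => `|(f t - f s) ij.1 ij.2|) (i, j); rewrite /= !mxE.
apply: le_trans h _; apply: le_trans (H _ _ sI tI) _.
rewrite ger0_norm ?subr_ge0// ler_wpM2r ?powR_ge0//; exact: ler_norm.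
Qed.

(** Both factors are Hoelder of exponent min(al, be), which together with be still
    exceeds 1. *)
Lemma okf_youngM a b al be f g : a <= b -> 2^-1 < be -> 0 < al -> 1 < al + be ->
  hol a b al f -> hol a b be g -> okf a b be (fun t => f t * g t).
Proof.
move=> ab be2 al0 albe hf hg.
have be0 : 0 < be by lra.
pose al' := Num.min al be.
have al'0 : 0 < al' by rewrite lt_min al0.
apply: (@okf_young _ a b be al') => //.
  by rewrite /al'; case: (leP al be) => _; lra.
apply: holM => //.
  by apply: hol_le hf => //; rewrite ge_min lexx.
by apply: hol_le hg => //; rewrite ge_min lexx orbT.
Qed.

End Regularity.

Section Global.
Context {R : realType} {d m : nat}.
Variables (T be : R) (x : R -> 'cV[R]_m) (Gt : {fset seq 'I_m}) (N : nat).
Variables (V : 'cV[R]_d -> 'M[R]_(d, m)) (y0 : 'cV[R]_d) (y : R -> 'cV[R]_d).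
Variables (n : nat) (yn : R -> 'cV[R]_d) (Phi Psi : R -> 'M[R]_d).
Hypotheses (T_gt0 : 0 < T) (n_gt0 : (0 < n)%N).
Hypotheses (be2 : 2^-1 < be) (be1 : be <= 1) (hx : vhol 0 T be x).
Hypothesis Gt_words : forall g : seq 'I_m, g \in Gt -> (0 < size g)%N.
Hypotheses (N0 : (0 < N)%N) (VN : forall i j, is_Ck N.+1 (fun z => V z i j)).
Hypothesis Vtop : forall (zeta : N.+1.-tuple 'I_d) i j,
  young_reg be (partials zeta (fun z => V z i j)).
Hypothesis y_young : exists al, [/\ 0 < al, 1 < al + be & vhol 0 T al y].
Hypothesis y_sol : forall t : R, 0 <= t <= T ->
  y t = y0 + RSint_mulmx (fun s => V (y s)) x 0 t.
Hypothesis yn_0 : yn 0 = y0.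
Hypothesis yn_step : forall k t, (k < n)%N -> grid T n k <= t <= grid T n k.+1 ->
  yn t = yn (grid T n k) + TaylorOn x V Gt (grid T n k) t (yn (grid T n k)).
Hypothesis Phi_young : exists al, [/\ 0 < al, 1 < al + be &
  forall i l, hol 0 T al (fun t => Phi t i l)].
Hypothesis Psi_young : exists al, [/\ 0 < al, 1 < al + be &
  forall i l, hol 0 T al (fun t => Psi t i l)].
Hypothesis Phi_sol : forall t : R, 0 <= t <= T ->
  Phi t = 1%:M + \sum_(j < m)
    RSint_mx (fun s => Vdot V j (y s) (yn s) *m Phi s) (fun s => x s j 0) 0 t.
Hypothesis Psi_sol : forall t : R, 0 <= t <= T ->
  Psi t = 1%:M - \sum_(j < m)
    RSint_mx (fun s => Psi s *m Vdot V j (y s) (yn s)) (fun s => x s j 0) 0 t.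

Let be0 : 0 < be. Proof. by move: be2; lra. Qed.
Let T0 : 0 <= T. Proof. exact: ltW. Qed.

Let tI t : 0 <= t -> t <= T -> 0 <= t <= T. Proof. by move=> -> ->. Qed.

Let V1 i j : is_Ck 1 (fun z => V z i j). Proof. exact: is_Ck_le (VN i j). Qed.

Let y_coord t i : 0 <= t -> t <= T ->
  y t i 0 = y0 i 0 + \sum_j RSint (fun s => V (y s) i j) (fun s => x s j 0) 0 t.
Proof. by move=> t0 tT; rewrite y_sol ?tI// mxE RSint_mulmx_coord. Qed.

(** The solutions inherit the regularity of x from the equations they solve. *)
Lemma vhol_y : vhol 0 T be y.
Proof.
have [al [al0 albe hy]] := y_young => i.
apply: (@hol_ext _ _ _ _ (fun t => y0 i 0 +
    \sum_j RSint (fun s => V (y s) i j) (fun s => x s j 0) 0 t)).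
  by move=> t *; rewrite y_coord.
apply: holD; first exact: hol_cst.
apply: hol_sum => j _; apply: hol_RSint => //.
exact: okf_young T0 be0 al0 albe (hol_comp al0 (V1 i j) hy).
Qed.

Let hx_cell k : (k < n)%N -> vhol (grid T n k) (grid T n k.+1) be x.
Proof.
move=> kn i; apply: hol_sub (hx i); first exact: grid_ge0.
exact: grid_leT.
Qed.

Lemma vhol_yn : vhol 0 T be yn.
Proof.
move=> i; apply: (hol_grid (n := n)) => // k kn.
apply: (@hol_ext _ _ _ _ (fun t => yn (grid T n k) i 0 +
    TaylorOn x V Gt (grid T n k) t (yn (grid T n k)) i 0)).
  by move=> t kt tk; rewrite [in RHS](yn_step kn) ?mxE// kt.
apply: holD; first exact: hol_cst.
exact: (hol_TaylorOn V (yn (grid T n k)) Gt (ler_grid T_gt0 n_gt0 (leqnSn k)) be2 be1 (hx_cell kn) i).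
Qed.

Let J j s : 'M[R]_d := Vdot V j (y s) (yn s).

Lemma hol_J j i l : hol 0 T be (fun s => J j s i l).
Proof.
have G1 : is_Ck 1 (partial l (fun z => V z i j)).
  by apply: is_Ck_partial; apply: is_Ck_le (VN i j).
apply: hol_ext (hol_segment_average be0 G1 vhol_y vhol_yn) => s _ _.
rewrite /J /Vdot mxE; congr (Rintegral _ _ _); apply/funext => lam.
by rewrite mxE.
Qed.

Lemma Vdot_increment j i (p q : 'cV[R]_d) :
  V p i j - V q i j = \sum_l Vdot V j p q i l * (p l 0 - q l 0).
Proof.
rewrite (segment_increment p q (V1 i j)); apply: eq_bigr => l _; congr (_ * _).
by rewrite /Vdot mxE; congr (Rintegral _ _ _); apply/funext => lam; rewrite mxE.
Qed.

Let okPhiJ j i l : okf 0 T be (fun s => (J j s *m Phi s) i l).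
Proof.
have [al [al0 albe hP]] := Phi_young.
apply: (@okf_ext _ _ _ _ (fun s => \sum_k Phi s k l * J j s i k)).
  by move=> s *; rewrite mxE; apply: eq_bigr => k _; rewrite mulrC.
apply: okf_sum => // k; apply: (okf_youngM T0 be2 al0 albe) => //; exact: hol_J.
Qed.

Let okPsiJ j i l : okf 0 T be (fun s => (Psi s *m J j s) i l).
Proof.
have [al [al0 albe hP]] := Psi_young.
apply: (@okf_ext _ _ _ _ (fun s => \sum_k Psi s i k * J j s k l)).
  by move=> s *; rewrite mxE.
apply: okf_sum => // k; apply: (okf_youngM T0 be2 al0 albe) => //; exact: hol_J.
Qed.

Let Phi_coord t i l : 0 <= t -> t <= T -> Phi t i l =
  (i == l)%:R + \sum_j RSint (fun s => (J j s *m Phi s) i l) (fun s => x s j 0) 0 t.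
Proof.
move=> t0 tT; rewrite Phi_sol ?tI// mxE mxE summxE; congr (_ + _).
by apply: eq_bigr => j _; rewrite mxE.
Qed.

Let Psi_coord t i l : 0 <= t -> t <= T -> Psi t i l =
  (i == l)%:R + \sum_j RSint (fun s => - (Psi s *m J j s) i l) (fun s => x s j 0) 0 t.
Proof.
move=> t0 tT; rewrite Psi_sol ?tI// mxE mxE; congr (_ + _).
rewrite mxE summxE -sumrN; apply: eq_bigr => j _; rewrite mxE.
have [h ph] := okf_yint (okPsiJ j i l) (hx j).
have phN : prim 0 T (fun s => - (Psi s *m J j s) i l) (fun s => x s j 0) (fun s => - h s).
  by apply: small_ext (smallZ (-1) ph) => s u v *; rewrite -/(J j u); ring.
rewrite (RSint_prim ph)// (RSint_prim phN)//; ring.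
Qed.

Let okPsiJN j i l : okf 0 T be (fun s => - (Psi s *m J j s) i l).
Proof.
have [al [al0 albe hP]] := Psi_young.
apply: (@okf_ext _ _ _ _ (fun s => \sum_k Psi s i k * (-1 * J j s k l))).
  by move=> s *; rewrite mxE -sumrN; apply: eq_bigr => k _; rewrite mulN1r mulrN.
apply: okf_sum => // k; apply: (okf_youngM T0 be2 al0 albe) => //; apply: holZ; exact: hol_J.
Qed.

Lemma hol_Phi i l : hol 0 T be (fun t => Phi t i l).
Proof.
apply: (@hol_ext _ _ _ _ (fun t => (i == l)%:R +
    \sum_j RSint (fun s => (J j s *m Phi s) i l) (fun s => x s j 0) 0 t)).
  by move=> t *; rewrite Phi_coord.
apply: holD; first exact: hol_cst.
by apply: hol_sum => j _; apply: hol_RSint.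
Qed.

Lemma hol_Psi i l : hol 0 T be (fun t => Psi t i l).
Proof.
apply: (@hol_ext _ _ _ _ (fun t => (i == l)%:R +
    \sum_j RSint (fun s => - (Psi s *m J j s) i l) (fun s => x s j 0) 0 t)).
  by move=> t *; rewrite Psi_coord.
apply: holD; first exact: hol_cst.
by apply: hol_sum => j _; apply: hol_RSint.
Qed.

Lemma sgerm_Phi i l : sgerm 0 T (index_enum 'I_m)
  (fun j s => (J j s *m Phi s) i l) (fun j s => x s j 0) (fun t => Phi t i l).
Proof. apply: (@sgerm_RSint _ 0 T be) => // t t0 tT; exact: Phi_coord. Qed.

Lemma sgerm_Psi i l : sgerm 0 T (index_enum 'I_m)
  (fun j s => - (Psi s *m J j s) i l) (fun j s => x s j 0) (fun t => Psi t i l).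
Proof. apply: (@sgerm_RSint _ 0 T be) => // t t0 tT; exact: Psi_coord. Qed.

Lemma sgerm_y i : sgerm 0 T (index_enum 'I_m)
  (fun j s => V (y s) i j) (fun j s => x s j 0) (fun t => y t i 0).
Proof.
apply: (@sgerm_RSint _ 0 T be _ _ _ _ _ (y0 i 0)) => //.
  by move=> j; apply: okf_hol => //; exact: (hol_comp be0 (V1 i j) vhol_y).
by move=> t t0 tT; exact: y_coord.
Qed.

(** Psi is an integrating factor: in d(Psi B) = Psi dB + dPsi B the terms with J
    cancel, and Psi dr remains. *)
Lemma integrating_factor q a b (B r : R -> 'M[R]_(d, q)) : 0 <= a -> b <= T ->
  (forall i l, hol a b be (fun t => B t i l)) ->
  (forall i l, small a b (fun s _ t => (B t i l - r t i l) - (B s i l - r s i l)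
     - \sum_j (J j s *m B s) i l * (x t j 0 - x s j 0))) ->
  forall i l, sgerm a b (index_enum 'I_d) (fun p s => Psi s i p) (fun p s => r s p l)
     (fun t => (Psi t *m B t) i l).
Proof.
move=> a0 bT hB dB i l.
have hP p : hol a b be (fun t => Psi t i p) by exact: hol_sub (hol_Psi i p).
have S1 p := germ_prod be2 (hP p) (hB p l).
have S2 p : small a b (fun s _ t => Psi s i p * ((B t p l - r t p l) - (B s p l - r s p l)
     - \sum_j (J j s *m B s) p l * (x t j 0 - x s j 0))).
  have [C C0 PC] := hol_bdd be0 (hP p).
  by apply: (@smallMl _ _ _ C (fun s _ _ => Psi s i p)) (dB p l) => s u t *; apply: PC; lra.
have S3 p : small a b (fun s _ t => B s p l * (Psi t i p - Psi s i p
     - \sum_j - (Psi s *m J j s) i p * (x t j 0 - x s j 0))).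
  have [C C0 BC] := hol_bdd be0 (hB p l).
  apply: (@smallMl _ _ _ C (fun s _ _ => B s p l)); first by move=> s u t *; apply: BC; lra.
  exact: small_sub (sgerm_Psi i p).
have := small_sum (index_enum 'I_d) (fun p (_ : xpredT p) => smallD (S1 p) (smallD (S2 p) (S3 p))).
apply: small_ext => s u t _ _ _ _.
have E : \sum_p Psi s i p * (\sum_j (J j s *m B s) p l * (x t j 0 - x s j 0)) =
    \sum_p B s p l * (\sum_j (Psi s *m J j s) i p * (x t j 0 - x s j 0)).
  transitivity (\sum_j (Psi s *m (J j s *m B s)) i l * (x t j 0 - x s j 0)).
    transitivity (\sum_p \sum_j Psi s i p * (J j s *m B s) p l * (x t j 0 - x s j 0)).
      by apply: eq_bigr => p _; rewrite mulr_sumr; apply: eq_bigr => j _; rewrite mulrA.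
    by rewrite exchange_big /=; apply: eq_bigr => j _; rewrite -mulr_suml [in RHS]mxE.
  transitivity (\sum_p \sum_j (Psi s *m J j s) i p * B s p l * (x t j 0 - x s j 0)).
    rewrite exchange_big /=; apply: eq_bigr => j _; rewrite -mulr_suml mulmxA.
    by rewrite [in LHS]mxE.
  apply: eq_bigr => p _; rewrite mulr_sumr; apply: eq_bigr => j _; ring.
rewrite ![(Psi _ *m B _) i l]mxE -!sumrB.
transitivity (\sum_p (Psi t i p * B t p l - Psi s i p * B s p l - Psi s i p * (r t p l - r s p l)
   - Psi s i p * (\sum_j (J j s *m B s) p l * (x t j 0 - x s j 0))
   + B s p l * (\sum_j (Psi s *m J j s) i p * (x t j 0 - x s j 0)))).
  apply: eq_bigr => p _.
  have -> : \sum_j - (Psi s *m J j s) i p * (x t j 0 - x s j 0) =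
      - \sum_j (Psi s *m J j s) i p * (x t j 0 - x s j 0).
    by rewrite -sumrN; apply: eq_bigr => j _; rewrite mulNr.
  ring.
by rewrite big_split /= sumrB E subrK.
Qed.

(** [integrating_factor] with r = 0. *)
Lemma Psi_Phi t : 0 <= t -> t <= T -> Psi t *m Phi t = 1%:M.
Proof.
move=> t0 tT; apply/matrixP => i l.
have dPhi i' l' : small 0 T (fun s _ t => (Phi t i' l' - (0 : 'M[R]_d) i' l') -
     (Phi s i' l' - (0 : 'M[R]_d) i' l') - \sum_j (J j s *m Phi s) i' l' * (x t j 0 - x s j 0)).
  by apply: small_ext (sgerm_Phi i' l') => s u v *; rewrite mxE !subr0.
have := @integrating_factor d 0 T Phi (fun=> 0) (lexx 0) (lexx T) hol_Phi dPhi i l.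
move=> G; transitivity ((Psi 0 *m Phi 0) i l).
  apply: (@small_const _ 0 T (fun t => (Psi t *m Phi t) i l)) => //.
  apply: small_ext G => s u v *; rewrite big1 ?subr0// => p _.
  by rewrite mxE subrr mulr0.
have -> : Phi 0 = 1%:M.
  apply/matrixP => p q; rewrite Phi_coord// big1 ?addr0 ?mxE// => j _.
  by rewrite RSintxx.
have -> : Psi 0 = 1%:M.
  apply/matrixP => p q; rewrite Psi_coord// big1 ?addr0 ?mxE// => j _.
  by rewrite RSintxx.
by rewrite mulmx1.
Qed.

Let rem k t : 'cV[R]_d := let tk := grid T n k in let z := yn tk in
  R1 x V N tk t z + (R2 x V N Gt tk t z + (R3 x V N Gt tk t z + R4 x V N Gt tk t z)).

Let S (Re : R -> R -> 'cV[R]_d -> 'cV[R]_d) k t : 'cV[R]_d :=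
  RSint_mulmx Psi (fun s => Re (grid T n k) s (yn (grid T n k))) (grid T n k) t.

Let grid_le k : grid T n k <= grid T n k.+1. Proof. exact: ler_grid. Qed.

Let vhol_cell k (f : R -> 'cV[R]_d) : (k < n)%N -> vhol 0 T be f ->
  vhol (grid T n k) (grid T n k.+1) be f.
Proof.
by move=> kn hf i; apply: hol_sub (hf i); [exact: grid_ge0|exact: grid_leT].
Qed.

Let vhol_rem k : (k < n)%N -> vhol (grid T n k) (grid T n k.+1) be (rem k).
Proof.
move=> kn i.
have h1 := vhol_R1 V (yn (grid T n k)) N (grid_le k) be2 be1 (hx_cell kn) i.
have h2 := vhol_R2 (yn (grid T n k)) Gt (grid_le k) be2 be1 (hx_cell kn) Vtop i.
have h3 := vhol_R3 V (yn (grid T n k)) N Gt (grid_le k) be2 be1 (hx_cell kn) i.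
have h4 := vhol_R4 V (yn (grid T n k)) N Gt (grid_le k) be2 be1 (hx_cell kn) i.
by apply: hol_ext (holD h1 (holD h2 (holD h3 h4))) => t *; rewrite !mxE.
Qed.

(** The difference V(y) - V(y^n) is J (y - y^n), and by [one_step_error] the path y^n
    solves the equation of y up to the remainders. *)
Lemma sgerm_error k i (l : 'I_1) : (k < n)%N ->
  small (grid T n k) (grid T n k.+1) (fun s _ t =>
    ((y t - yn t) i l - rem k t i l) - ((y s - yn s) i l - rem k s i l)
    - \sum_j (J j s *m (y s - yn s)) i l * (x t j 0 - x s j 0)).
Proof.
move=> kn; rewrite (ord1 l).
have hyn := vhol_cell kn vhol_yn.
have kV j : okf (grid T n k) (grid T n k.+1) be (fun s => V (yn s) i j).
  by apply: okf_hol => //; exact: (hol_comp be0 (V1 i j) hyn).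
have dyn : sgerm (grid T n k) (grid T n k.+1) (index_enum 'I_m)
    (fun j s => V (yn s) i j) (fun j s => x s j 0) (fun t => yn t i 0 + rem k t i 0).
  apply: (@sgerm_RSint _ _ _ be _ _ _ _ _ (yn (grid T n k) i 0)) => //.
    by move=> j; exact: hx_cell.
  move=> t kt tk.
  have := one_step_error (yn (grid T n k)) (grid_le k) be2 be1 (hx_cell kn) N0 VN Vtop
    Gt_words i kt tk.
  have tI' : grid T n k <= t <= grid T n k.+1 by rewrite kt.
  rewrite (yn_step kn tI').
  have -> : \sum_j RSint (fun u => V (yn (grid T n k) + TaylorOn x V Gt (grid T n k) u
        (yn (grid T n k))) i j) (fun u => x u j 0) (grid T n k) t =
     \sum_j RSint (fun u => V (yn u) i j) (fun u => x u j 0) (grid T n k) t.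
    apply: eq_bigr => j _; apply: (RSint_congr _ (kV j) (hx_cell kn j)) => //.
    by move=> u ku uk; rewrite -(yn_step (t := u) kn) ?ku.
  by move=> ->; rewrite /rem !mxE; ring.
have dy := small_sub (grid_ge0 T_gt0 n_gt0 k) (grid_leT T_gt0 n_gt0 kn) (sgerm_y i).
apply: small_ext (smallD dy (smallZ (-1) dyn)) => s u t *.
have E : \sum_j (J j s *m (y s - yn s)) i 0 * (x t j 0 - x s j 0) =
   \sum_j V (y s) i j * (x t j 0 - x s j 0) - \sum_j V (yn s) i j * (x t j 0 - x s j 0).
  rewrite -sumrB; apply: eq_bigr => j _; rewrite -mulrBl Vdot_increment mxE.
  by congr (_ * _); apply: eq_bigr => p _; rewrite !mxE.
rewrite E !mxE; ring.
Qed.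

Let Psi_error_cell k t : (k < n)%N -> grid T n k <= t -> t <= grid T n k.+1 ->
  Psi t *m (y t - yn t) = Psi (grid T n k) *m (y (grid T n k) - yn (grid T n k))
  + (S (R1 x V N) k t + (S (R2 x V N Gt) k t + (S (R3 x V N Gt) k t + S (R4 x V N Gt) k t))).
Proof.
move=> kn kt tk.
have k0 := grid_ge0 T_gt0 n_gt0 k; have kT := grid_leT T_gt0 n_gt0 kn.
have hw i l : hol (grid T n k) (grid T n k.+1) be (fun t => (y t - yn t) i l).
  rewrite (ord1 l).
  apply: (@hol_ext _ _ _ _ (fun t => y t i 0 + -1 * yn t i 0)).
    by move=> s *; rewrite !mxE mulN1r.
  by apply: holD; [|apply: holZ]; apply: vhol_cell => //; [exact: vhol_y|exact: vhol_yn].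
have kP i l : okf (grid T n k) (grid T n k.+1) be (fun t => Psi t i l).
  by apply: okf_hol => //; apply: hol_sub (hol_Psi i l).
apply/colP => i.
have := @integrating_factor 1 _ _ (fun t => y t - yn t) (rem k) k0 kT hw
  (fun i l => sgerm_error i l kn) i 0.
move/(sgermP (grid_le k) (kP i) (fun l => vhol_rem kn l)) => /(_ t kt tk) ->.
rewrite [RHS]mxE; congr (_ + _); rewrite /S !mxE -!big_split /=.
apply: eq_bigr => l _.
have h1 := vhol_R1 V (yn (grid T n k)) N (grid_le k) be2 be1 (hx_cell kn) l.
have h2 := vhol_R2 (yn (grid T n k)) Gt (grid_le k) be2 be1 (hx_cell kn) Vtop l.
have h3 := vhol_R3 V (yn (grid T n k)) N Gt (grid_le k) be2 be1 (hx_cell kn) l.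
have h4 := vhol_R4 V (yn (grid T n k)) N Gt (grid_le k) be2 be1 (hx_cell kn) l.
have h34 := holD h3 h4; have h234 := holD h2 h34.
rewrite -(RSint_addg (kP i l) h3 h4)// -(RSint_addg (kP i l) h2 h34)//.
rewrite -(RSint_addg (kP i l) h1 h234)//.
by congr (RSint _ _ _ _); apply/funext => s; rewrite /rem !mxE.
Qed.

(** Integrate d(Psi (y - y^n)) = Psi dr over the cells up to t. *)
Lemma Psi_error t : 0 <= t -> t <= T ->
  Psi t *m (y t - yn t) = \sum_(0 <= k < (grid_index T n t).+1)
   \sum_(Re <- [:: R1 x V N; R2 x V N Gt; R3 x V N Gt; R4 x V N Gt])
     RSint_mulmx Psi (fun s => Re (grid T n k) s (yn (grid T n k)))
       (grid T n k) (Num.min (grid T n k.+1) t).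
Proof.
move=> t0 tT.
pose SS k s := S (R1 x V N) k s + (S (R2 x V N Gt) k s + (S (R3 x V N Gt) k s + S (R4 x V N Gt) k s)).
transitivity (\sum_(0 <= k < (grid_index T n t).+1) SS k (Num.min (grid T n k.+1) t)); last first.
  by apply: eq_bigr => k _; rewrite !big_cons big_nil addr0.
have full k : (k <= n)%N -> Psi (grid T n k) *m (y (grid T n k) - yn (grid T n k)) =
    \sum_(0 <= l < k) SS l (grid T n l.+1).
  elim: k => [_|k IH kn].
    rewrite big_geq// grid0 yn_0; apply/colP => i.
    rewrite (_ : y 0 - y0 = 0) ?mulmx0//.
    apply/colP => p; rewrite !mxE y_coord// big1 ?addr0 ?subrr// => j _.
    by rewrite RSintxx.
  rewrite big_nat_recr//= -IH; last exact: ltnW.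
  by rewrite (Psi_error_cell kn).
set K := grid_index T n t.
have /andP[Kt tK] := grid_index_itv T_gt0 n_gt0 t0; rewrite -/K in Kt tK.
rewrite big_nat_recr//= (min_idPr (ltW tK)).
have -> : \sum_(0 <= k < K) SS k (Num.min (grid T n k.+1) t) =
    \sum_(0 <= k < K) SS k (grid T n k.+1).
  rewrite big_nat [RHS]big_nat; apply: eq_bigr => k /andP[_ kK].
  by rewrite (min_idPl _)//; apply: le_trans Kt; exact: ler_grid.
rewrite -full; last exact: grid_index_le.
have [Kn|tE] := grid_cell T_gt0 n_gt0 t0 tT.
  by rewrite (Psi_error_cell Kn)// ltW.
have <- : t = grid T n K by [].
have Stt Re : S Re K t = 0.
  apply/colP => i; rewrite /S mxE [RHS]mxE; apply: big1 => l _.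
  by rewrite -/K -tE RSintxx.
by rewrite /SS !Stt !addr0.
Qed.

End Global.

Unset Implicit Arguments.

Theorem theorem3p11 (R : realType) (d m : nat) (T beta : R) (x : R -> 'cV[R]_m)
    (Gt : {fset seq 'I_m}) (N : nat) (V : 'cV[R]_d -> 'M[R]_(d, m))
    (y0 : 'cV[R]_d) (y : R -> 'cV[R]_d) (n : nat) (yn : R -> 'cV[R]_d)
    (Phi Psi : R -> 'M[R]_d)
    (T_gt0 : 0 < T)
    (beta_gt : 2^-1 < beta)
    (x_hoelder : hoelder_on 0 T beta x)
    (Gt_neq0 : Gt != fset0)
    (Gt_words : forall g : seq 'I_m, g \in Gt -> (0 < size g)%N)
    (N_def : N = (\max_(g <- Gt) size g)%N)
    (V_Ck : forall i j, is_Ck N.+1 (fun z => V z i j))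
    (V_hoelder : beta < 1 -> exists2 gam : R, 1 < beta * (1 + gam) &
       forall (zeta : N.+1.-tuple 'I_d) i j,
         loc_hoelder gam (partials zeta (fun z => V z i j)))
    (y_young : young_path T beta y)
    (y_sol : forall t : R, 0 <= t <= T ->
       y t = y0 + RSint_mulmx (fun s => V (y s)) x 0 t)
    (n_gt0 : (0 < n)%N)
    (yn_0 : yn 0 = y0)
    (yn_step : forall k t, (k < n)%N -> grid T n k <= t <= grid T n k.+1 ->
       yn t = yn (grid T n k) + TaylorOn x V Gt (grid T n k) t (yn (grid T n k)))
    (Phi_young : young_path T beta Phi)
    (Phi_sol : forall t : R, 0 <= t <= T ->
       Phi t = 1%:M + \sum_(j < m)
         RSint_mx (fun s => Vdot V j (y s) (yn s) *m Phi s) (fun s => x s j 0) 0 t)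
    (Psi_young : young_path T beta Psi)
    (Psi_sol : forall t : R, 0 <= t <= T ->
       Psi t = 1%:M - \sum_(j < m)
         RSint_mx (fun s => Psi s *m Vdot V j (y s) (yn s)) (fun s => x s j 0) 0 t) :
  forall t : R, 0 <= t <= T ->
    y t - yn t =
      \sum_(Re <- [:: R1 x V N; R2 x V N Gt; R3 x V N Gt; R4 x V N Gt])
        Phi t *m \sum_(0 <= k < (grid_index T n t).+1)
          RSint_mulmx Psi (fun s => Re (grid T n k) s (yn (grid T n k)))
            (grid T n k) (Num.min (grid T n k.+1) t)
    /\
    y t - yn t =
      \sum_(Re <- [:: R1 x V N; R2 x V N Gt; R3 x V N Gt; R4 x V N Gt])
        Phi t *m RSint_mulmx Psi (glue_grid T n Re yn) 0 t.
Proof.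
(* Beyond exponent 1 a path is constant; at exponent 1, continuity of the highest
   derivatives is all the regularity that the integrals need. *)
pose be := Num.min beta 1.
have be2 : 2^-1 < be by rewrite lt_min beta_gt /=; lra.
have be1 : be <= 1 by rewrite ge_min lexx orbT.
have be0 : 0 < be by lra.
have beb : be <= beta by rewrite ge_min lexx.
have hx : vhol 0 T be x by move=> j; apply: hol_le (hoelder_on_hol j 0 x_hoelder).
have N0 : (0 < N)%N.
  have [g gG] := fset0Pn _ Gt_neq0.
  rewrite N_def (leq_trans (Gt_words g gG))//.
  exact: (@leq_bigmax_seq _ _ xpredT size).
have al_be al : 0 < al -> 1 < al + beta -> 1 < al + be.
  by move=> al0 ab; rewrite /be; case: (leP beta 1) => _; lra.
have Vtop (zeta : N.+1.-tuple 'I_d) i j : young_reg be (partials zeta (fun z => V z i j)).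
  split; first by have [] := V_Ck i j zeta; rewrite size_tuple.
  have [b1|b1] := ltP beta 1; last by left; rewrite /be (min_idPr b1).
  right; have [gam bg Vg] := V_hoelder b1; exists gam; last exact: Vg.
  by rewrite /be (min_idPl (ltW b1)).
have y_young' : exists al, [/\ 0 < al, 1 < al + be & vhol 0 T al y].
  have [al [al0 ab hy]] := y_young; exists al; split => //; first exact: al_be.
  by move=> i; exact: hoelder_on_hol hy.
have mx_young (F : R -> 'M[R]_d) : young_path T beta F ->
    exists al, [/\ 0 < al, 1 < al + be & forall i l, hol 0 T al (fun t => F t i l)].
  move=> [al [al0 ab hF]]; exists al; split => //; first exact: al_be.
  by move=> i l; exact: hoelder_on_hol hF.
have Phi_y := mx_young _ Phi_young; have Psi_y := mx_young _ Psi_young.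
move=> t /andP[t0 tT].
have PP : Phi t *m Psi t = 1%:M.
  apply: mulmx1C.
  exact: (Psi_Phi T_gt0 n_gt0 be2 be1 hx N0 V_Ck y_young' y_sol yn_step Phi_y Psi_y
    Phi_sol Psi_sol t0 tT).
have err := Psi_error T_gt0 n_gt0 be2 be1 hx Gt_words N0 V_Ck Vtop y_young' y_sol yn_0
  yn_step Psi_y Psi_sol t0 tT.
have first : y t - yn t =
      \sum_(Re <- [:: R1 x V N; R2 x V N Gt; R3 x V N Gt; R4 x V N Gt])
        Phi t *m \sum_(0 <= k < (grid_index T n t).+1)
          RSint_mulmx Psi (fun s => Re (grid T n k) s (yn (grid T n k)))
            (grid T n k) (Num.min (grid T n k.+1) t).
  by rewrite -mulmx_sumr exchange_big /= -err mulmxA PP mul1mx.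
split=> //; rewrite first.
have hP i l : okf 0 T be (fun t => Psi t i l).
  apply: okf_hol => //; first exact: ltW.
  exact: (hol_Psi T_gt0 n_gt0 be2 be1 hx N0 V_Ck y_young' y_sol yn_step Psi_y Psi_sol).
have hxc k : (k < n)%N -> vhol (grid T n k) (grid T n k.+1) be x.
  move=> kn i; apply: hol_sub (hx i); first exact: grid_ge0.
  exact: grid_leT.
have glue Re : (forall s z, Re s s z = 0) -> (forall k, (k < n)%N ->
    vhol (grid T n k) (grid T n k.+1) be (fun t => Re (grid T n k) t (yn (grid T n k)))) ->
    \sum_(0 <= k < (grid_index T n t).+1)
          RSint_mulmx Psi (fun s => Re (grid T n k) s (yn (grid T n k)))
            (grid T n k) (Num.min (grid T n k.+1) t) =
    RSint_mulmx Psi (glue_grid T n Re yn) 0 t.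
  move=> Re0 hRe; apply/colP => i; rewrite summxE [RHS]mxE.
  under [RHS]eq_bigr => l _ do
    rewrite (RSint_glue_grid T_gt0 n_gt0 Re0 be2 hRe l (hP i l) t0 tT).
  by rewrite exchange_big /=; apply: eq_bigr => k _; rewrite mxE.
have mulmx_start p q r (F : R -> 'M[R]_(p, q)) (G : R -> 'M[R]_(q, r)) s :
    RSint_mulmx F G s s = 0.
  by apply/matrixP => i j; rewrite !mxE big1// => l _; rewrite RSintxx.
have grid_le k : grid T n k <= grid T n k.+1 by exact: ler_grid.
have z1 s z : R1 x V N s s z = 0.
  by rewrite /R1 !big1 ?addr0// => p _; rewrite ?big1// => *; rewrite mulmx_start.
have z2 s z : R2 x V N Gt s s z = 0.
  by rewrite /R2 big1// => zeta _; rewrite mulmx_start.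
have z3 s z : R3 x V N Gt s s z = 0.
  by rewrite /R3 big1// => p _; rewrite big1// => zeta _; rewrite mulmx_start.
have z4 s z : R4 x V N Gt s s z = 0.
  by rewrite /R4 Taylor_start (TaylorOn_start x V z Gt_words) subr0.
have g1 := glue _ z1 (fun k kn =>
  vhol_R1 V (yn (grid T n k)) N (grid_le k) be2 be1 (hxc k kn)).
have g2 := glue _ z2 (fun k kn =>
  vhol_R2 (yn (grid T n k)) Gt (grid_le k) be2 be1 (hxc k kn) Vtop).
have g3 := glue _ z3 (fun k kn =>
  vhol_R3 V (yn (grid T n k)) N Gt (grid_le k) be2 be1 (hxc k kn)).
have g4 := glue _ z4 (fun k kn =>
  vhol_R4 V (yn (grid T n k)) N Gt (grid_le k) be2 be1 (hxc k kn)).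
by rewrite 4!big_cons big_nil g1 g2 g3 g4 4!big_cons big_nil.
Qed.
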